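(* Let $G$ be a connected real Lie group and let $R \ge 0$. Then the locally convex algebra $\mathscr{E}_R(G)$ of $R$-entire functions on $G$ (with pointwise multiplication) is (i) a Fréchet algebra; (ii) nuclear; (iii) a Montel space, i.e. every bounded and closed subset of $\mathscr{E}_R(G)$ is compact; (iv) separable and reflexive.
   Context: All functions are complex-valued. $G$ is a connected real Lie group of dimension $n$ with Lie algebra $\mathfrak{g}=T_{\mathrm e}G$, unit $\mathrm e$, and a fixed basis $(e_1,\dots,e_n)$ of $\mathfrak g$. For $\xi\in\mathfrak g$ let $X_\xi$ be the left-invariant vector field with $X_\xi(\mathrm e)=\xi$, put $X_i=X_{e_i}$, and let $\mathcal L_X$ denote the Lie derivative. With $\mathbb N_n=\{1,\dots,n\}$ and $\alpha=(\alpha_1,\dots,\alpha_k)\in\mathbb N_n^k$ put $\mathcal L_{X_\alpha}=\mathcal L_{X_{\alpha_1}}\cdots\mathcal L_{X_{\alpha_k}}$ (the identity for $k=0$). For $\phi\in C^\infty(G)$ set $$c_k(\phi)=\frac1{k!}\sum_{\alpha\in\mathbb N_n^k}\bigl|(\mathcal L_{X_\alpha}\phi)(\mathrm e)\bigr|,\qquad q_{R,c}(\phi)=\sum_{k=0}^\infty k!^{R}\,c_k(\phi)\,c^k\in[0,\infty]\quad(c\ge0).$$ The space of $R$-entire functions is $\mathscr E_R(G)=\{\phi\in C^\omega(G): q_{R,c}(\phi)<\infty\text{ for all }c\ge0\}$, where $C^\omega(G)$ denotes the real-analytic functions; it carries the locally convex topology defined by the seminorms $q_{R,c}$, $c\ge0$.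 (The space and topology do not depend on the basis.) A Fréchet algebra is an algebra whose underlying space is a Fréchet space and whose product is continuous; it need not be locally multiplicatively convex. *)

(* Defs.v *)
From HB Require Import structures.
From mathcomp Require Import all_boot all_order all_algebra.
From mathcomp Require Import all_classical all_reals all_analysis.
From mathcomp.real_closed Require Import complex.

Set Implicit Arguments.
Unset Strict Implicit.
Unset Printing Implicit Defensive.

Import Order.TTheory GRing.Theory Num.Theory.
Import numFieldNormedType.Exports.

Local Open Scope classical_set_scope.
Local Open Scope ring_scope.
Local Open Scope complex_scope.

(* The modulus as an element of R; the norm `|z| lives in R[i]. *)
Notation cabs := (@Normc.normc _).

Definition seminorm_on (R : realType) (V : lmodType R[i]) (S : {pred V})
    (p : V -> R) : Prop :=
  {in S &, forall x y, p (x + y) <= p x + p y} /\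
  (forall a, {in S, forall x, p (a *: x) = cabs a * p x}).

(* The subspace S of V with the topology generated by the seminorms p i. The
   0-neighbourhood base is { max_(i in s) p i < eps } for finite s and eps > 0. *)
Definition lcspace (R : realType) (V : lmodType R[i]) (S : {pred V})
    (I : Type) (p : I -> V -> R) (hS : submod_closed S)
    (hp : forall i, seminorm_on S (p i)) : Type := {x : V | x \in S}.

Section LCSpace.
Context (R : realType) (V : lmodType R[i]) (S : {pred V}) (I : Type)
  (p : I -> V -> R) (hS : submod_closed S)
  (hp : forall i, seminorm_on S (p i)).

Local Notation E := (lcspace hS hp).

HB.instance Definition _ := SubType.copy E {x : V | x \in S}.
HB.instance Definition _ := Choice.copy E {x : V | x \in S}.
HB.instance Definition _ :=
  GRing.SubChoice_isSubLmodule.Build R[i] V S E (GRing.submod_closed_semi hS).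

Definition lc_max (s : seq I) (x : V) : R := \big[Num.max/0]_(i <- s) p i x.

Definition lc_nbhs (x : E) : set_system E :=
  [set A | exists s eps, 0 < eps /\
    forall y : E, lc_max s (\val y - \val x) < eps -> A y].

Let cabsE (a : R[i]) : `|a| = (cabs a)%:C.
Proof. by case: a. Qed.

Let cabs_ge0 (a : R[i]) : 0 <= cabs a.
Proof. by case: a => a b /=; exact: sqrtr_ge0. Qed.

Let subvalS (x y : E) : \val x - \val y \in S.
Proof. by rewrite -GRing.valB; exact: valP. Qed.

Let p0 i : p i 0 = 0.
Proof.
have [_ h] := hp i; rewrite -(scale0r (0 : V)) h ?hS.1//.
by rewrite Normc.normc0 mul0r.
Qed.

Let pN i x : x \in S -> p i (- x) = p i x.
Proof.
have [_ h] := hp i; move=> xS; rewrite -scaleN1r h//.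
rewrite (_ : cabs (-1) = 1) ?mul1r//.
by apply: complexI; rewrite -cabsE normrN1.
Qed.

Let maxge0 s x : 0 <= lc_max s x.
Proof.
rewrite /lc_max; elim: s => [|i s ih]; first by rewrite big_nil.
by rewrite big_cons le_max ih orbT.
Qed.

Let max0 s : lc_max s 0 = 0.
Proof.
by rewrite /lc_max; elim/big_ind : _ => // a b -> ->; rewrite maxxx.
Qed.

Let maxN s x : x \in S -> lc_max s (- x) = lc_max s x.
Proof. by move=> xS; rewrite /lc_max; apply: eq_bigr => i _; rewrite pN. Qed.

Let maxD s x y : x \in S -> y \in S ->
  lc_max s (x + y) <= lc_max s x + lc_max s y.
Proof.
move=> xS yS; elim: s => [|i s ih]; rewrite /lc_max ?big_nil ?addr0//.
rewrite !big_cons -!/(lc_max _ _) ge_max; apply/andP; split.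
  by rewrite (le_trans ((hp i).1 _ _ xS yS))// lerD// le_max lexx.
by rewrite (le_trans ih)// lerD// le_max lexx orbT.
Qed.

Let maxZ s a x : x \in S -> lc_max s (a *: x) = cabs a * lc_max s x.
Proof.
move=> xS; elim: s => [|i s ih]; rewrite /lc_max ?big_nil ?mulr0//.
by rewrite !big_cons -!/(lc_max _ _) ih (hp i).2// maxr_pMr ?cabs_ge0.
Qed.

Let max_cat s t x : lc_max (s ++ t) x = Num.max (lc_max s x) (lc_max t x).
Proof.
elim: s => [|i s ih] /=.
  by rewrite [lc_max [::] x]/lc_max big_nil max_r.
by rewrite /lc_max !big_cons -!/(lc_max _ _) ih maxA.
Qed.

Let maxB s (x y z : E) :
  lc_max s (\val x - \val z) <= lc_max s (\val x - \val y) + lc_max s (\val y - \val z).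
Proof. by rewrite -(subrKA (\val y)) maxD. Qed.

HB.instance Definition _ := hasNbhs.Build E lc_nbhs.

Let nbhs_filter (x : E) : ProperFilter (nbhs x).
Proof.
apply: Build_ProperFilter_ex.
  move=> A [s [e [e0 h]]]; exists x; apply: h; by rewrite subrr max0.
split.
- by exists [::], 1.
- move=> A B [s [e [e0 hA]]] [t [d [d0 hB]]].
  exists (s ++ t), (Num.min e d); split; first by rewrite lt_min e0.
  move=> y; rewrite max_cat gt_max !lt_min => /andP[/andP[a _] /andP[_ b]].
  by split; [exact: hA|exact: hB].
- move=> A B AB [s [e [e0 hA]]]; exists s, e; split => // y /hA; exact: AB.
Qed.

Let nbhs_sing (x : E) (A : set E) : nbhs x A -> A x.
Proof. by move=> [s [e [e0 h]]]; apply: h; rewrite subrr max0. Qed.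

Let nbhs_nbhs (x : E) (A : set E) : nbhs x A -> nbhs x (nbhs^~ A).
Proof.
move=> [s [e [e0 h]]]; exists s, e; split => // y yx.
exists s, (e - lc_max s (\val y - \val x)); split; first by rewrite subr_gt0.
move=> z zy; apply: h; rewrite (le_lt_trans (maxB _ _ y _))//.
by rewrite -ltrBrDr.
Qed.

HB.instance Definition _ :=
  Nbhs_isNbhsTopological.Build E nbhs_filter nbhs_sing nbhs_nbhs.

Let add_cont : continuous (fun x : E * E => x.1 + x.2).
Proof.
move=> [x y] A [s [e [e0 h]]] /=.
exists ([set z : E | lc_max s (\val z - \val x) < e / 2],
        [set z : E | lc_max s (\val z - \val y) < e / 2]).
  by split; exists s, (e / 2); rewrite divr_gt0.
move=> [u v] /= [ux vy]; apply: h.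
rewrite !GRing.valD opprD addrACA (le_lt_trans (maxD _ _ _))//.
by rewrite (splitr e) ltrD.
Qed.

Let scale_cont : continuous (fun z : R[i]^o * E => z.1 *: z.2).
Proof.
move=> [a x] A [s [e [e0 h]]] /=.
pose M := 1 + lc_max s (\val x); pose N := 1 + cabs a.
have M0 : 0 < M by rewrite ltr_pwDl.
have N0 : 0 < N by rewrite ltr_pwDl.
pose d := Num.min 1 (e / 2 / M).
have d0 : 0 < d by rewrite lt_min ltr01 !divr_gt0.
exists ([set b : R[i]^o | cabs (a - b) < d],
        [set z : E | lc_max s (\val z - \val x) < e / 2 / N]).
  split; last by exists s, (e / 2 / N); rewrite !divr_gt0.
  apply/nbhs_ballP; exists d%:C; first by rewrite /= ltcR.
  by move=> b; rewrite -ball_normE /= cabsE ltcR.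
move=> [b z] /= [ba zx]; apply: h; rewrite !GRing.valZ.
have -> : b *: \val z - a *: \val x =
    b *: (\val z - \val x) + (-1) *: ((a - b) *: \val x).
  by rewrite scalerBr scaleN1r scalerBl opprB addrA subrK.
have aS : (a - b) *: \val x \in S by rewrite -GRing.valZ; exact: valP.
have bS : b *: (\val z - \val x) \in S.
  by rewrite -GRing.valB -GRing.valZ; exact: valP.
rewrite scaleN1r (le_lt_trans (maxD _ _ _))//.
  by rewrite -scaleN1r -GRing.valZ -GRing.valZ; exact: valP.
rewrite maxN// !maxZ//; last exact: valP.
rewrite (splitr e) ltr_leD//.
  have bN : cabs b <= N.
    rewrite -(subrK a b) -lecR -cabsE (le_trans (ler_normD _ _))//.
    rewrite distrC !cabsE -rmorphD lecR lerD2r (ltW (lt_le_trans ba _))//.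
    by rewrite ge_min lexx.
  rewrite (@le_lt_trans _ _ (N * lc_max s (\val z - \val x)))// ?ler_wpM2r//.
  by rewrite mulrC -ltr_pdivlMr.
rewrite (@le_trans _ _ (e / 2 / M * M))//; last by rewrite divfK// gt_eqF.
apply: ler_pM => //; last by rewrite lerDr.
by rewrite (ltW (lt_le_trans ba _))// ge_min lexx orbT.
Qed.

Let loc_convex : exists2 B : set_system E,
  (forall b, b \in B -> convex_set b) & basis B.
Proof.
exists [set B | exists s e (x : E), B = [set y | lc_max s (\val y - \val x) < e]].
  move=> B /[!inE] -[s [e [x ->]]].
  apply/convex_setW => u v /[!inE] /= ux vx k k0 k1; rewrite !inE /=.
  set l := k%:num.
  have convE : (\val (conv k u v : E)) - \val x =
      l *: (\val (u : E) - \val x) + (1 - l) *: (\val (v : E) - \val x).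
    rewrite (_ : conv k u v = l *: (u : E) + (1 - l) *: (v : E))// GRing.valD !GRing.valZ !scalerBr addrACA -opprD.
    by rewrite -scalerDl addrCA subrr addr0 scale1r.
  have lR : l = (cabs l)%:C by rewrite -cabsE ger0_norm// ltW.
  have l'R : 1 - l = (cabs (1 - l))%:C.
    by rewrite -cabsE ger0_norm// subr_ge0 ltW.
  have l0 : 0 < cabs l by rewrite -ltcR -lR.
  have l'0 : 0 < cabs (1 - l) by rewrite -ltcR -l'R subr_gt0.
  have ll : cabs l + cabs (1 - l) = 1.
    by apply: complexI; rewrite rmorphD /= -lR -l'R addrCA subrr addr0.
  rewrite convE (le_lt_trans (maxD _ _ _))//.
  - by rewrite -GRing.valB -GRing.valZ; exact: valP.
  - by rewrite -GRing.valB -GRing.valZ; exact: valP.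
  rewrite !maxZ// -[ltRHS]mul1r -ll mulrDl.
  by rewrite ltrD// ltr_pM2l.
split.
  move=> B [s [e [x ->]]]; rewrite openE => y /= yx.
  exists s, (e - lc_max s (\val y - \val x)); split; first by rewrite subr_gt0.
  move=> z zy /=; rewrite (le_lt_trans (maxB _ _ y _))//.
  by rewrite -ltrBrDr.
move=> x A [s [e [e0 h]]].
exists [set y | lc_max s (\val y - \val x) < e] => //=; split.
  by exists s, e, x.
by rewrite subrr max0.
Qed.

HB.instance Definition _ :=
  PreTopologicalLmod_isTvs.Build R[i] E add_cont scale_cont loc_convex.
HB.instance Definition _ :=
  PreTopologicalNmodule_isTopologicalNmodule.Build E add_cont.
HB.instance Definition _ :=
  TopologicalNmodule_isTopologicalLmodule.Build R[i] E scale_cont.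
HB.instance Definition _ := Uniform_isTvs.Build R[i] E loc_convex.

End LCSpace.

Definition tvs_bounded (R : realType) (E : tvsType R[i]) (B : set E) : Prop :=
  forall U : set E, nbhs 0 U -> exists2 t : R, 0 < t &
    forall a : R[i], t <= cabs a -> B `<=` [set a *: u | u in U].

Definition dual_pred (R : realType) (E : tvsType R[i]) : {pred E -> R[i]^o} :=
  fun f => `[< linear f /\ continuous f >].
Arguments dual_pred {R} E.

Definition sup_seminorm (R : realType) (E : tvsType R[i])
    (B : {B : set E | tvs_bounded B}) (f : E -> R[i]^o) : R :=
  sup [set cabs (f x) | x in sval B].

Lemma dual_submod_closed (R : realType) (E : tvsType R[i]) :
  submod_closed (dual_pred E).
Proof.
split.
  apply/asboolP; split; last exact: cst_continuous.
  by move=> a x y; rewrite scaler0 addr0.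
move=> a f g /asboolP[lf cf] /asboolP[lg cg]; apply/asboolP; split.
  move=> b x y; rewrite !fctE lf lg !scalerDr !scalerA (mulrC a b).
  by rewrite addrACA.
move=> x; apply: (@cvgD R[i] R[i]^o); last exact: cg.
by apply: (@cvgZ R[i] R[i]^o); [exact: cvg_cst|exact: cf].
Qed.

Lemma dual_has_ubound (R : realType) (E : tvsType R[i])
    (B : {B : set E | tvs_bounded B}) (f : E -> R[i]^o) :
  f \in dual_pred E -> has_ubound [set cabs (f x) | x in sval B].
Proof.
move=> /asboolP[lf cf]; case: B => B bB /=.
have f0 : f 0 = 0.
  by have := lf (-1) 0 0; rewrite scaleN1r addNr scaleN1r addNr.
have U0 : nbhs (0 : E) [set x | cabs (f x) < 1].
  apply: (cf 0 [set z : R[i]^o | cabs z < 1]).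
  apply/nbhs_ballP; exists 1 => //= z; rewrite -ball_normE /= f0 sub0r normrN.
  by case: z => u v; rewrite [`|_|]/(_%:C) -[1]/(1%:C) ltcR.
have [t t0 /(_ t%:C)] := bB _ U0.
have -> : cabs t%:C = t by rewrite /= expr0n addr0 sqrtr_sqr gtr0_norm.
move=> /(_ (lexx _)) BU; exists t => _ [x Bx <-].
have [u /= fu <-] := BU _ Bx.
have -> : f (t%:C *: u) = t%:C * f u.
  by have := lf t%:C u 0; rewrite f0 !addr0.
rewrite Normc.normcM.
have -> : cabs t%:C = t by rewrite /= expr0n addr0 sqrtr_sqr gtr0_norm.
by rewrite -[leRHS]mulr1 ler_wpM2l ?ltW.
Qed.

Lemma sup_seminormP (R : realType) (E : tvsType R[i])
    (B : {B : set E | tvs_bounded B}) :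
  seminorm_on (dual_pred E) (sup_seminorm B).
Proof.
have [[x0 Bx0]|/set0P/negP/negPn/eqP B0] := pselect (sval B !=set0); last first.
  have s0 f : sup_seminorm B f = 0.
    by rewrite /sup_seminorm B0 -[RHS](@sup0 R) (image_set0 (fun x => cabs (f x))).
  by split=> [f g _ _|a f _]; rewrite !s0 ?addr0 ?mulr0.
have le_sup f x : f \in dual_pred E -> sval B x -> cabs (f x) <= sup_seminorm B f.
  by move=> df Bx; apply: ub_le_sup; [exact: dual_has_ubound|exists x].
have sup_le f M : (forall x, sval B x -> cabs (f x) <= M) -> sup_seminorm B f <= M.
  move=> h; apply: ge_sup; first by exists (cabs (f x0)), x0.
  by move=> _ [x Bx <-]; exact: h.
have cabsD (a b : R[i]) : cabs (a + b) <= cabs a + cabs b.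
  have E' (c : R[i]) : (cabs c)%:C = `|c| by case: c.
  by rewrite -lecR rmorphD /= !E' ler_normD.
have cabs_ge0 (a : R[i]) : 0 <= cabs a by case: a => a b; exact: sqrtr_ge0.
split.
- move=> f g df dg; apply: sup_le => x Bx.
  have -> : (f + g) x = f x + g x by [].
  exact: (le_trans (cabsD _ _) (lerD (le_sup f x df Bx) (le_sup g x dg Bx))).
- have scE a (f : E -> R[i]^o) x : cabs ((a *: f) x) = cabs a * cabs (f x).
    by rewrite -Normc.normcM.
  move=> a f df; apply/eqP; rewrite eq_le; apply/andP; split.
    by apply: sup_le => x Bx; rewrite scE; apply: ler_wpM2l => //; exact: le_sup.
  have [->|a0] := eqVneq a 0.
    rewrite Normc.normc0 mul0r scale0r.
    have d0 := (dual_submod_closed E).1.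
    exact: (le_trans (cabs_ge0 _) (le_sup _ x0 d0 Bx0)).
  have ca0 : 0 < cabs a.
    rewrite lt_neqAle cabs_ge0 andbT eq_sym.
    by apply: contra a0 => /eqP/Normc.eq0_normc ->.
  rewrite -ler_pdivlMl//; apply: sup_le => x Bx.
  have daf : a *: f \in dual_pred E.
    have := (dual_submod_closed E).2 a f 0 df (dual_submod_closed E).1.
    by rewrite addr0.
  by rewrite ler_pdivlMl// -scE; exact: (le_sup _ x daf Bx).
Qed.

(* The topological dual with the topology of uniform convergence on bounded
   sets. *)
Definition strong_dual (R : realType) (E : tvsType R[i]) : tvsType R[i] :=
  lcspace (@dual_submod_closed R E) (@sup_seminormP R E).

(* The uniform structure of E is the one induced by its vector space topology,
   so that [cauchy] has the usual meaning. *)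
Definition frechet_space (R : realType) (E : tvsType R[i]) : Prop :=
  [/\ hausdorff_space E, countable_uniformity E &
    forall F : set_system E, ProperFilter F -> cauchy F ->
      exists x : E, F --> x].

Definition frechet_algebra (R : realType) (E : tvsType R[i])
    (mul : E -> E -> E) : Prop :=
  [/\ frechet_space E,
      associative mul,
      forall x, linear (mul x),
      forall y, linear (mul^~ y) &
      continuous (fun xy : E * E => mul xy.1 xy.2)].

Definition continuous_seminorm (R : realType) (E : tvsType R[i])
    (p : E -> R) : Prop :=
  seminorm_on {: E} p /\ continuous p.

(* (F, j) is a completion of the seminormed space (E, p), i.e. the local Banach
   space of E at p with its canonical map; it is unique up to isometry. *)
Definition local_banach (R : realType) (E : tvsType R[i]) (p : E -> R)
    (F : completeNormedModType R[i]) (j : {linear E -> F}) : Prop :=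
  (forall x, `|j x| = (p x)%:C) /\ dense (range j).

Definition nuclear_operator (R : realType) (F1 F2 : completeNormedModType R[i])
    (T : F1 -> F2) : Prop :=
  exists (lam : nat -> R[i]) (a : nat -> {linear F1 -> R[i]^o}) (y : nat -> F2),
  [/\ cvgn (series (fun k => cabs (lam k))),
      forall k x, `|a k x| <= `|x|,
      forall k, `|y k| <= 1 &
      forall x, series (fun k => (lam k * a k x) *: y k) @ \oo --> T x].

Definition nuclear_space (R : realType) (E : tvsType R[i]) : Prop :=
  forall p : E -> R, continuous_seminorm p ->
  exists q : E -> R, [/\ continuous_seminorm q, forall x, p x <= q x &
    forall (Fp Fq : completeNormedModType R[i])
      (jp : {linear E -> Fp}) (jq : {linear E -> Fq}),
      local_banach p jp -> local_banach q jq ->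
      exists T : {linear Fq -> Fp},
        (forall x, T (jq x) = jp x) /\ nuclear_operator T].

Definition montel (R : realType) (E : tvsType R[i]) : Prop :=
  forall B : set E, tvs_bounded B -> closed B -> compact B.

Definition separable (T : topologicalType) : Prop :=
  exists2 D : set T, countable D & dense D.

Definition reflexive_space (R : realType) (E : tvsType R[i]) : Prop :=
  exists (J : E -> strong_dual (strong_dual E))
         (J' : strong_dual (strong_dual E) -> E),
  [/\ forall x (f : strong_dual E), \val (J x) f = \val f x,
      cancel J J', cancel J' J, continuous J & continuous J'].

(* Power series are summed over words: the homogeneous part of degree k is
   \sum_(w in {0..m-1}^k) a_w h_(w_1) ... h_(w_k). Collecting the words with the
   same letter count gives the usual series in multi-indices, and conversely. *)
Definition analytic_at (R : realType) (m : nat) (f : 'rV[R]_m -> R)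
    (x : 'rV[R]_m) : Prop :=
  exists (a : seq 'I_m -> R) (rho : R),
  [/\ 0 < rho,
      cvgn (series (fun k => (\sum_(w : k.-tuple 'I_m) `|a w|) * rho ^+ k)) &
      forall h : 'rV[R]_m, (forall i, `|h 0 i| < rho) ->
        series (fun k => \sum_(w : k.-tuple 'I_m) a w * \prod_(i <- w) h 0 i)
          @ \oo --> f (x + h)].

Definition analytic_map_at (R : realType) (m p : nat)
    (f : 'rV[R]_m -> 'rV[R]_p) (x : 'rV[R]_m) : Prop :=
  forall j, analytic_at (fun y => f y 0 j) x.

(* The values of [cmap] outside [cdom], and of [cinv] outside the image, are
   irrelevant. *)
Record chart (R : realType) (n : nat) (G : Type) := Chart {
  cdom : set G;
  cmap : G -> 'rV[R]_n;
  cinv : 'rV[R]_n -> G }.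

Definition cimg (R : realType) (n : nat) (G : Type) (c : chart R n G) :
  set 'rV[R]_n := cmap c @` cdom c.

Definition chart_axiom (R : realType) (n : nat) (G : topologicalType)
    (c : chart R n G) : Prop :=
  [/\ open (cdom c), open (cimg c),
      {within cdom c, continuous (cmap c)},
      {within cimg c, continuous (cinv c)} &
      forall g, cdom c g -> cinv c (cmap c g) = g].

#[short(type="preTopologicalGroupType")]
HB.structure Definition PreTopologicalGroup := {G of Group G & Topological G}.

HB.mixin Record isLieGroup (R : realType) (n : nat) G
    of PreTopologicalGroup G := {
  atlas : set (chart R n G);
  lie_hausdorff : hausdorff_space G;
  lie_mul_continuous : continuous (fun xy : G * G => (xy.1 * xy.2)%g);
  lie_inv_continuous : continuous (fun x : G => x^-1%g);
  atlas_chart : forall c, atlas c -> chart_axiom c;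
  atlas_cover : forall g, exists2 c, atlas c & cdom c g;
  atlas_compat : forall c d, atlas c -> atlas d ->
    forall g, cdom c g -> cdom d g ->
      analytic_map_at (cmap d \o cinv c) (cmap c g);
  lie_mul_analytic : forall a b c, atlas a -> atlas b -> atlas c ->
    forall g h, cdom a g -> cdom b h -> cdom c (g * h)%g ->
      analytic_map_at
        (fun z : 'rV[R]_(n + n) =>
           cmap c (cinv a (lsubmx z) * cinv b (rsubmx z))%g)
        (row_mx (cmap a g) (cmap b h));
  lie_inv_analytic : forall a b, atlas a -> atlas b ->
    forall g, cdom a g -> cdom b g^-1%g ->
      analytic_map_at (fun x => cmap b (cinv a x)^-1%g) (cmap a g)
}.

(* The atlas is a real analytic one: every C^oo Lie group carries a unique
   compatible analytic structure, and C^omega(G) refers to it. Second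
   countability is automatic when G is connected. *)
#[short(type="lieGroupType")]
HB.structure Definition LieGroup (R : realType) (n : nat) :=
  {G of isLieGroup R n G & PreTopologicalGroup G}.

(* A basis of T_e G, where T_e G is identified with R^n through a chart at the
   unit. *)
Record lie_basis (R : realType) (n : nat) (G : lieGroupType R n) := LieBasis {
  bchart : chart R n G;
  bchart_atlas : atlas bchart;
  bchart1 : cdom bchart 1%g;
  bvec : 'I_n -> 'rV[R]_n;
  bvec_free : row_free (\matrix_i bvec i) }.

Section Entire.
Context (R : realType) (n : nat) (G : lieGroupType R n) (e : lie_basis G).
Implicit Types (phi : G -> R[i]) (r c : R).

(* The left-invariant vector field X_i is g |-> d(L_g) e_i, so that
   (X_i phi)(g) is the derivative at e of h |-> phi (g h) along e_i. *)
Definition lie_derive (i : 'I_n) phi (g : G) : R[i] :=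
  let f x := phi (g * cinv (bchart e) x)%g in
  let x0 := cmap (bchart e) 1%g in
  ('D_(bvec e i) (fun x => complex.Re (f x)) x0) +i*
  ('D_(bvec e i) (fun x => complex.Im (f x)) x0).

Definition lie_derives (w : seq 'I_n) phi : G -> R[i] :=
  foldr lie_derive phi w.

Definition taylor_coef (k : nat) phi : R :=
  (k`!%:R)^-1 * \sum_(w : k.-tuple 'I_n) cabs (lie_derives w phi 1%g).

Definition entire_norm r c phi : \bar R :=
  (\sum_(0 <= k <oo) (k`!%:R `^ r * taylor_coef k phi * c ^+ k)%:E)%E.

Definition analytic_fun phi : Prop :=
  forall k : chart R n G, atlas k -> forall g, cdom k g ->
    analytic_at (fun x => complex.Re (phi (cinv k x))) (cmap k g) /\
    analytic_at (fun x => complex.Im (phi (cinv k x))) (cmap k g).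

Definition entire r : {pred G -> R[i]} :=
  fun phi => `[< analytic_fun phi /\
                 forall c, 0 <= c -> (entire_norm r c phi < +oo)%E >].

Definition entire_seminorm r (c : {nonneg R}) phi : R :=
  fine (entire_norm r c%:num phi).

End Entire.

(* Main.v *)
(* In a chart, the components of the Maurer-Cartan form turn left-invariant
   differentiation into a first order system with analytic coefficients. Solving
   it formally expresses an analytic function u near any g through its Lie jet
   (L_w u)(g), and the majorant exp(B q) of the formal solution makes the
   expansion valid on a chart box that depends neither on g nor on u, as soon as
   all q_(0,c) are finite. Since G is connected, the bounds at the unit spread to
   every g. Hence a function with zero jet at the unit vanishes, and a sequence
   that is Cauchy for all q_(0,c) converges together with all its jets to an
   analytic function.

   So E_R(G) is separated and complete, and its topology is given by the
   seminorms sup_w om_j(w) |(L_w phi)(e)|, where sum_w om_j(w) / om_(j+1)(w) is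
   finite. Nuclearity, the Montel property, separability and reflexivity follow
   from this description alone: the topology is also given by the Hilbert
   seminorms h_j^2 = sum_w om_j(w)^2 |(L_w phi)(e)|^2, and minimising
   h_j^2 - 2 Re l represents a continuous functional l up to an arbitrarily small
   multiple of h_j, which replaces both the Riesz and the Hahn-Banach theorems.

   The product is continuous because the Leibniz rule and
   k!^R <= (2^k i! j!)^R, i + j = k, give
   q_(R,c)(phi psi) <= q_(R,2^R c)(phi) q_(R,2^R c)(psi). *)
From HB Require Import structures.
From mathcomp Require Import all_boot all_order all_algebra.
From mathcomp Require Import all_classical all_reals all_analysis.
From mathcomp.real_closed Require Import complex.
From mathcomp Require Import ring lra zify.
Require Import Defs.

Set Implicit Arguments.
Unset Strict Implicit.
Unset Printing Implicit Defensive.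

Import Order.TTheory GRing.Theory Num.Theory.
Import numFieldNormedType.Exports.

Local Open Scope classical_set_scope.
Local Open Scope ring_scope.

(** * Series and sums over words *)

(** Coefficients indexed by words are not determined by the function, so a function is carried
    together with a bound for the majorant of some expansion of it ([rep]). This bound is stable
    under sums, products, substitution and limits. Derivatives enter only through first-order
    remainders of size O(s^2), so no series is differentiated term by term.

    Convergence of the formal solution S does not yet say that S is u. Along a ray t -> t h,
    induction on the order shows that u agrees with the truncations of S to every order at t = 0.
    Both are analytic on [0, 1], hence equal at t = 1, and the size of the box depends on the
    Maurer-Cartan form alone.

    A passage to another point of a box replaces c by c + B.

    Passing from sums over words to suprema, or from suprema to Hilbert norms, costs one index of
    the weights. There are n^k words of length k, and a factor 2 (n + 1) per letter makes the weight
    quotients summable. *)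

Lemma invS_small (R : realType) (e : R) : 0 < e -> exists N, forall n, (N <= n)%N -> n.+1%:R^-1 < e.
Proof.
move=> e1; have [N hN] : exists N, e^-1 < N.+1%:R by exists (Num.truncn e^-1); exact: truncnS_gt.
exists N => n Nn; rewrite -[ltRHS]invrK ltf_pV2 ?posrE ?ltr0n ?invr_gt0//.
by rewrite (lt_le_trans hN)// ler_nat ltnS.
Qed.

Section RealSequences.
Context (R : realType).
Implicit Types (u M : nat -> R) (l e B : R).

Lemma cvgn_epsP u l :
  u @ \oo --> l <->
  forall e, 0 < e -> exists N, forall k, (N <= k)%N -> `|l - u k| <= e.
Proof.
split=> [/cvgrPdist_le h e e0|h].
  by have [N _ hN] := h e e0; exists N => k Nk; exact: hN.
apply/cvgrPdist_le => e e0; have [N hN] := h e e0.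
by exists N => // k /= Nk; exact: hN.
Qed.

Lemma cvgn_dist_le u l c e N :
  u @ \oo --> l -> (forall k, (N <= k)%N -> `|u k - c| <= e) -> `|l - c| <= e.
Proof.
move=> /cvgn_epsP ul uc; apply/ler_addgt0Pr => d d0.
have [N' hN'] := ul d d0.
have -> : l - c = (u (maxn N N') - c) + (l - u (maxn N N')) by ring.
by rewrite (le_trans (ler_normD _ _))// lerD ?uc ?hN' ?leq_maxl ?leq_maxr.
Qed.

Lemma bounded_series_cvgn u B :
  (forall k, 0 <= u k) -> (forall K, \sum_(k < K) u k <= B) ->
  cvgn (series u).
Proof.
move=> u0 uB; apply: nondecreasing_is_cvgn.
  by apply: nondecreasing_series => n _ _; exact: u0.
by exists B => _ [K _ <-]; rewrite seriesEord; exact: uB.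
Qed.

Lemma bounded_series_tail u B :
  (forall k, 0 <= u k) -> (forall K, \sum_(k < K) u k <= B) ->
  forall e, 0 < e -> exists N, forall K, \sum_(N <= k < K) u k <= e.
Proof.
move=> u0 uB e e0; have cu := bounded_series_cvgn u0 uB.
have /cvgn_epsP/(_ e e0)[N hN] := cu.
exists N => K; have [NK|/ltnW KN] := leqP N K; last first.
  by rewrite big_geq// ltW.
rewrite -sub_series_geq//; apply: le_trans (hN N (leqnn _)).
rewrite (le_trans _ (ler_norm _))// lerB//.
apply: nondecreasing_cvgn_le => //.
by apply: nondecreasing_series => n _ _; exact: u0.
Qed.

Lemma abs_series_cvgn u M B :
  (forall k, `|u k| <= M k) -> (forall K, \sum_(k < K) M k <= B) ->
  cvgn (series u).
Proof.
move=> uM MB; apply: normed_cvg; apply: (@bounded_series_cvgn _ B) => [k|K].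
  exact: normr_ge0.
by apply: le_trans (MB K); apply: ler_sum => k _; exact: uM.
Qed.

Lemma abs_series_tail u M B l :
  (forall k, `|u k| <= M k) -> (forall K, \sum_(k < K) M k <= B) ->
  series u @ \oo --> l ->
  forall e N, (forall K, \sum_(N <= k < K) M k <= e) ->
  `|l - \sum_(k < N) u k| <= e.
Proof.
move=> uM MB ul e N hN; apply: (cvgn_dist_le (N := N) ul) => k Nk.
have -> : \sum_(k < N) u k = series u N by rewrite seriesEord.
rewrite sub_series_geq// (le_trans (ler_norm_sum _ _ _))// (le_trans _ (hN k))//.
by apply: ler_sum.
Qed.

Lemma series_norm_le u l B :
  series u @ \oo --> l -> (forall K, \sum_(k < K) `|u k| <= B) -> `|l| <= B.
Proof.
move=> ul uB; rewrite -[l]subr0; apply: (cvgn_dist_le (N := 0) ul) => k _.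
by rewrite subr0 seriesEord (le_trans (ler_norm_sum _ _ _)).
Qed.

End RealSequences.

Section WordSums.
Context (V : nmodType) (m : nat).
Implicit Types (F : seq 'I_m -> V).

(** Recursion on the first letter turns splitting, shifting and exchanging words into inductions on
    the length; [wsumE] links it with the sums over tuples in [analytic_at]. *)
Fixpoint wsum k F : V :=
  if k is k'.+1 then \sum_(i < m) wsum k' (fun w => F (i :: w)) else F [::].

Lemma wsumE k F : \sum_(w : k.-tuple 'I_m) F w = wsum k F.
Proof.
elim: k F => [|k ih] F /=.
  rewrite (big_pred1 [tuple])// => w; apply/esym/eqP; exact: tuple0.
under [RHS]eq_bigr do rewrite -ih.
rewrite pair_big /= (reindex (fun p : 'I_m * k.-tuple 'I_m => [tuple of p.1 :: p.2]))//=.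
exists (fun w => (thead w, [tuple of behead w])) => [[i w] _|w _] /=.
  by rewrite theadE; congr pair; apply: val_inj.
by apply: val_inj; rewrite /= [in RHS](tuple_eta w).
Qed.

Lemma eq_wsum k F F' :
  (forall w, size w = k -> F w = F' w) -> wsum k F = wsum k F'.
Proof.
elim: k F F' => [|k ih] F F' h /=; first exact: h.
by apply: eq_bigr => i _; apply: ih => w wk; apply: h => /=; rewrite wk.
Qed.

Lemma wsum_cat j k F :
  wsum (j + k) F = wsum j (fun u => wsum k (fun v => F (u ++ v))).
Proof. by elim: j F => [|j ih] F //=; apply: eq_bigr => i _; rewrite ih. Qed.

Lemma wsumD k F F' : wsum k (fun w => F w + F' w) = wsum k F + wsum k F'.
Proof.
elim: k F F' => [|k ih] F F' //=.
by rewrite -big_split /=; apply: eq_bigr => i _; rewrite ih.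
Qed.

Lemma wsum0 k : wsum k (fun=> 0) = 0.
Proof. by elim: k => //= k ih; rewrite big1. Qed.

Lemma wsum_sum (I : Type) (r : seq I) (P : pred I) k (F : I -> seq 'I_m -> V) :
  wsum k (fun w => \sum_(i <- r | P i) F i w) = \sum_(i <- r | P i) wsum k (F i).
Proof.
elim: k F => [|k ih] F //=.
by rewrite exchange_big /=; apply: eq_bigr => i _; rewrite ih.
Qed.

Lemma wsum_exchange j k (F : seq 'I_m -> seq 'I_m -> V) :
  wsum j (fun u => wsum k (F u)) = wsum k (fun v => wsum j (F^~ v)).
Proof. elim: j F => [|j ih] F //=.
by rewrite wsum_sum; apply: eq_bigr => i _; rewrite ih. Qed.

Lemma wsum_rcons k F :
  wsum k.+1 F = \sum_(i < m) wsum k (fun w => F (rcons w i)).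
Proof.
rewrite -addn1 wsum_cat /= wsum_sum; apply: eq_bigr => i _.
by apply: eq_wsum => w _; rewrite cats1.
Qed.

End WordSums.

Section CvgSums.
Context (R : realType) (T : Type) (F : set_system T) {FF : Filter F}.

Lemma cvg_bigsum (I : Type) (r : seq I) (u : I -> T -> R) (l : I -> R) :
  (forall i, u i @ F --> l i) ->
  (fun x => \sum_(i <- r) u i x) @ F --> \sum_(i <- r) l i.
Proof.
move=> ul; elim: r => [|i r ih].
  by rewrite big_nil; under eq_fun do rewrite big_nil; exact: cvg_cst.
rewrite big_cons; under eq_fun do rewrite big_cons.
by apply: cvgD; [exact: ul|exact: ih].
Qed.

Lemma cvg_wsum (m k : nat) (u : seq 'I_m -> T -> R) (l : seq 'I_m -> R) :
  (forall w, u w @ F --> l w) ->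
  (fun x => wsum k (u^~ x)) @ F --> wsum k l.
Proof.
elim: k u l => [|k ih] u l ul /=; first exact: ul.
apply: cvg_bigsum => i; exact: (ih (fun w => u (i :: w)) (fun w => l (i :: w))).
Qed.

End CvgSums.

Section WordSumsReal.
Context (R : numDomainType) (m : nat).
Implicit Types (F : seq 'I_m -> R).

Lemma wsumZ k (c : R) F : wsum k (fun w => c * F w) = c * wsum k F.
Proof.
elim: k F => [|k ih] F //=.
by rewrite mulr_sumr; apply: eq_bigr => i _; rewrite ih.
Qed.

Lemma wsumZr k (c : R) F : wsum k (fun w => F w * c) = wsum k F * c.
Proof.
elim: k F => [|k ih] F //=.
by rewrite mulr_suml; apply: eq_bigr => i _; rewrite ih.
Qed.

Lemma ler_wsum k F F' :
  (forall w, size w = k -> F w <= F' w) -> wsum k F <= wsum k F'.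
Proof.
elim: k F F' => [|k ih] F F' h /=; first exact: h.
by apply: ler_sum => i _; apply: ih => w wk; apply: h => /=; rewrite wk.
Qed.

Lemma wsum_ge0 k F : (forall w, 0 <= F w) -> 0 <= wsum k F.
Proof. by move=> h; rewrite -[leLHS](@wsum0 R m k); apply: ler_wsum. Qed.

Lemma ler_norm_wsum k F : `|wsum k F| <= wsum k (fun w => `|F w|).
Proof.
elim: k F => [|k ih] F //=.
by rewrite (le_trans (ler_norm_sum _ _ _))// ler_sum.
Qed.

Lemma ler_wsum_term k F w : (forall w, 0 <= F w) -> size w = k -> F w <= wsum k F.
Proof.
elim: k F w => [|k ih] F [|i w]//= F0 [wk].
rewrite (bigD1 i)//= (le_trans (ih (fun w => F (i :: w)) w _ wk))// lerDl.
by apply: sumr_ge0 => j _; apply: wsum_ge0.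
Qed.

End WordSumsReal.

(** * Power series indexed by words *)

Section WordSeries.
Context (R : realType) (m : nat).
Implicit Types (a b : seq 'I_m -> R) (f g : 'rV[R]_m -> R) (h : 'rV[R]_m).
Implicit Types (rho M : R).

Definition monom h (w : seq 'I_m) : R := \prod_(i <- w) h 0 i.
Definition hom a k h : R := wsum k (fun w => a w * monom h w).
Definition nrm a k : R := wsum k (fun w => `|a w|).
Definition box rho h := forall i, `|h 0 i| < rho.

(** [M] bounds the majorant series at radius [rho], which gives absolute convergence on the box.
    Permuted words have the same monomial, so [f] does not determine [a]; hence the existential in
    [rep]. *)
Definition repc rho M a f :=
  (forall K, \sum_(k < K) nrm a k * rho ^+ k <= M) /\
  (forall h, box rho h -> series (fun k => hom a k h) @ \oo --> f h).

Definition rep rho M f := exists a, repc rho M a f.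

Lemma monom_nil h : monom h [::] = 1.
Proof. by rewrite /monom big_nil. Qed.

Lemma monom_cons h i w : monom h (i :: w) = h 0 i * monom h w.
Proof. by rewrite /monom big_cons. Qed.

Lemma monom_cat h u v : monom h (u ++ v) = monom h u * monom h v.
Proof. by rewrite /monom big_cat. Qed.

Lemma monom_le r h w : (forall i, `|h 0 i| <= r) -> `|monom h w| <= r ^+ size w.
Proof.
move=> hr; elim: w => [|i w ih]; first by rewrite monom_nil normr1.
by rewrite monom_cons normrM /= exprS ler_pM.
Qed.

Lemma monomZ t h w : monom (t *: h) w = t ^+ size w * monom h w.
Proof.
elim: w => [|i w ih]; first by rewrite !monom_nil mulr1.
by rewrite !monom_cons ih mxE /= exprS; ring.
Qed.

Lemma homZ a k t h : hom a k (t *: h) = t ^+ k * hom a k h.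
Proof.
by rewrite /hom -wsumZ; apply: eq_wsum => w <-; rewrite monomZ mulrCA.
Qed.

Lemma hom_le a k r h : (forall i, `|h 0 i| <= r) -> `|hom a k h| <= nrm a k * r ^+ k.
Proof.
move=> hr; rewrite (le_trans (ler_norm_wsum _ _))// /nrm -wsumZr.
by apply: ler_wsum => w <-; rewrite normrM ler_wpM2l// monom_le.
Qed.

Lemma nrm_ge0 a k : 0 <= nrm a k.
Proof. exact: wsum_ge0. Qed.

Lemma repc_ge0 rho M a f : repc rho M a f -> 0 <= M.
Proof. by move=> [/(_ 0%N)]; rewrite big_ord0. Qed.

Lemma repc_nrm_le rho M a f k : 0 < rho -> repc rho M a f -> nrm a k * rho ^+ k <= M.
Proof.
move=> r0 [/(_ k.+1)] + _; rewrite big_ord_recr /=; apply: le_trans.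
by rewrite lerDr sumr_ge0// => i _; rewrite mulr_ge0 ?nrm_ge0 ?exprn_ge0 ?ltW.
Qed.

Lemma repc_le rho M a f h : repc rho M a f -> box rho h -> `|f h| <= M.
Proof.
move=> [aM af] hh; apply: series_norm_le (af _ hh) _ => K.
by rewrite (le_trans _ (aM K))// ler_sum// => i _; rewrite hom_le// => j; exact: ltW.
Qed.

Lemma rep_le rho M f h : rep rho M f -> box rho h -> `|f h| <= M.
Proof. by move=> [a]; exact: repc_le. Qed.

Lemma rep_ge0 rho M f : rep rho M f -> 0 <= M.
Proof. by move=> [a /repc_ge0]. Qed.

Lemma repW rho M M' f : M <= M' -> rep rho M f -> rep rho M' f.
Proof.
by move=> MM [a [aM af]]; exists a; split=> // K; rewrite (le_trans (aM K)).
Qed.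

Lemma repc_radius rho rho' M a f : 0 <= rho' -> rho' <= rho -> repc rho M a f -> repc rho' M a f.
Proof.
move=> r0 rr [aM af]; split=> [K|h hh].
  rewrite (le_trans _ (aM K))// ler_sum// => i _.
  by rewrite ler_wpM2l ?nrm_ge0// lerXn2r// nnegrE// (le_trans r0).
by apply: af => i; exact: lt_le_trans (hh i) rr.
Qed.

Lemma rep_radius rho rho' M f : 0 <= rho' -> rho' <= rho -> rep rho M f -> rep rho' M f.
Proof. by move=> r0 rr [a /(repc_radius r0 rr) h]; exists a. Qed.

Lemma repc_eq rho M a f g : (forall h, box rho h -> f h = g h) -> repc rho M a f -> repc rho M a g.
Proof. by move=> fg [aM af]; split=> // h hh; rewrite -fg//; exact: af. Qed.

Lemma rep_eq rho M f g : (forall h, box rho h -> f h = g h) -> rep rho M f -> rep rho M g.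
Proof. by move=> fg [a /(repc_eq fg) h]; exists a. Qed.

Lemma repc_at0 rho M a f : 0 < rho -> repc rho M a f -> f 0 = a [::].
Proof.
move=> r0 [_ /(_ 0)]; have hb : box rho 0 by move=> i; rewrite mxE normr0.
move=> /(_ hb) h; apply/eqP; rewrite -subr_eq0 -normr_le0.
apply: (cvgn_dist_le (N := 1) h) => -[//|k] _.
rewrite seriesEord /= big_ord_recl big1 /= ?addr0; last first.
  (* Written as [0 *: 0], the zero vector lets [homZ] produce a factor 0 ^+ k with k > 0. *)
  move=> i _; rewrite /hom; have -> : (0 : 'rV[R]_m) = 0 *: 0 by rewrite scale0r.
  by rewrite -/(hom _ _ _) homZ /bump /= add1n expr0n mul0r.
by rewrite /hom /= monom_nil mulr1 subrr normr0.
Qed.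

Lemma rep_cst rho c : rep rho `|c| (fun=> c).
Proof.
pose a (w : seq 'I_m) := if w is [::] then c else 0.
have nS k : nrm a k.+1 = 0.
  by rewrite /nrm /=; rewrite big1// => i _; under eq_wsum do rewrite normr0; rewrite wsum0.
have hS k h : hom a k.+1 h = 0.
  by rewrite /hom /=; rewrite big1// => i _; under eq_wsum do rewrite mul0r; rewrite wsum0.
exists a; split=> [[|K]|h _].
- by rewrite big_ord0.
- rewrite big_ord_recl big1 ?addr0 /=; first by rewrite /nrm /= mulr1.
  by move=> i _; rewrite /bump /= add1n nS mul0r.
- apply/cvgn_epsP => e e0; exists 1%N => -[//|k] _.
  rewrite seriesEord /= big_ord_recl big1 ?addr0 /=; last by move=> i _; rewrite /bump /= add1n hS.
  by rewrite /hom /= monom_nil mulr1 subrr normr0 ltW.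
Qed.

Lemma rep_scale rho M f c : rep rho M f -> rep rho (`|c| * M) (fun h => c * f h).
Proof.
move=> [a [aM af]]; exists (fun w => c * a w); split=> [K|h hh].
  have -> : \sum_(k < K) nrm (fun w => c * a w) k * rho ^+ k =
      `|c| * \sum_(k < K) nrm a k * rho ^+ k.
    rewrite mulr_sumr; apply: eq_bigr => k _; rewrite mulrA /nrm -wsumZ; congr (_ * _).
    by apply: eq_wsum => w _; rewrite normrM.
  by rewrite ler_wpM2l.
have -> : series (fun k => hom (fun w => c * a w) k h) = c *: series (fun k => hom a k h).
  apply/funext => k; rewrite /= fctE !seriesEord scaler_sumr; apply: eq_bigr => j _.
  by rewrite /hom -[RHS]wsumZ; apply: eq_wsum => w _; rewrite mulrA.
by apply: cvgZr; exact: af.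
Qed.

Lemma rep_add rho M M' f g : 0 <= rho ->
  rep rho M f -> rep rho M' g -> rep rho (M + M') (fun h => f h + g h).
Proof.
move=> r0 [a [aM af]] [b [bM bg]]; exists (fun w => a w + b w); split=> [K|h hh].
  rewrite (le_trans _ (lerD (aM K) (bM K)))// -big_split ler_sum//= => k _.
  rewrite -mulrDl ler_wpM2r ?exprn_ge0// /nrm -wsumD; apply: ler_wsum => w _.
  exact: ler_normD.
have -> : series (fun k => hom (fun w => a w + b w) k h) = series (fun k => hom a k h) \+ series (fun k => hom b k h).
  apply/funext => k; rewrite /= !seriesEord -big_split; apply: eq_bigr => j _.
  by rewrite /hom -[RHS]wsumD; apply: eq_wsum => w _; rewrite mulrDl.
by apply: cvgD; [exact: af|exact: bg].
Qed.

Lemma rep_bigsum (I : Type) (r : seq I) (F : I -> 'rV[R]_m -> R) (N : I -> R) rho :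
  0 <= rho -> (forall i, rep rho (N i) (F i)) ->
  rep rho (\sum_(i <- r) N i) (fun h => \sum_(i <- r) F i h).
Proof.
move=> r0 FN; elim: r => [|i r ih].
  rewrite big_nil; have := rep_cst rho 0; rewrite normr0; apply: rep_eq => h _.
  by rewrite big_nil.
rewrite big_cons; have := rep_add r0 (FN i) ih; apply: rep_eq => h _.
by rewrite big_cons.
Qed.

Lemma rep_wsum p k (F : seq 'I_p -> 'rV[R]_m -> R) (N : seq 'I_p -> R) rho :
  0 <= rho -> (forall w, size w = k -> rep rho (N w) (F w)) ->
  rep rho (wsum k N) (fun h => wsum k (fun w => F w h)).
Proof.
move=> r0; elim: k F N => [|k ih] F N FN /=; first exact: FN.
by apply: rep_bigsum => // i; apply: ih => w wk; apply: FN; rewrite /= wk.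
Qed.

(** Prepending the letter [i] to every word multiplies the series by the coordinate; words that
    start with another letter get the coefficient 0. *)
Lemma rep_coordM rho M f i : 0 <= rho ->
  rep rho M f -> rep rho (rho * M) (fun h => h 0 i * f h).
Proof.
move=> r0 [a [aM af]].
pose b (w : seq 'I_m) := if w is j :: v then (if j == i then a v else 0) else 0.
have b0 : b [::] = 0 by [].
have nS k : nrm b k.+1 = nrm a k.
  rewrite /nrm /= (bigD1 i)//= eqxx big1 ?addr0// => j /negPf ->.
  by under eq_wsum do rewrite normr0; rewrite wsum0.
have hS k h : hom b k.+1 h = h 0 i * hom a k h.
  rewrite /hom /= (bigD1 i)//= eqxx big1 ?addr0; last first.
    by move=> j /negPf ->; under eq_wsum do rewrite mul0r; rewrite wsum0.
  by rewrite -wsumZ; apply: eq_wsum => w _; rewrite monom_cons mulrCA.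
exists b; split=> [[|K]|h hh].
- by rewrite big_ord0 mulr_ge0// (le_trans _ (aM 0%N))// big_ord0.
- rewrite big_ord_recl {1}/nrm /= normr0 mul0r add0r.
  rewrite (le_trans _ (ler_wpM2l r0 (aM K)))// mulr_sumr ler_sum// => k _.
  by rewrite /bump /= add1n nS exprS mulrCA.
- apply/cvgn_epsP => e e0.
  have : (fun k => h 0 i * series (fun k => hom a k h) k) @ \oo --> h 0 i * f h.
    by apply: cvgM; [exact: cvg_cst|exact: af].
  move=> /cvgn_epsP/(_ e e0)[N hN]; exists N.+1 => -[//|k] Nk; apply: le_trans (hN k Nk).
  rewrite !seriesEord /= big_ord_recl {1}/hom /= !mul0r add0r mulr_sumr.
  by under eq_bigr do rewrite /bump /= add1n hS.
Qed.

Lemma rep_monomM rho M f w : 0 <= rho ->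
  rep rho M f -> rep rho (rho ^+ size w * M) (fun h => monom h w * f h).
Proof.
move=> r0 fM; elim: w => [|i w ih].
  by rewrite mul1r; apply: rep_eq fM => h _; rewrite monom_nil mul1r.
have := rep_coordM i r0 ih; rewrite mulrA -exprS; apply: rep_eq => h _.
by rewrite monom_cons mulrA.
Qed.

(** Completeness for the majorant norm. Each coefficient of F n is at most N n / rho ^+ size w, so
    the coefficients can be summed over n word by word; norm and values of the sum are then read off
    from finite partial sums. Products, compositions and slices are obtained from it. *)
Lemma rep_series rho M (F : nat -> 'rV[R]_m -> R) (N : nat -> R) f : 0 < rho ->
  (forall n, rep rho (N n) (F n)) -> (forall K, \sum_(n < K) N n <= M) ->
  (forall h, box rho h -> series (F^~ h) @ \oo --> f h) ->
  rep rho M f.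
Proof.
move=> r0 FN NM Ff; have /choice[a_ aF] := FN.
have N0 n : 0 <= N n by exact: rep_ge0 (FN n).
have a_le n w : `|a_ n w| <= (rho ^+ size w)^-1 * N n.
  rewrite -ler_pdivrMl ?invr_gt0 ?exprn_gt0// invrK.
  rewrite (le_trans _ (repc_nrm_le (size w) r0 (aF n)))// mulrC ler_wpM2r ?exprn_ge0 ?(ltW r0)//.
  by apply: (@ler_wsum_term _ _ _ (fun w => `|a_ n w|)).
pose C (w : seq 'I_m) := (rho ^+ size w)^-1 * M.
have aC w K : \sum_(n < K) (rho ^+ size w)^-1 * N n <= C w.
  by rewrite -mulr_sumr ler_wpM2l// invr_ge0 exprn_ge0// ltW.
have ca w : cvgn (series (a_^~ w)).
  by apply: (abs_series_cvgn (M := fun n => (rho ^+ size w)^-1 * N n)) (aC w).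
pose a w := limn (series (a_^~ w)).
have aa w : series (a_^~ w) @ \oo --> a w by exact: ca.
have tailN := bounded_series_tail N0 NM.
(* finite partial sums of any weighted word sum pass to the limit in n *)
have fin_lim K (c : 'I_K -> seq 'I_m -> R) :
   (fun P => \sum_(k < K) wsum k (fun w => series (a_^~ w) P * c k w)) @ \oo -->
   \sum_(k < K) wsum k (fun w => a w * c k w).
  apply: (cvg_bigsum (u := fun (k : 'I_K) P => wsum k (fun w => series (a_^~ w) P * c k w))) => k.
  apply: (@cvg_wsum R nat _ _ m k (fun w P => series (a_^~ w) P * c k w) (fun w => a w * c k w)) => w.
  by apply: cvgM; [exact: aa|exact: cvg_cst].
have partial K P N' h : (N' <= P)%N -> box rho h ->
   `|\sum_(k < K) wsum k (fun w => series (a_^~ w) P * monom h w) -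
     \sum_(n < N') \sum_(k < K) hom (a_ n) k h| <= \sum_(N' <= n < P) N n.
  move=> NP hh.
  have -> : \sum_(k < K) wsum k (fun w => series (a_^~ w) P * monom h w) =
      \sum_(0 <= n < P) \sum_(k < K) hom (a_ n) k h.
    rewrite exchange_big; apply: eq_bigr => k _; rewrite -wsum_sum.
    by apply: eq_wsum => w _; rewrite seriesEnat /= mulr_suml.
  have -> : forall F : nat -> R, \sum_(0 <= n < P) F n = \sum_(n < N') F n + \sum_(N' <= n < P) F n.
    by move=> F'; rewrite -(big_mkord xpredT) -big_cat_nat.
  rewrite addrAC subrr add0r.
  rewrite (le_trans (ler_norm_sum _ _ _))// ler_sum// => n _.
  rewrite (le_trans (ler_norm_sum _ _ _))// (le_trans _ ((aF n).1 K))// ler_sum// => k _.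
  by apply: hom_le => i; exact/ltW.
exists a; split=> [K|h hh].
  rewrite -[X in X <= _](@ger0_norm _ _); last first.
    by apply: sumr_ge0 => k _; rewrite mulr_ge0 ?nrm_ge0// exprn_ge0// ltW.
  (* Pairing with the signs of the limit coefficients makes the norm linear in [a], so that
     [fin_lim] applies to it. *)
  pose s (k : nat) w : R := Num.sg (a w) * rho ^+ k.
  have -> : \sum_(k < K) nrm a k * rho ^+ k = \sum_(k < K) wsum k (fun w => a w * s k w).
    apply: eq_bigr => k _; rewrite -wsumZr; apply: eq_wsum => w _.
    by rewrite /s mulrA normrEsg [Num.sg _ * _]mulrC.
  rewrite -[X in `|X|]subr0; apply: (cvgn_dist_le (N := 0) (fin_lim K (fun k => s k))) => P _.
  rewrite subr0.
  have -> : \sum_(k < K) wsum k (fun w => series (a_^~ w) P * s k w) =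
      \sum_(n < P) \sum_(k < K) wsum k (fun w => a_ n w * s k w).
    rewrite exchange_big; apply: eq_bigr => k _; rewrite -wsum_sum.
    by apply: eq_wsum => w _; rewrite seriesEord /= mulr_suml.
  rewrite (le_trans (ler_norm_sum _ _ _))// (le_trans _ (NM P))// ler_sum// => n _.
  rewrite (le_trans (ler_norm_sum _ _ _))// (le_trans _ ((aF n).1 K))// ler_sum// => k _.
  rewrite (le_trans (ler_norm_wsum _ _))// -wsumZr; apply: ler_wsum => w _.
  rewrite /s !normrM ler_wpM2l// normrX (gtr0_norm r0) ler_piMl ?exprn_ge0 ?(ltW r0)//.
  by rewrite normr_sg; case: (_ != _).
apply/cvgn_epsP => e e0.
(* Three errors: cutting the sum over n at N' for the values, the same cut for the partial sums in
   the degree, and the convergence of the first N' series. *)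
have e30 : 0 < e / 3 by rewrite divr_gt0.
have [N' hN'] := tailN _ e30.
have A1 : `|f h - \sum_(n < N') F n h| <= e / 3.
  apply: (abs_series_tail (M := N) (B := M)) (Ff _ hh) _ _ hN' => // n.
  exact: rep_le (FN n) hh.
have A2 K : `|\sum_(k < K) hom a k h - \sum_(n < N') \sum_(k < K) hom (a_ n) k h| <= e / 3.
  apply: (cvgn_dist_le (N := N') (fin_lim K (fun k w => monom h w))) => P NP.
  by rewrite (le_trans (partial _ _ _ _ NP hh)).
have : (fun K => \sum_(n < N') series (fun k => hom (a_ n) k h) K) @ \oo --> \sum_(n < N') F n h.
  by apply: (cvg_bigsum (u := fun (n : 'I_N') K => series (fun k => hom (a_ n) k h) K)) => n; exact: (aF n).2.
move=> /cvgn_epsP/(_ _ e30)[K0 hK0]; exists K0 => K /hK0 A3.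
rewrite seriesEord.
have -> : e = e / 3 + (e / 3 + e / 3) by field.
have -> : f h - \sum_(k < K) hom a k h = (f h - \sum_(n < N') F n h) +
   ((\sum_(n < N') F n h - \sum_(n < N') \sum_(k < K) hom (a_ n) k h) -
    (\sum_(k < K) hom a k h - \sum_(n < N') \sum_(k < K) hom (a_ n) k h)) by ring.
rewrite (le_trans (ler_normD _ _))// lerD// (le_trans (ler_normB _ _))// lerD//.
rewrite (_ : \sum_(n < N') \sum_(k < K) hom (a_ n) k h = \sum_(n < N') series (fun k => hom (a_ n) k h) K)//.
by apply: eq_bigr => n _; rewrite seriesEord.
Qed.

(** Every homogeneous part of f is a finite sum of monomials times coefficients, so its product with
    g is covered by [rep_monomM]; [rep_series] adds up the degrees, and no Cauchy product is
    formed. *)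
Lemma rep_mul rho M M' f g : 0 < rho ->
  rep rho M f -> rep rho M' g -> rep rho (M * M') (fun h => f h * g h).
Proof.
move=> r0 [a [aM af]] gM.
apply: (@rep_series _ _ (fun k h => hom a k h * g h) (fun k => nrm a k * rho ^+ k * M')) => //.
- move=> k; have [r0' gM0] := (ltW r0, rep_ge0 gM).
  have -> : nrm a k * rho ^+ k * M' = wsum k (fun w => `|a w| * (rho ^+ size w * M')).
    by rewrite -mulrA -wsumZr; apply: eq_wsum => w ->.
  have := @rep_wsum m k (fun w h => a w * (monom h w * g h)) _ rho r0' (fun w _ => rep_scale (a w) (rep_monomM w r0' gM)).
  apply: rep_eq => h _; rewrite /hom -wsumZr; apply: eq_wsum => w _; exact: mulrA.
- by move=> K; rewrite -mulr_suml ler_wpM2r// (rep_ge0 gM).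
- move=> h hh.
  have -> : series (fun k => hom a k h * g h) = (fun k => series (fun k => hom a k h) k * g h).
    by apply/funext => K; rewrite !seriesEord mulr_suml.
  by apply: cvgM; [exact: af|exact: cvg_cst].
Qed.

(** Without a constant term every term of the majorant carries at least one factor [s] when the
    radius is multiplied by [s]. *)
Lemma rep_shrink rho M f s : 0 < rho -> 0 <= s <= 1 -> f 0 = 0 ->
  rep rho M f -> rep (s * rho) (s * M) f.
Proof.
move=> r0 /andP[s0 s1] f0 [a fM]; have a0 := repc_at0 r0 fM.
have [aM _] := fM; rewrite f0 in a0; exists a; split.
  move=> K; rewrite (le_trans _ (ler_wpM2l s0 (aM K)))// mulr_sumr ler_sum// => -[[|k] /= _] _.
    by rewrite /nrm /= -a0 normr0 !mul0r mulr0.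
  rewrite mulrCA ler_wpM2l ?nrm_ge0// exprMn ler_wpM2r ?exprn_ge0 ?(ltW r0)//.
  by rewrite exprS ler_piMr// exprn_ile1.
by apply: (repc_radius _ _ fM).2; rewrite ?mulr_ge0 ?(ltW r0)// ler_piMl// ltW.
Qed.

End WordSeries.

Section WordSeriesComp.
Context (R : realType) (m p : nat).

(** By [rep_mul] a monomial in psi has bound r ^+ size w, so the substituted series is majorised by
    that of f at radius r. The inequality r < rho is strict because psi must take its values in the
    open box. *)
Lemma rep_comp (f : 'rV[R]_p -> R) (psi : 'rV[R]_m -> 'rV[R]_p) rho M rho' r :
  0 < rho' -> 0 <= r -> r < rho -> rep rho M f ->
  (forall j, rep rho' r (fun h => psi h 0 j)) ->
  rep rho' M (f \o psi).
Proof.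
move=> r0' r0 rr [a [aM af]] psir.
have monr w : rep rho' (r ^+ size w) (fun h => monom (psi h) w).
  elim: w => [|j w ih].
    by have := rep_cst m rho' (1 : R); rewrite normr1 expr0; apply: rep_eq => h _; rewrite monom_nil.
  have := rep_mul r0' (psir j) ih; rewrite -exprS; apply: rep_eq => h _.
  by rewrite monom_cons.
apply: (@rep_series _ _ _ _ (fun k h => hom a k (psi h)) (fun k => nrm a k * r ^+ k)) => //.
- move=> k; have -> : nrm a k * r ^+ k = wsum k (fun w => `|a w| * r ^+ size w).
    by rewrite -wsumZr; apply: eq_wsum => w ->.
  exact: (@rep_wsum _ _ _ _ (fun w h => a w * monom (psi h) w) _ _ (ltW r0') (fun w _ => rep_scale (a w) (monr w))).
- move=> K; rewrite (le_trans _ (aM K))// ler_sum// => k _.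
  by rewrite ler_wpM2l ?nrm_ge0// lerXn2r ?nnegrE// ?(le_trans r0)// ltW.
- by move=> h hh; apply: af => j; rewrite (le_lt_trans (rep_le (psir j) hh)).
Qed.

End WordSeriesComp.

(** * First-order expansion in a second block of variables *)

Section Slice.
Context (R : realType) (p q : nat).
Implicit Types (h : 'rV[R]_p) (k : 'rV[R]_q) (w : seq 'I_(p + q)).

Definition monom0 w h : R := monom (row_mx h (0 : 'rV[R]_q)) w.

(** The coefficient of k_j in the monomial of [w] at (h, k), that is, its partial derivative at k =
    0. It is nonzero only if exactly one letter of [w] belongs to the second block. *)
Fixpoint monom1 w (j : 'I_q) h : R :=
  if w is i :: w' then
    match fintype.split i with
    | inl i' => h 0 i' * monom1 w' j h
    | inr j' => (j' == j)%:R * monom0 w' h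
    end
  else 0.

Lemma rep_monom0 rho w : 0 < rho -> rep rho (rho ^+ size w) (monom0 w).
Proof.
move=> r0; elim: w => [|i w ih].
  have := rep_cst p rho (1 : R); rewrite normr1; apply: rep_eq => h _.
  by rewrite /monom0 monom_nil.
case: (split_ordP i) => [i' ->|j' ->].
  have := rep_coordM i' (ltW r0) ih; rewrite -exprS; apply: rep_eq => h _.
  by rewrite /monom0 monom_cons row_mxEl.
have := rep_cst p rho (0 : R); rewrite normr0 => h0.
apply: (repW (M := 0)); first by rewrite exprn_ge0// ltW.
by apply: rep_eq h0 => h _; rewrite /monom0 monom_cons row_mxEr mxE mul0r.
Qed.

Lemma rep_monom1 rho w j : 0 < rho -> rep rho (rho ^+ size w / rho) (monom1 w j).
Proof.
move=> r0; elim: w => [|i w ih].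
  have := rep_cst p rho (0 : R); rewrite normr0 => h0.
  by apply: (repW (M := 0)) h0; rewrite divr_ge0// ?exprn_ge0// ltW.
rewrite /=; case: (split_ordP i) => [i' _|j' _].
  by have := rep_coordM i' (ltW r0) ih; rewrite mulrA -exprS.
have := rep_scale ((j' == j)%:R) (rep_monom0 w r0) => h0.
apply: (@repW _ _ _ (`|(j' == j)%:R| * rho ^+ size w)).
  rewrite (_ : _ / rho = rho ^+ size w) ?ler_piMl ?exprn_ge0 ?(ltW r0)//.
    by case: eqP; rewrite ?normr1 ?normr0.
  by rewrite exprS; field; rewrite gt_eqF.
exact: h0.
Qed.

(** A word with at most one letter of the second block leaves no remainder; any other word has two
    factors of size at most kappa in place of rho. In the induction the second of these factors
    comes from the first-order estimate [first]. *)
Lemma monom_slice rho kappa h k w : 0 < rho -> 0 <= kappa -> kappa <= rho -> box rho h ->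
  (forall j, `|k 0 j| <= kappa) ->
  `|monom (row_mx h k) w - monom0 w h - \sum_(j < q) k 0 j * monom1 w j h|
  <= (kappa / rho) ^+ 2 * rho ^+ size w.
Proof.
move=> r0 k0 kr hh kk.
have zr i : `|row_mx h k 0 i| <= rho.
  case: (split_ordP i) => [i' ->|j' ->]; rewrite ?row_mxEl ?row_mxEr; first exact/ltW.
  exact: le_trans (kk _) kr.
have c0 : 0 <= kappa / rho by rewrite divr_ge0// ltW.
have first v : `|monom (row_mx h k) v - monom0 v h| <= kappa / rho * rho ^+ size v.
  elim: v => [|i v ih].
    by rewrite /monom0 !monom_nil subrr normr0 mulr1.
  rewrite /monom0 !monom_cons -/(monom0 _ _) /= (exprS rho).
  case: (split_ordP i) => [i' ->|j' ->]; rewrite ?row_mxEl ?row_mxEr.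
    by rewrite -mulrBr normrM mulrCA ler_pM// ltW.
  rewrite mxE mul0r subr0 normrM mulrA divfK ?gt_eqF// ler_pM//.
  exact: monom_le.
elim: w => [|i w ih].
  rewrite /monom0 !monom_nil subrr big1 ?subr0 ?normr0 ?mulr1 ?exprn_ge0// => j _.
  by rewrite /= mulr0.
rewrite /monom0 !monom_cons -/(monom0 _ _) /= (exprS rho).
case: (split_ordP i) => [i' ->|j' ->]; rewrite ?row_mxEl ?row_mxEr.
  under eq_bigr do rewrite mulrCA.
  by rewrite -mulr_sumr -!mulrBr normrM mulrCA ler_pM// ltW.
rewrite (bigD1 j')//= eqxx big1 => [|j jj']; last by rewrite eq_sym (negPf jj') mul0r mulr0.
rewrite addr0 mxE mul0r subr0 mul1r -mulrBr normrM.
have -> : (kappa / rho) ^+ 2 * (rho * rho ^+ size w) = kappa * (kappa / rho * rho ^+ size w).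
  by field; rewrite gt_eqF.
by rewrite ler_pM.
Qed.

(** Only words with a single letter of the second block contribute to B j, and each contributes
    once. So no factor counting letters appears, and the derivative keeps the radius rho with the
    bound M / rho. *)
Lemma rep_slice rho M (H : 'rV[R]_(p + q) -> R) : 0 < rho -> rep rho M H ->
  exists B : 'I_q -> 'rV[R]_p -> R,
  (forall j, rep rho (M / rho) (B j)) /\
  forall h k kappa, box rho h -> 0 <= kappa -> kappa < rho -> (forall j, `|k 0 j| <= kappa) ->
    `|H (row_mx h k) - H (row_mx h 0) - \sum_(j < q) k 0 j * B j h|
    <= M * (kappa / rho) ^+ 2.
Proof.
move=> r0 [a [aM af]].
pose t j n h := wsum n (fun w => a w * monom1 w j h).
have trep j n : rep rho (nrm a n * rho ^+ n / rho) (t j n).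
  have -> : nrm a n * rho ^+ n / rho = wsum n (fun w => `|a w| * (rho ^+ size w / rho)).
    by rewrite -mulrA -wsumZr; apply: eq_wsum => w ->.
  exact: (@rep_wsum _ _ _ _ (fun w h => a w * monom1 w j h) _ _ (ltW r0) (fun w _ => rep_scale (a w) (rep_monom1 w j r0))).
have tM K : \sum_(n < K) nrm a n * rho ^+ n / rho <= M / rho.
  by rewrite -mulr_suml ler_wpM2r// invr_ge0 ltW.
pose B j h := limn (series (fun n => t j n h)).
have tB j h : box rho h -> series (fun n => t j n h) @ \oo --> B j h.
  move=> hh; suff : cvgn (series (fun n => t j n h)) by [].
  by apply: (abs_series_cvgn (M := fun n => nrm a n * rho ^+ n / rho)) tM => n; exact: rep_le (trep j n) hh.
exists B; split=> [j|h k kappa hh k0 kr kk].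
  exact: (rep_series r0 (trep j) tM (tB j)).
have b1 : box rho (row_mx h k).
  move=> i; case: (split_ordP i) => [i' ->|j' ->]; rewrite ?row_mxEl ?row_mxEr//.
  exact: le_lt_trans (kk _) kr.
have b0 : box rho (row_mx h (0 : 'rV[R]_q)).
  by move=> i; case: (split_ordP i) => [i' ->|j' ->]; rewrite ?row_mxEl ?row_mxEr// mxE normr0.
have cv : (fun K => series (fun n => hom a n (row_mx h k)) K -
    series (fun n => hom a n (row_mx h 0)) K -
    \sum_(j < q) k 0 j * series (fun n => t j n h) K) @ \oo -->
    H (row_mx h k) - H (row_mx h 0) - \sum_(j < q) k 0 j * B j h.
  apply: cvgB; first by apply: cvgB; exact: af.
  apply: (cvg_bigsum (u := fun (j : 'I_q) K => k 0 j * series (fun n => t j n h) K)) => j.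
  by apply: cvgM; [exact: cvg_cst|exact: tB].
rewrite -[X in `|X|]subr0; apply: (cvgn_dist_le (N := 0) cv) => K _.
rewrite subr0 !seriesEord /= -sumrB.
under [X in _ - X]eq_bigr do rewrite seriesEord /= mulr_sumr.
rewrite exchange_big -sumrB (le_trans (ler_norm_sum _ _ _))//.
have c20 : 0 <= (kappa / rho) ^+ 2 by rewrite exprn_even_ge0.
apply: le_trans (ler_wpM2r c20 (aM K)); rewrite mulr_suml; apply: ler_sum => n _.
have -> : hom a n (row_mx h k) - hom a n (row_mx h 0) - \sum_(j < q) k 0 j * t j n h =
   wsum n (fun w => a w * (monom (row_mx h k) w - monom0 w h - \sum_(j < q) k 0 j * monom1 w j h)).
  rewrite /hom /t; under [X in _ - X]eq_bigr do rewrite -wsumZ.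
  rewrite -wsum_sum -[- wsum _ _]mulN1r -wsumZ -wsumD -[- wsum _ _]mulN1r -wsumZ -wsumD.
  apply: eq_wsum => w _; rewrite !mulN1r !mulrBr /monom0; congr (_ - _).
  by rewrite mulr_sumr; apply: eq_bigr => j _; rewrite mulrCA.
rewrite (le_trans (ler_norm_wsum _ _))// mulrAC -mulrA -wsumZr; apply: ler_wsum => w <-.
by rewrite normrM ler_wpM2l// monom_slice// ltW.
Qed.

End Slice.

Section QuadraticRemainder.
Context (R : realType).

(** From degree two on, a term gains the factor (kappa / rho)^2 over its majorant at radius rho. The
    coefficients of one-letter words thereby act as partial derivatives. *)
Lemma repc_quad m rho M a (f : 'rV[R]_m -> R) : 0 < rho -> repc rho M a f ->
  forall (k : 'rV[R]_m) kappa, 0 <= kappa -> kappa < rho -> (forall j, `|k 0 j| <= kappa) ->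
  `|f k - f 0 - \sum_(j < m) k 0 j * a [:: j]| <= M * (kappa / rho) ^+ 2.
Proof.
move=> r0 fM k kappa k0 kr kk; have [aM af] := fM.
have bk : box rho k by move=> j; rewrite (le_lt_trans (kk j)).
rewrite -addrA -opprD (repc_at0 r0 fM).
apply: (cvgn_dist_le (N := 2) (af _ bk)) => -[|[|K]]// _.
have -> : series (fun n => hom a n k) K.+2 =
    hom a 0 k + (hom a 1 k + \sum_(i < K) hom a i.+2 k).
  by rewrite seriesEord [LHS]big_ord_recl [X in _ + X]big_ord_recl.
have -> : hom a 0 k = a [::] by rewrite /hom /= monom_nil mulr1.
have -> : hom a 1 k = \sum_(j < m) k 0 j * a [:: j].
  by apply: eq_bigr => i _; rewrite /= monom_cons monom_nil mulr1 mulrC.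
have -> : forall x y z : R, x + (y + z) - (x + y) = z by move=> x y z; ring.
rewrite (le_trans (ler_norm_sum _ _ _))//.
have c20 : 0 <= (kappa / rho) ^+ 2 by rewrite exprn_even_ge0.
apply: le_trans (ler_wpM2r c20 (aM K.+2)); rewrite 2!big_ord_recl !mulrDl addrA -[leLHS]add0r lerD//.
  by rewrite addr_ge0// (mulr_ge0 _ c20)// mulr_ge0 ?nrm_ge0 ?exprn_ge0// ltW.
rewrite mulr_suml.
apply: ler_sum => n _; rewrite (le_trans (hom_le _ _ kk))// -mulrA ler_wpM2l ?nrm_ge0//.
rewrite (_ : (lift ord0 (lift ord0 n) : nat) = n.+2)// !exprS expr0 mulr1.
have -> : rho * (rho * rho ^+ n) * (kappa / rho * (kappa / rho)) = kappa * (kappa * rho ^+ n).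
  by field; rewrite gt_eqF.
by rewrite !ler_wpM2l// lerXn2r ?nnegrE ?(ltW r0)// ltW.
Qed.

Lemma quad_is_derive (V : normedModType R) (f : V -> R) x v d C delta : 0 < delta ->
  (forall t : R, `|t| < delta -> `|f (t *: v + x) - f x - t * d| <= C * t ^+ 2) ->
  is_derive x v f d.
Proof.
move=> d0 H; have C0 : 0 <= C.
  have h2 : 0 < delta / 2 by rewrite divr_gt0.
  have /H : `|delta / 2| < delta by rewrite gtr0_norm//; lra.
  by move/(le_trans (normr_ge0 _)); rewrite pmulr_lge0// exprn_gt0.
have cv : (fun t => t^-1 *: (f (t *: v + x) - f x)) @ (0 : R)^' --> d.
  apply/cvgrPdist_le => e e0; near=> t.
  have t0 : t != 0 by near: t; exact: nbhs_dnbhs_neq.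
  have td : `|t| < delta.
    by near: t; apply: dnbhs0_lt.
  have te : `|t| < e / (C + 1) by near: t; apply: dnbhs0_lt; rewrite divr_gt0// ltr_wpDl.
  have -> : d - t^-1 *: (f (t *: v + x) - f x) = - (t^-1 * (f (t *: v + x) - f x - t * d)).
    by rewrite /GRing.scale /=; field.
  rewrite normrN normrM normfV ler_pdivrMl ?normr_gt0// (le_trans (H _ td))//.
  have : `|t| * (C + 1) <= e by rewrite -ler_pdivlMr ?ltr_wpDl// ltW.
  have := normr_ge0 t; rewrite -(real_normK (num_real t)); nra.
apply: DeriveDef; first by apply/cvg_ex; exists d; exact: cv.
exact: cvg_lim.
Unshelve. all: by end_near.
Qed.

End QuadraticRemainder.

(** * Analytic functions *)

Section AnalyticAt.
Context (R : realType).

Lemma analytic_atP m (f : 'rV[R]_m -> R) x :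
  analytic_at f x <-> exists rho M, 0 < rho /\ rep rho M (fun h => f (x + h)).
Proof.
split=> [[a [rho [r0 ca fa]]]|[rho [M [r0 [a [aM af]]]]]].
  exists rho, (limn (series (fun k => (\sum_(w : k.-tuple 'I_m) `|a w|) * rho ^+ k))).
  split => //; exists a; split=> [K|h hh]; last first.
    have -> : hom a ^~ h = (fun k => \sum_(w : k.-tuple 'I_m) a w * \prod_(i <- w) h 0 i).
      by apply/funext => k; rewrite /hom -wsumE.
    exact: fa.
  have e : (fun k => (\sum_(w : k.-tuple 'I_m) `|a w|) * rho ^+ k) = (fun k => nrm a k * rho ^+ k).
    by apply/funext => k; rewrite /nrm -wsumE.
  rewrite e in ca *.
  have nd : nondecreasing_seq (series (fun k => nrm a k * rho ^+ k)).
    by apply: nondecreasing_series => n _ _; rewrite mulr_ge0 ?nrm_ge0 ?exprn_ge0// ltW.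
  by have := nondecreasing_cvgn_le nd ca K; rewrite [X in X K]seriesEord.
exists a, rho; split=> // [|h hh]; last first.
  have -> : (fun k => \sum_(w : k.-tuple 'I_m) a w * \prod_(i <- w) h 0 i) = hom a ^~ h.
    by apply/funext => k; rewrite /hom -wsumE.
  exact: af.
have -> : (fun k => (\sum_(w : k.-tuple 'I_m) `|a w|) * rho ^+ k) = (fun k => nrm a k * rho ^+ k).
  by apply/funext => k; rewrite /nrm -wsumE.
by apply: bounded_series_cvgn aM => k; rewrite mulr_ge0 ?nrm_ge0 ?exprn_ge0// ltW.
Qed.

Lemma nbhs_boxP m (x : 'rV[R]_m) (A : set 'rV[R]_m) :
  nbhs x A <-> exists2 rho : R, 0 < rho & forall h, box rho h -> A (x + h).
Proof.
split=> [/nbhs_ballP[e e0 eA]|[e e0 eA]].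
  exists e => // h hh; apply: eA; split=> // i j; rewrite !ord1 /ball /= mxE opprD addNKr normrN.
  exact: hh.
apply/nbhs_ballP; exists e => // y xy.
rewrite -(subrK x y) addrC; apply: eA => i; rewrite !mxE distrC.
exact: (xy.2 ord0 i).
Qed.

Section Closure.
Context (m : nat).
Implicit Types (f g : 'rV[R]_m -> R) (x : 'rV[R]_m).

Lemma analytic_near f g x : (\forall y \near x, f y = g y) -> analytic_at f x -> analytic_at g x.
Proof.
move=> /nbhs_boxP[d d0 fg] /analytic_atP[rho [M [r0 fM]]].
apply/analytic_atP; exists (Num.min d rho), M; split; first by rewrite lt_min d0.
apply: (@rep_eq _ _ _ _ (fun h => f (x + h))).
  by move=> h hh; apply: fg => i; rewrite (lt_le_trans (hh i))// ge_min lexx.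
by apply: rep_radius fM; rewrite ?ge_min ?lexx ?orbT// le_min !ltW.
Qed.

Lemma analytic_cst c x : analytic_at (fun=> c) x.
Proof. by apply/analytic_atP; exists 1, `|c|; split=> //; exact: rep_cst. Qed.

Lemma analytic_common f g x : analytic_at f x -> analytic_at g x ->
  exists rho M M', [/\ 0 < rho, rep rho M (fun h => f (x + h)) & rep rho M' (fun h => g (x + h))].
Proof.
move=> /analytic_atP[rho [M [r0 fM]]] /analytic_atP[rho' [M' [r0' gM]]].
exists (Num.min rho rho'), M, M'; split; first by rewrite lt_min r0.
  by apply: rep_radius fM; rewrite ?ge_min ?lexx ?orbT// le_min !ltW.
by apply: rep_radius gM; rewrite ?ge_min ?lexx ?orbT// le_min !ltW.
Qed.

Lemma analyticD f g x : analytic_at f x -> analytic_at g x -> analytic_at (fun y => f y + g y) x.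
Proof.
move=> fa /(analytic_common fa)[rho [M [M' [r0 fM gM]]]].
by apply/analytic_atP; exists rho, (M + M'); split=> //; apply: rep_add => //; exact: ltW.
Qed.

Lemma analyticM f g x : analytic_at f x -> analytic_at g x -> analytic_at (fun y => f y * g y) x.
Proof.
move=> fa /(analytic_common fa)[rho [M [M' [r0 fM gM]]]].
by apply/analytic_atP; exists rho, (M * M'); split=> //; exact: rep_mul.
Qed.

Lemma analyticZ f c x : analytic_at f x -> analytic_at (fun y => c * f y) x.
Proof. exact/analyticM/analytic_cst. Qed.

Lemma analyticB f g x : analytic_at f x -> analytic_at g x -> analytic_at (fun y => f y - g y) x.
Proof.
move=> fa ga; have := analyticD fa (analyticZ (-1) ga).
by under eq_fun do rewrite mulN1r.
Qed.

Lemma analytic_coord i x : analytic_at (fun y => y 0 i) x.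
Proof.
apply/analytic_atP; exists 1, (`|x 0 i| + 1 * 1); split=> //.
apply: (@rep_eq _ _ _ _ (fun h => x 0 i + h 0 i * 1)).
  by move=> h _; rewrite mxE mulr1.
apply: rep_add => //; first exact: rep_cst.
by apply: rep_coordM => //; have := rep_cst m (1 : R) (1 : R); rewrite normr1.
Qed.

(** Serves to keep an inner function inside the box of an outer one: [f - f x] has no constant term,
    so [rep_shrink] makes its bound as small as wanted. *)
Lemma analytic_rep0 f x e : analytic_at f x -> 0 < e ->
  exists2 rho, 0 < rho & exists2 r, r < e & 0 <= r /\ rep rho r (fun h => f (x + h) - f x).
Proof.
move=> fa e0; have /analytic_atP[rho [M [r0 fM]]] := analyticB fa (analytic_cst (f x) x).
have M0 := rep_ge0 fM.
pose s := Num.min 1 (e / 2 / (M + 1)).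
have s0 : 0 < s by rewrite lt_min ltr01 !divr_gt0// ltr_wpDl.
exists (s * rho); first exact: mulr_gt0.
have sM : s * M <= e / 2.
  apply: (@le_trans _ _ (e / 2 / (M + 1) * (M + 1))); last by rewrite divfK// gt_eqF// ltr_wpDl.
  by apply: ler_pM; rewrite ?(ltW s0)// ?lerDl// ge_min lexx orbT.
exists (s * M); first by rewrite (le_lt_trans sM)//; lra.
split; first by rewrite mulr_ge0// ltW.
by apply: rep_shrink fM; rewrite ?(ltW s0) ?ge_min ?lexx// addr0 subrr.
Qed.

End Closure.

Lemma analytic_comp m p (f : 'rV[R]_p -> R) (psi : 'rV[R]_m -> 'rV[R]_p) x :
  analytic_at f (psi x) -> analytic_map_at psi x -> analytic_at (f \o psi) x.
Proof.
move=> /analytic_atP[rho [M [r0 fM]]] pa.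
have h2 : 0 < rho / 2 by rewrite divr_gt0.
have /choice[F HF] : forall j, exists F : R, 0 < F /\ rep F (rho / 2) (fun h => psi (x + h) 0 j - psi x 0 j).
  move=> j; have [F F0 [r rr [r0' fr]]] := analytic_rep0 (pa j) h2.
  by exists F; split=> //; apply: repW fr; exact: ltW.
have [F0 [F00 F0F]] : exists F0, 0 < F0 /\ forall j, F0 <= F j.
  exists (\big[Num.min/1]_j F j); split.
    by elim/big_ind: _ => // [a b a0 b0|j _]; [rewrite lt_min a0|exact: (HF j).1].
  by move=> j; exact: bigmin_le_cond.
apply/analytic_atP; exists F0, M; split=> //.
have := @rep_comp _ _ _ (fun h => f (psi x + h)) (fun h => psi (x + h) - psi x) rho M F0 (rho / 2) F00 (ltW h2).
have lt2 : rho / 2 < rho by lra.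
move=> /(_ lt2 fM) H.
apply: (@rep_eq _ _ _ _ ((fun h => f (psi x + h)) \o (fun h => psi (x + h) - psi x))).
  by move=> h _ /=; rewrite addrC subrK.
apply: H => j; apply: (@rep_radius _ _ (F j)); rewrite ?(ltW F00)//.
by apply: rep_eq (HF j).2 => h _; rewrite !mxE.
Qed.

(** Recentring at h is composition with the translation k -> h + k, whose j-th component has bound
    |h_j| + s, kept below rho by the choice of s. *)
Lemma rep_analytic m (f : 'rV[R]_m -> R) rho M h : 0 < rho -> rep rho M f ->
  box rho h -> analytic_at f h.
Proof.
move=> r0 fM hh.
have [s [s0 hs]] : exists s, 0 < s /\ forall i, `|h 0 i| + s < rho.
  exists ((\big[Num.min/rho]_i (rho - `|h 0 i|)) / 2).
  have pos : 0 < \big[Num.min/rho]_i (rho - `|h 0 i|).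
    by elim/big_ind: _ => // [a b a0 b0|j _]; [rewrite lt_min a0|rewrite subr_gt0].
  split; first by rewrite divr_gt0.
  move=> i; have : \big[Num.min/rho]_i (rho - `|h 0 i|) <= rho - `|h 0 i|.
    exact: bigmin_le_cond.
  by have := hh i; lra.
apply/analytic_atP; exists s, M; split=> //.
have [r [r1 [r2 r3]]] : exists r, [/\ 0 <= r, r < rho & forall i, `|h 0 i| + s <= r].
  exists (\big[Num.max/0]_i (`|h 0 i| + s)); split.
  - exact: bigmax_ge_id.
  - by elim/big_ind: _ => // a b a0 b0; rewrite gt_max a0.
  - by move=> i; exact: le_bigmax_cond.
have := @rep_comp _ _ _ f (fun k => h + k) rho M s r s0 r1 r2 fM; apply => j.
apply: (@repW _ _ _ (`|h 0 j| + s * 1)); first by rewrite mulr1.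
apply: (@rep_eq _ _ _ _ (fun k => h 0 j + k 0 j * 1)).
  by move=> k _; rewrite mxE mulr1.
apply: rep_add (ltW s0) _ _; first exact: rep_cst.
by apply: rep_coordM (ltW s0) _; have := rep_cst m s (1 : R); rewrite normr1.
Qed.

End AnalyticAt.

(** * The identity theorem in one variable *)

Section OneVariable.
Context (R : realType).

Definition ana1 (u : R -> R) (t : R) : Prop := exists (c : nat -> R) (rho M : R),
  [/\ 0 < rho, forall K, \sum_(k < K) `|c k| * rho ^+ k <= M &
    forall s, `|s| < rho -> series (fun k => c k * s ^+ k) @ \oo --> u (t + s)].

Lemma analytic_line m (f : 'rV[R]_m -> R) (x v : 'rV[R]_m) (t : R) :
  analytic_at f (x + t *: v) -> ana1 (fun s => f (x + s *: v)) t.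
Proof.
move=> /analytic_atP[rho [M [r0 [a [aM af]]]]].
pose b := 1 + \sum_i `|v 0 i|.
have vb i : `|v 0 i| <= b.
  by rewrite /b (bigD1 i)//= addrCA lerDl addr_ge0// sumr_ge0.
have b0 : 0 < b by rewrite ltr_pwDl// sumr_ge0.
exists (fun k => hom a k v), (rho / b), M; split; first exact: divr_gt0.
  move=> K; rewrite (le_trans _ (aM K))// ler_sum// => k _.
  rewrite (le_trans (ler_wpM2r _ (hom_le a k vb)))// ?exprn_ge0 ?divr_ge0 ?(ltW r0) ?(ltW b0)//.
  by rewrite -mulrA -exprMn (mulrC b) divfK// gt_eqF.
move=> s sr; have sv : box rho (s *: v).
  move=> i; rewrite mxE normrM (le_lt_trans (ler_wpM2l _ (vb i)))//.
  by rewrite -ltr_pdivlMr.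
have := af _ sv; rewrite scalerDl addrA; under [X in series X]eq_fun do rewrite homZ mulrC.
by [].
Qed.

Lemma ana1B u v t : ana1 u t -> ana1 v t -> ana1 (fun s => u s - v s) t.
Proof.
move=> [c [rho [M [r0 cM cu]]]] [c' [rho' [M' [r0' cM' cu']]]].
exists (fun k => c k - c' k), (Num.min rho rho'), (M + M'); split.
- by rewrite lt_min r0.
- move=> K; rewrite (le_trans _ (lerD (cM K) (cM' K)))// -big_split ler_sum//= => k _.
  have m0 : 0 <= Num.min rho rho' by rewrite le_min !ltW.
  rewrite (le_trans (ler_wpM2r _ (ler_normB _ _)))// ?exprn_ge0// mulrDl lerD//.
    by rewrite ler_wpM2l// lerXn2r ?nnegrE ?ge_min ?lexx// ltW.
  by rewrite ler_wpM2l// lerXn2r ?nnegrE ?ge_min ?lexx ?orbT// ltW.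
- move=> s; rewrite lt_min => /andP[sr sr'].
  have -> : series (fun k => (c k - c' k) * s ^+ k) = series (fun k => c k * s ^+ k) \- series (fun k => c' k * s ^+ k).
    by apply/funext => K; rewrite /= !seriesEord /= -sumrB; apply: eq_bigr => k _; rewrite mulrBl.
  by apply: cvgB; [exact: cu|exact: cu'].
Qed.

(** One-sided, because at the supremum in [ana1_identity] the function is known only to the left. *)
Definition flat_left (u : R -> R) t := forall N, exists C d : R, 0 < d /\
  forall s, - d < s -> s < 0 -> `|u (t + s)| <= C * `|s| ^+ N.

(** All coefficients vanish, by strong induction: if those before c N do, then c N s^N differs from
    u (t + s) by O(s^(N+1)), and u (t + s) itself has that order for s < 0. *)
Lemma ana1_flat u t : ana1 u t -> flat_left u t ->
  exists2 rho, 0 < rho & forall s, `|s| < rho -> u (t + s) = 0.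
Proof.
move=> [c [rho [M [r0 cM cu]]]] fl; exists rho => //.
have M0 : 0 <= M by have := cM 0%N; rewrite big_ord0.
have c0 : forall N k, (k < N)%N -> c k = 0.
  elim=> // N ih k; rewrite ltnS leq_eqVlt => /orP[/eqP ->|/ih //].
  have [C [d [d0 hC]]] := fl N.+1.
  have expand s : `|s| < rho -> `|u (t + s) - c N * s ^+ N| <= M * (`|s| / rho) ^+ N.+1.
    move=> sr; apply: (cvgn_dist_le (N := N.+1) (cu s sr)) => K NK.
    have [L ->] : exists L, K = (N.+1 + L)%N by exists (K - N.+1)%N; rewrite subnKC.
    rewrite seriesEord /= big_split_ord /= big_ord_recr /= big1 ?add0r; last first.
      by move=> i _; rewrite ih// mul0r.
    rewrite addrAC subrr add0r (le_trans (ler_norm_sum _ _ _))//.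
    have sr1 : `|s| / rho <= 1 by rewrite ler_pdivrMr// mul1r ltW.
    have sr0 : 0 <= `|s| / rho by rewrite divr_ge0// ltW.
    rewrite (le_trans _ (ler_wpM2r (exprn_ge0 _ sr0) (cM (N.+1 + L)%N)))// big_split_ord /= mulrDl.
    rewrite -[leLHS]add0r lerD//.
      by rewrite mulr_ge0 ?exprn_ge0// sumr_ge0// => i _; rewrite mulr_ge0// exprn_ge0// ltW.
    rewrite mulr_suml ler_sum// => i _; rewrite normrM normrX -mulrA ler_wpM2l//.
    rewrite exprD expr_div_n.
    rewrite [leLHS](_ : _ = `|s| ^+ N.+1 * `|s| ^+ i); last by rewrite -exprD.
    rewrite [leRHS](_ : _ = `|s| ^+ N.+1 * rho ^+ i); last first.
      by rewrite exprD; field; rewrite expf_neq0// gt_eqF.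
    by rewrite ler_wpM2l ?exprn_ge0// lerXn2r ?nnegrE// ?(ltW r0)// ltW.
  apply/eqP; rewrite -normr_le0; apply/ler_addgt0Pr => e e0; rewrite add0r.
  pose D := `|C| + M / rho ^+ N.+1.
  have D0 : 0 <= D by rewrite addr_ge0// divr_ge0// exprn_ge0// ltW.
  (* Small enough for the flatness estimate, for the expansion, and for D s <= e. *)
  pose s := Num.min (Num.min (d / 2) (rho / 2)) (e / (D + 1)).
  have s0 : 0 < s by rewrite !lt_min !divr_gt0// ltr_wpDl.
  have sd : s < d by rewrite (@le_lt_trans _ _ (d / 2)) ?ge_min ?lexx//; lra.
  have sr : s < rho by rewrite (@le_lt_trans _ _ (rho / 2)) ?ge_min ?lexx ?orbT//; lra.
  have se : s * (D + 1) <= e by rewrite -ler_pdivlMr ?ltr_wpDl// ge_min lexx orbT.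
  have nN : `|- s| = s by rewrite normrN gtr0_norm.
  have h1 : `|u (t + - s)| <= C * s ^+ N.+1 by rewrite -{2}nN; apply: hC; rewrite ?ltrN2 ?oppr_lt0.
  have := expand (- s); rewrite nN => /(_ sr) h2.
  have sN : 0 < s ^+ N by rewrite exprn_gt0.
  have : `|c N| * s ^+ N <= (D * s) * s ^+ N.
    have -> : `|c N| * s ^+ N = `|u (t + - s) - (u (t + - s) - c N * (- s) ^+ N)|.
      by rewrite opprB addrC subrK normrM normrX nN.
    rewrite (le_trans (ler_normB _ _))// /D.
    have -> : (`|C| + M / rho ^+ N.+1) * s * s ^+ N = `|C| * s ^+ N.+1 + M * (s / rho) ^+ N.+1.
      by rewrite expr_div_n !exprS; field; rewrite expf_neq0// gt_eqF.
    by apply: lerD => //; apply: le_trans h1 _; rewrite ler_wpM2r ?ler_norm// exprn_ge0// ltW.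
  rewrite (ler_pM2r sN) => h3; apply: le_trans h3 _; nra.
move=> s sr; apply/eqP; rewrite -subr_eq0 subr0 -normr_le0 -[X in `|X|]subr0.
apply: (cvgn_dist_le (N := 0) (cu s sr)) => K _.
by rewrite seriesEord /= big1 ?subrr ?normr0// => k _; rewrite (c0 k.+1)// mul0r.
Qed.

(* The supremum T of the t such that u = 0 on [0, t] cannot be < 1: u is flat
   on the left of T, hence vanishes around T. *)
Lemma ana1_identity u : (forall t, 0 <= t <= 1 -> ana1 u t) -> flat_left u 0 -> u 1 = 0.
Proof.
move=> ua u0.
pose S := [set t : R | 0 <= t <= 1 /\ forall s, 0 <= s <= t -> u s = 0].
have S0 : S 0.
  split; first by rewrite lexx ler01.
  move=> s /andP[s0 s1]; have -> : s = 0 by apply/eqP; rewrite eq_le s0 s1.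
  have [|rho r0 H] := ana1_flat (ua 0 _) u0; first by rewrite lexx ler01.
  by have := H 0; rewrite addr0 normr0; apply.
have ubS : has_ubound S by exists 1 => t [/andP[]].
have supS : has_sup S by split=> //; exists 0.
set T := sup S.
have T01 : 0 <= T <= 1.
  apply/andP; split; first exact: ub_le_sup.
  by apply: ge_sup; [exists 0|move=> t [/andP[]]].
have /andP[T0 T1] := T01.
have below s : 0 <= s -> s < T -> u s = 0.
  move=> s0 sT; have [t [tS1 tS2] st] := sup_gt (ex_intro _ 0 S0 : S !=set0) sT.
  by apply: tS2; rewrite s0 ltW.
have fl : flat_left u T.
  (* At T = 0 there is no interval to the left on which u is known to vanish, and the hypothesis at
     0 takes over. *)
  have [T00|T00] := eqVneq T 0; first by rewrite T00.
  move=> N; exists 0, T; split; first by rewrite lt_neqAle eq_sym T00.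
  move=> s sT s0; rewrite below ?normr0 ?mul0r//; last by lra.
  by lra.
have [rho r0 H] := ana1_flat (ua T T01) fl.
have uT s : 0 <= s -> s < T + rho -> u s = 0.
  move=> s0 sT; have [sT'|Ts] := ltP s T; first exact: below.
  by rewrite -(subrK T s) addrC; apply: H; rewrite ger0_norm; lra.
have [T1'|T1'] := ltP 1 (T + rho); first by apply: uT.
have : S (T + rho / 2).
  split; first by apply/andP; split; lra.
  by move=> s /andP[s0 sT]; apply: uT => //; lra.
by move=> /(ub_le_sup ubS); rewrite -/T; lra.
Qed.

End OneVariable.

(** * Analytic functions on a Lie group *)

Section Quadratic.
Context (R : realType).

(** Differentiability strengthened to a uniform O(kappa^2) remainder: power series provide it, and
    the chain rule along curves becomes a finite estimate instead of a limit. *)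
Definition quadr q (f : 'rV[R]_q -> R) (x : 'rV[R]_q) (L : 'I_q -> R) :=
  exists C d, 0 < d /\ forall (k : 'rV[R]_q) kappa, 0 <= kappa -> kappa < d ->
    (forall j, `|k 0 j| <= kappa) ->
    `|f (x + k) - f x - \sum_(j < q) k 0 j * L j| <= C * kappa ^+ 2.

Definition quad1 (u : R -> R) (c d : R) :=
  exists C delta, 0 < delta /\ forall s, `|s| < delta -> `|u s - c - s * d| <= C * s ^+ 2.

Lemma analytic_quadr q (f : 'rV[R]_q -> R) x : analytic_at f x -> exists L, quadr f x L.
Proof.
move=> /analytic_atP[rho [M [r0 [a fM]]]]; exists (fun j => a [:: j]).
exists (M / rho ^+ 2), rho; split=> // k kappa k0 kr kk.
have := repc_quad r0 fM k0 kr kk; rewrite addr0 expr_div_n => /le_trans; apply.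
by rewrite mulrA mulrAC.
Qed.

Lemma quadr_curve q (f : 'rV[R]_q -> R) x L (psi : R -> 'rV[R]_q) (B : 'I_q -> R) :
  quadr f x L -> (forall l, quad1 (fun s => psi s 0 l) (x 0 l) (B l)) ->
  quad1 (f \o psi) (f x) (\sum_l B l * L l).
Proof.
move=> [C [d [d0 hf]]] /choice[C' /choice[d' H]].
pose D := \big[Num.min/d]_l d' l; pose E := \sum_l `|C' l|; pose V := 1 + \sum_l `|B l|.
have D0 : 0 < D by rewrite /D; elim/big_ind: _ => // [a b a0 b0|l _]; [rewrite lt_min a0|exact: (H l).1].
have E0 : 0 <= E by rewrite sumr_ge0.
have V0 : 0 < V by rewrite ltr_pwDl// sumr_ge0.
have EC l : `|C' l| <= E by rewrite /E (bigD1 l)//= lerDl sumr_ge0.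
have VB l : `|B l| <= V by rewrite /V (bigD1 l)//= addrCA lerDl addr_ge0// sumr_ge0.
have DE l : D <= d' l by exact: bigmin_le_cond.
(* The bound 1 gives s^2 <= |s|, hence |psi s - x| <= |s| (V + E); the bound d / (V + E) keeps this
   below d. *)
pose r := Num.min (Num.min D 1) (d / (V + E)).
have VE : 0 < V + E by rewrite ltr_wpDr.
have C0 : 0 <= C.
  have d20 : 0 < d / 2 by rewrite divr_gt0.
  have := hf 0 (d / 2) (ltW d20); have dd : d / 2 < d by lra.
  move=> /(_ dd); have h0 j : `|(0 : 'rV[R]_q) 0 j| <= d / 2 by rewrite mxE normr0 ltW.
  by move=> /(_ h0) /(le_trans (normr_ge0 _)); rewrite pmulr_lge0// exprn_gt0.
exists (C * (V + E) ^+ 2 + \sum_l E * `|L l|), r; split; first by rewrite !lt_min D0 ltr01 divr_gt0.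
move=> s; rewrite !lt_min => /andP[/andP[sD s1] sd].
have psl l : `|psi s 0 l - x 0 l - s * B l| <= E * s ^+ 2.
  apply: le_trans ((H l).2 s (lt_le_trans sD (DE l))) _.
  by rewrite ler_wpM2r ?sqr_ge0// (le_trans (ler_norm _)).
have kk l : `|(psi s - x) 0 l| <= `|s| * (V + E).
  have -> : (psi s - x) 0 l = (psi s 0 l - x 0 l - s * B l) + s * B l by rewrite !mxE subrK.
  rewrite (le_trans (ler_normD _ _))// addrC mulrDr lerD//.
    by rewrite normrM ler_wpM2l.
  rewrite (le_trans (psl l))// -(real_normK (num_real s)) mulrC expr2 ler_wpM2r//.
  by rewrite ler_piMr// ltW.
have sd' : `|s| * (V + E) < d by rewrite -ltr_pdivlMr.
have := hf _ _ _ sd' kk; rewrite mulr_ge0 ?(ltW VE)// => /(_ isT).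
have -> : x + (psi s - x) = psi s by rewrite addrC subrK.
move=> h1.
have -> : (f \o psi) s - f x - s * (\sum_l B l * L l) =
   (f (psi s) - f x - \sum_(j < q) (psi s - x) 0 j * L j) +
   \sum_l (psi s 0 l - x 0 l - s * B l) * L l.
  have -> : \sum_l (psi s 0 l - x 0 l - s * B l) * L l =
      \sum_l (psi s - x) 0 l * L l - s * (\sum_l B l * L l).
    by rewrite mulr_sumr -sumrB; apply: eq_bigr => l _; rewrite !mxE; ring.
  by rewrite /=; ring.
rewrite (le_trans (ler_normD _ _))// mulrDl lerD//.
  by rewrite (le_trans h1)// exprMn real_normK ?num_real// mulrCA mulrC.
rewrite (le_trans (ler_norm_sum _ _ _))// mulr_suml ler_sum// => l _.
by rewrite normrM mulrAC ler_wpM2r.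
Qed.

Lemma quad1_is_derive (V : normedModType R) (f : V -> R) x v d :
  quad1 (fun s => f (x + s *: v)) (f x) d -> is_derive x v f d.
Proof.
move=> [C [e [e0 H]]]; apply: (quad_is_derive e0 (C := C)) => t te.
by rewrite [t *: v + x]addrC; exact: H.
Qed.

Lemma quad1_line q (x v : 'rV[R]_q) l : quad1 (fun s => (x + s *: v) 0 l) (x 0 l) (v 0 l).
Proof.
exists 0, 1; split=> // s _; rewrite !mxE mul0r normr_le0; apply/eqP; ring.
Qed.

Lemma quadr_derive q (f : 'rV[R]_q -> R) x L v : quadr f x L ->
  'D_v f x = \sum_j v 0 j * L j.
Proof.
move=> fL; have := quad1_is_derive (quadr_curve fL (quad1_line x v)).
by move=> h; rewrite derive_val.
Qed.

End Quadratic.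

Section AnalyticMaps.
Context (R : realType).

Lemma analytic_map_continuous m p (psi : 'rV[R]_m -> 'rV[R]_p) x :
  analytic_map_at psi x -> psi y @[y --> x] --> psi x.
Proof.
move=> pa A /nbhs_boxP[e e0 eA].
have /choice[d H] : forall j, exists d : R, 0 < d /\ forall h, box d h -> `|psi (x + h) 0 j - psi x 0 j| < e.
  move=> j; have [d d0 [r re [r0 fr]]] := analytic_rep0 (pa j) e0.
  by exists d; split=> // h hh; exact: le_lt_trans (rep_le fr hh) re.
apply/nbhs_boxP; exists (\big[Num.min/1]_j d j).
  by elim/big_ind: _ => // [a b a0 b0|l _]; [rewrite lt_min a0|exact: (H l).1].
move=> h hh; rewrite /= -(subrK (psi x) (psi (x + h))) addrC; apply: eA => j.
rewrite !mxE; apply: (H j).2 => i; apply: lt_le_trans (hh i) _.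
exact: bigmin_le_cond.
Qed.

Lemma analytic_map_comp m p q (f : 'rV[R]_p -> 'rV[R]_q) (psi : 'rV[R]_m -> 'rV[R]_p) x :
  analytic_map_at f (psi x) -> analytic_map_at psi x -> analytic_map_at (f \o psi) x.
Proof. by move=> fa pa j; apply: (analytic_comp (f := fun y => f y 0 j)) (fa j) pa. Qed.

Lemma analytic_map_near m p (f g : 'rV[R]_m -> 'rV[R]_p) x :
  (\forall y \near x, f y = g y) -> analytic_map_at f x -> analytic_map_at g x.
Proof.
by move=> fg fa j; apply: analytic_near (fa j); apply: filterS fg => y ->.
Qed.

Lemma analytic_map_cst m p (c : 'rV[R]_p) (x : 'rV[R]_m) : analytic_map_at (fun=> c) x.
Proof. by move=> j; exact: analytic_cst. Qed.

Lemma analytic_mapD m p (f g : 'rV[R]_m -> 'rV[R]_p) x :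
  analytic_map_at f x -> analytic_map_at g x -> analytic_map_at (fun y => f y + g y) x.
Proof.
by move=> fa ga j; under eq_fun do rewrite mxE; exact: analyticD.
Qed.

Lemma analytic_map_row m p q (f : 'rV[R]_m -> 'rV[R]_p) (g : 'rV[R]_m -> 'rV[R]_q) x :
  analytic_map_at f x -> analytic_map_at g x -> analytic_map_at (fun y => row_mx (f y) (g y)) x.
Proof.
move=> fa ga j; case: (split_ordP j) => [i ->|i ->].
  by under eq_fun do rewrite row_mxEl; exact: fa.
by under eq_fun do rewrite row_mxEr; exact: ga.
Qed.

Lemma analytic_map_lsub p q (x : 'rV[R]_(p + q)) : analytic_map_at lsubmx x.
Proof. by move=> j; under eq_fun do rewrite mxE; exact: analytic_coord. Qed.

Lemma analytic_map_rsub p q (x : 'rV[R]_(p + q)) : analytic_map_at rsubmx x.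
Proof. by move=> j; under eq_fun do rewrite mxE; exact: analytic_coord. Qed.

End AnalyticMaps.

Section LieAnalytic.
Context (R : realType) (n : nat) (G : lieGroupType R n).

Definition ranal (u : G -> R) := forall k : chart R n G, atlas k ->
  forall g, cdom k g -> analytic_at (fun x => u (cinv k x)) (cmap k g).

(** Analyticity of a map into G. Continuity is part of it so that P stays, near x, in the domain of
    a chart at P x, where [cinv c (cmap c (P y))] is P y. *)
Definition gan m (P : 'rV[R]_m -> G) (x : 'rV[R]_m) := P y @[y --> x] --> P x /\
  forall c, atlas c -> cdom c (P x) -> analytic_map_at (cmap c \o P) x.

Lemma gan_cst m (g : G) (x : 'rV[R]_m) : gan (fun=> g) x.
Proof. by split; [exact: (@cvg_cst G g _ (nbhs x) _)|move=> c _ _; exact: analytic_map_cst]. Qed.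

Lemma cimgP (b : chart R n G) y : atlas b -> cimg b y -> cdom b (cinv b y) /\ cmap b (cinv b y) = y.
Proof. by move=> /atlas_chart[_ _ _ _ bK] [g bg <-]; rewrite bK. Qed.

Lemma gan_cinv (b : chart R n G) y : atlas b -> cimg b y -> gan (cinv b) y.
Proof.
move=> ab yb; have [_ bo _ bc _] := atlas_chart _ ab.
split.
  have := bc; rewrite continuous_open_subspace// => /(_ y); apply.
  by rewrite inE.
move=> c ac cy; have [cb yE] := cimgP ab yb.
by have := atlas_compat _ _ ab ac _ cb cy; rewrite yE.
Qed.

Lemma cmap_cdom (c : chart R n G) : atlas c -> forall g, cdom c g -> \forall h \near g, cdom c h.
Proof. by move=> /atlas_chart[co _ _ _ _] g cg; exact: open_nbhs_nbhs. Qed.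

Lemma gan_in_chart m (P : 'rV[R]_m -> G) x c : gan P x -> atlas c -> cdom c (P x) ->
  \forall y \near x, cinv c (cmap c (P y)) = P y.
Proof.
move=> [Pc _] ac cP; have [_ _ _ _ cK] := atlas_chart _ ac.
by apply: (@filterS _ (nbhs x) _ _ _ _ (Pc _ (cmap_cdom ac cP))) => y; exact: cK.
Qed.

Lemma gan_comp m p (P : 'rV[R]_p -> G) (psi : 'rV[R]_m -> 'rV[R]_p) x :
  gan P (psi x) -> analytic_map_at psi x -> gan (P \o psi) x.
Proof.
move=> [Pc Pa] pa; split.
  exact: (cvg_comp _ _ (analytic_map_continuous pa) Pc).
by move=> c ac cP; apply: analytic_map_comp (Pa c ac cP) pa.
Qed.

Lemma gan_mul m (P Q : 'rV[R]_m -> G) x : gan P x -> gan Q x ->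
  gan (fun y => P y * Q y)%g x.
Proof.
move=> gP gQ; have [Pc Pa] := gP; have [Qc Qa] := gQ.
split.
  apply: (@continuous2_cvg _ _ _ _ (nbhs x) _ P Q (fun a b : G => (a * b)%g) (P x) (Q x) _ Pc Qc).
  exact: (@lie_mul_continuous _ _ G (P x, Q x)).
move=> c ac cPQ; have [a aa aP] := atlas_cover (P x); have [b ab bQ] := atlas_cover (Q x).
have H := lie_mul_analytic _ _ _ aa ab ac _ _ aP bQ cPQ.
have := analytic_map_comp (psi := fun y => row_mx (cmap a (P y)) (cmap b (Q y))) H
  (analytic_map_row (Pa a aa aP) (Qa b ab bQ)).
apply: analytic_map_near.
near=> y; rewrite /= row_mxKl row_mxKr; congr (cmap c (_ * _)%g).
  by near: y; exact: gan_in_chart.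
by near: y; exact: gan_in_chart.
Unshelve. all: by end_near. Qed.

Lemma gan_inv m (P : 'rV[R]_m -> G) x : gan P x -> gan (fun y => (P y)^-1%g) x.
Proof.
move=> gP; have [Pc Pa] := gP; split.
  by apply: (cvg_comp _ _ Pc); exact: lie_inv_continuous.
move=> c ac cP; have [a aa aP] := atlas_cover (P x).
have := analytic_map_comp (psi := cmap a \o P) (lie_inv_analytic _ _ aa ac _ aP cP) (Pa a aa aP).
apply: analytic_map_near; have := gan_in_chart gP aa aP.
by apply: filterS => y /= ->.
Qed.

Lemma ranal_comp m u (P : 'rV[R]_m -> G) x : ranal u -> gan P x -> analytic_at (u \o P) x.
Proof.
move=> ua gP; have [Pc Pa] := gP; have [a aa aP] := atlas_cover (P x).
have := analytic_comp (psi := cmap a \o P) (ua a aa _ aP) (Pa a aa aP).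
apply: analytic_near; have := gan_in_chart gP aa aP.
by apply: filterS => y /= ->.
Qed.

Lemma ranal_cst c : ranal (fun=> c).
Proof. by move=> k ak g kg; exact: analytic_cst. Qed.

Lemma ranalD u v : ranal u -> ranal v -> ranal (fun g => u g + v g).
Proof. by move=> ua va k ak g kg; apply: analyticD; [exact: ua|exact: va]. Qed.

Lemma ranalB u v : ranal u -> ranal v -> ranal (fun g => u g - v g).
Proof. by move=> ua va k ak g kg; apply: analyticB; [exact: ua|exact: va]. Qed.

Lemma ranalM u v : ranal u -> ranal v -> ranal (fun g => u g * v g).
Proof. by move=> ua va k ak g kg; apply: analyticM; [exact: ua|exact: va]. Qed.

End LieAnalytic.

Section Quad1.
Context (R : realType).

Lemma quad1_eq (u v : R -> R) c d delta : 0 < delta ->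
  (forall s, `|s| < delta -> u s = v s) -> quad1 u c d -> quad1 v c d.
Proof.
move=> d0 uv [C [d' [d0' H]]]; exists C, (Num.min delta d'); split; first by rewrite lt_min d0.
by move=> s; rewrite lt_min => /andP[sd sd']; rewrite -uv//; exact: H.
Qed.

Lemma pos_min (I : finType) (F : I -> R) : (forall i, 0 < F i) ->
  exists2 r, 0 < r & forall i, r <= F i.
Proof.
move=> F0; exists (\big[Num.min/1]_i F i).
  by elim/big_ind: _ => // a b a0 b0; rewrite lt_min a0.
by move=> i; exact: bigmin_le_cond.
Qed.

End Quad1.

(** * Left-invariant derivatives and the Maurer-Cartan form *)

Section LieDerivative.
Context (R : realType) (n : nat) (G : lieGroupType R n) (e : lie_basis G).

Notation b := (bchart e).
Notation x0 := (cmap (bchart e) 1%g).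
Notation ab := (bchart_atlas e).

Definition rld i (u : G -> R) g : R :=
  'D_(bvec e i) (fun x => u (g * cinv b x)%g) x0.

Definition rlds (w : seq 'I_n) (u : G -> R) : G -> R := foldr rld u w.

Lemma cimg1 : cimg b x0.
Proof. by exists 1%g => //; exact: bchart1. Qed.

Lemma cinv1 : cinv b x0 = 1%g.
Proof. by have [_ _ _ _] := atlas_chart _ ab; apply; exact: bchart1. Qed.

Lemma gan_translate g y : cimg b y -> gan (fun x => g * cinv b x)%g y.
Proof. by move=> yb; apply: gan_mul; [exact: gan_cst|apply: gan_cinv => //; exact: ab]. Qed.

Lemma translate_analytic u g y : ranal u -> cimg b y ->
  analytic_at (fun x => u (g * cinv b x)%g) y.
Proof. by move=> ua /(gan_translate g); exact: ranal_comp. Qed.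

Lemma rld_is_derive i u g : ranal u ->
  is_derive x0 (bvec e i) (fun x => u (g * cinv b x)%g) (rld i u g).
Proof.
move=> ua; have [L uL] := analytic_quadr (translate_analytic g ua cimg1).
rewrite /rld (quadr_derive _ uL); apply: quad1_is_derive.
exact: (quadr_curve uL (quad1_line _ _)).
Qed.

Lemma rldE i u g d :
  is_derive x0 (bvec e i) (fun x => u (g * cinv b x)%g) d -> rld i u g = d.
Proof. by move=> h; rewrite /rld derive_val. Qed.

Lemma rldD i u v : ranal u -> ranal v ->
  rld i (fun g => u g + v g) = (fun g => rld i u g + rld i v g).
Proof.
move=> ua va; apply/funext => g; apply: rldE.
by apply: is_deriveD; exact: rld_is_derive.
Qed.

Lemma rldB i u v : ranal u -> ranal v ->
  rld i (fun g => u g - v g) = (fun g => rld i u g - rld i v g).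
Proof.
move=> ua va; apply/funext => g; apply: rldE.
by apply: is_deriveB; exact: rld_is_derive.
Qed.

Lemma rldM i u v : ranal u -> ranal v ->
  rld i (fun g => u g * v g) = (fun g => rld i u g * v g + u g * rld i v g).
Proof.
move=> ua va; apply/funext => g; apply: rldE.
have := is_deriveM (rld_is_derive i g ua) (rld_is_derive i g va).
by move=> h; apply: is_derive_eq h _; rewrite cinv1 mulg1 /GRing.scale /= addrC mulrC.
Qed.

Lemma rld_cst i c : rld i (fun=> c) = (fun=> 0).
Proof. by apply/funext => g; apply: rldE; exact: is_derive_cst. Qed.

Lemma rldZ i c u : ranal u -> rld i (fun g => c * u g) = (fun g => c * rld i u g).
Proof.
move=> ua; rewrite (rldM _ (ranal_cst c) ua) rld_cst.
by apply/funext => g; rewrite mul0r add0r.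
Qed.

(** Read in the chart k, X_i u is the derivative at x0 in the second block of the jointly analytic
    function (y, x) -> u (cinv k y * cinv b x), which [rep_slice] shows to be analytic in y. *)
Lemma rld_ranal i u : ranal u -> ranal (rld i u).
Proof.
move=> ua k ak g kg; set y0 := cmap k g.
have ky0 : cimg k y0 by exists g.
pose H (z : 'rV[R]_(n + n)) := u (cinv k (lsubmx z) * cinv b (rsubmx z))%g.
have : analytic_at H (row_mx y0 x0).
  apply: (ranal_comp (P := fun z => (cinv k (lsubmx z) * cinv b (rsubmx z))%g)) => //.
  apply: gan_mul.
    apply: (gan_comp (P := cinv k) (psi := lsubmx)); last exact: analytic_map_lsub.
    by rewrite row_mxKl; exact: gan_cinv.
  apply: (gan_comp (P := cinv b) (psi := rsubmx)); last exact: analytic_map_rsub.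
  by rewrite row_mxKr; apply: gan_cinv; [exact: ab|exact: cimg1].
move=> /analytic_atP[rho [M [r0 HM]]]; have [B [Brep HB]] := rep_slice r0 HM.
apply/analytic_atP; exists rho, (\sum_j `|bvec e i 0 j| * (M / rho)); split=> //.
apply: (@rep_eq _ _ _ _ (fun h => \sum_j bvec e i 0 j * B j h)); last first.
  by apply: rep_bigsum => [|j]; [exact: ltW|exact: rep_scale].
move=> h hh; rewrite /rld.
apply/esym/quadr_derive; exists (M / rho ^+ 2), rho; split=> // l kappa k0 kr kk.
have := HB h l kappa hh k0 kr kk; rewrite !add_row_mx addr0 /H !row_mxKl !row_mxKr.
by move/le_trans; apply; rewrite expr_div_n mulrA mulrAC.
Qed.

Lemma rlds_ranal w u : ranal u -> ranal (rlds w u).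
Proof. by move=> ua; elim: w => //= i w ih; exact: rld_ranal. Qed.

Lemma rldsB w u v : ranal u -> ranal v ->
  rlds w (fun g => u g - v g) = (fun g => rlds w u g - rlds w v g).
Proof.
move=> ua va; elim: w => //= i w ih.
by rewrite ih rldB//; exact: rlds_ranal.
Qed.

Lemma rlds_cat w w' u : rlds (w ++ w') u = rlds w (rlds w' u).
Proof. by rewrite /rlds foldr_cat. Qed.

(* om i j is the component along X_i of the Maurer-Cartan form applied to the
   j-th coordinate direction of the chart; it does not depend on g and u. *)
Lemma maurer_cartan : exists rho (W : 'I_n -> 'I_n -> R) (om : 'I_n -> 'I_n -> 'rV[R]_n -> R),
  [/\ 0 < rho, forall i j, rep rho (W i j) (om i j),
    forall h, box rho h -> cimg b (x0 + h) &
    forall u g h v, ranal u -> box rho h ->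
    quad1 (fun s => u (g * cinv b (x0 + (h + s *: v)))%g) (u (g * cinv b (x0 + h))%g)
      (\sum_i (\sum_j v 0 j * om i j h) * rld i u (g * cinv b (x0 + h))%g)].
Proof.
(* With p h = cinv b (x0 + h), this is the increment P (h, k) = p(h)^-1 p(h + k). Its derivative in
   k at k = 0, read in the chart [b], is the Maurer-Cartan form in chart coordinates. *)
pose P (z : 'rV[R]_(n + n)) :=
  ((cinv b (x0 + lsubmx z))^-1 * cinv b (x0 + (lsubmx z + rsubmx z)))%g.
have addx0 (psi : 'rV[R]_(n + n) -> 'rV[R]_n) : analytic_map_at psi 0 -> psi 0 = 0 ->
    gan (fun z => cinv b (x0 + psi z)) 0.
  move=> pa p0; apply: (gan_comp (P := cinv b) (psi := fun z => x0 + psi z)).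
    by rewrite p0 addr0; apply: gan_cinv; [exact: ab|exact: cimg1].
  by apply: analytic_mapD => //; exact: analytic_map_cst.
have ls0 : lsubmx (0 : 'rV[R]_(n + n)) = 0 by exact: linear0.
have rs0 : rsubmx (0 : 'rV[R]_(n + n)) = 0 by exact: linear0.
have gP : gan P 0.
  apply: gan_mul.
    by apply: gan_inv; apply: addx0 => //; exact: analytic_map_lsub.
  apply: (addx0 (fun z => lsubmx z + rsubmx z)); last by rewrite ls0 rs0 addr0.
  by apply: analytic_mapD; [exact: analytic_map_lsub|exact: analytic_map_rsub].
have P0 : P 0 = 1%g by rewrite /P ls0 rs0 !addr0 cinv1 mulVg.
have bP0 : cdom b (P 0) by rewrite P0; exact: bchart1.
have eta_an := gP.2 b ab bP0.
have /choice[rM HrM] : forall l, exists p : R * R, 0 < p.1 /\ rep p.1 p.2 (fun z => cmap b (P z) 0 l).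
  move=> l; have /analytic_atP[rho [M [r0 H]]] := eta_an l.
  by exists (rho, M); split=> //; apply: rep_eq H => z _ /=; rewrite add0r.
have [rho1 rho10 rho1l] := pos_min (fun l => (HrM l).1).
have [rho2 rho20 H2] := (nbhs_boxP _ _).1 (gan_in_chart gP ab bP0).
have [_ bo _ _ bK] := atlas_chart _ ab.
have [rho3 rho30 H3] := (nbhs_boxP _ _).1 (open_nbhs_nbhs (conj bo cimg1)).
have [rho r0 rle] : exists2 rho, 0 < rho & [/\ rho <= rho1, rho <= rho2 & rho <= rho3].
  exists (Num.min rho1 (Num.min rho2 rho3)); first by rewrite !lt_min rho10 rho20.
  by rewrite !ge_min !lexx !orbT.
have [rle1 rle2 rle3] := rle.
have etaM l : rep rho (rM l).2 (fun z => cmap b (P z) 0 l).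
  by apply: rep_radius (HrM l).2; rewrite ?(ltW r0)// (le_trans rle1).
have /choice[B HB] := fun l => rep_slice r0 (etaM l).
(* The derivatives X_i u at a point are A times the gradient in the translated chart, so [invmx A]
   passes from chart coordinates to components along the fields X_i. *)
pose A := \matrix_i bvec e i.
have uA : A \in unitmx by rewrite -row_free_unit; exact: bvec_free.
exists rho, (fun i j => \sum_l `|invmx A l i| * ((rM l).2 / rho)),
  (fun i j h => \sum_l invmx A l i * B l j h); split=> //.
- by move=> i j; apply: rep_bigsum => [|l]; [exact: ltW|apply: rep_scale; exact: (HB l).1].
- by move=> h hh; apply: H3 => i; exact: lt_le_trans (hh i) rle3.
move=> u g h v ua hh; set p := cinv b (x0 + h).
have [L uL] := analytic_quadr (translate_analytic (g * p)%g ua cimg1).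
pose V := 1 + \sum_i `|v 0 i|.
have V0 : 0 < V by rewrite ltr_pwDl// sumr_ge0.
have vV i : `|v 0 i| <= V by rewrite /V (bigD1 i)//= addrCA lerDl addr_ge0// sumr_ge0.
have Ph0 : P (row_mx h 0) = 1%g by rewrite /P row_mxKl row_mxKr addr0 mulVg.
have curve l : quad1 (fun s => cmap b (P (row_mx h (s *: v))) 0 l) (x0 0 l) (\sum_j v 0 j * B l j h).
  exists ((rM l).2 * V ^+ 2 / rho ^+ 2), (rho / V); split; first exact: divr_gt0.
  move=> s; rewrite ltr_pdivlMr// => sV.
  have sv j : `|(s *: v) 0 j| <= `|s| * V by rewrite mxE normrM ler_wpM2l.
  have := (HB l).2 h (s *: v) (`|s| * V) hh (mulr_ge0 (normr_ge0 _) (ltW V0)) sV sv.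
  rewrite Ph0; have -> : \sum_j (s *: v) 0 j * B l j h = s * \sum_j v 0 j * B l j h.
    by rewrite mulr_sumr; apply: eq_bigr => j _; rewrite mxE mulrA.
  move/le_trans; apply; rewrite -(real_normK (num_real s)) expr_div_n exprMn.
  by rewrite le_eqVlt; apply/orP; left; apply/eqP; field; rewrite gt_eqF.
have := quadr_curve (psi := fun s => cmap b (P (row_mx h (s *: v)))) uL curve.
rewrite cinv1 mulg1.
have -> : \sum_l (\sum_j v 0 j * B l j h) * L l =
   \sum_i (\sum_j v 0 j * (\sum_l invmx A l i * B l j h)) * rld i u (g * p)%g.
  have Ll l : L l = \sum_i invmx A l i * rld i u (g * p)%g.
    have rE : (\col_i rld i u (g * p)%g) = A *m (\col_l L l).
      apply/matrixP => i j; rewrite !mxE /rld (quadr_derive _ uL).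
      by apply: eq_bigr => k _; rewrite !mxE.
    have := congr1 (fun M => (invmx A *m M) l 0) rE; rewrite mulKmx// !mxE => <-.
    by apply: eq_bigr => i _; rewrite !mxE.
  under eq_bigr do rewrite Ll mulr_sumr.
  rewrite exchange_big /=; apply: eq_bigr => i _.
  under [X in _ = X * _]eq_bigr do rewrite mulr_sumr.
  rewrite exchange_big /= mulr_suml; apply: eq_bigr => l _.
  by rewrite mulrA; congr (_ * _); rewrite mulr_suml; apply: eq_bigr => j _; ring.
apply: (quad1_eq (delta := rho / V)); first exact: divr_gt0.
move=> s; rewrite ltr_pdivlMr// => sV /=.
have zb : box rho2 (row_mx h (s *: v)).
  move=> i; case: (split_ordP i) => [i' ->|j' ->]; rewrite ?row_mxEl ?row_mxEr.
    exact: lt_le_trans (hh i') rle2.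
  rewrite mxE normrM (lt_le_trans _ rle2)// (le_lt_trans _ sV)// ler_wpM2l//.
have := H2 _ zb; rewrite /= add0r => ->.
by rewrite /P row_mxKl row_mxKr -/p !mulgA mulgK.
Qed.

(** For a set stable under right translation by the box, the first half makes the set open and the
    second half makes its complement open. *)
Lemma near_translate rho g : 0 < rho ->
  (\forall g' \near g, exists2 h, box rho h & g' = (g * cinv b (x0 + h))%g) /\
  (\forall g' \near g, exists2 h, box rho h & g = (g' * cinv b (x0 + h))%g).
Proof.
move=> r0; have [bo bi bc _ bK] := atlas_chart _ ab.
have N1 : nbhs (1%g : G) [set p | exists2 h, box rho h & p = cinv b (x0 + h)].
  have Cc : cmap b p @[p --> (1%g : G)] --> x0.
    have := bc; rewrite continuous_open_subspace// => /(_ 1%g); apply.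
    by rewrite inE; exact: bchart1.
  have bx : nbhs x0 [set y | box rho (y - x0)].
    by apply/nbhs_boxP; exists rho => // h hh; rewrite /= addrC addKr.
  have N := @filterI _ _ (nbhs_filter (1%g : G)) _ _ (Cc _ bx : nbhs (1%g : G) _) (cmap_cdom ab (bchart1 e)).
  apply: (@filterS _ (nbhs (1%g : G)) _ _ _ _ N) => p [/= pr bp]; exists (cmap b p - x0) => //.
  by rewrite addrC subrK bK.
have C1 : (g^-1 * g')%g @[g' --> g] --> (1%g : G).
  rewrite -(mulVg g).
  apply: (@continuous2_cvg _ _ _ _ (nbhs g) _ (fun=> g^-1%g) id (fun a b : G => (a * b)%g)).
  - exact: (@lie_mul_continuous _ _ G (g^-1, g)%g).
  - exact: (@cvg_cst G _ _ (nbhs g) _).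
  - exact: cvg_id.
have C2 : (g'^-1 * g)%g @[g' --> g] --> (1%g : G).
  rewrite -(mulVg g).
  apply: (@continuous2_cvg _ _ _ _ (nbhs g) _ (fun g' => g'^-1%g) (fun=> g) (fun a b : G => (a * b)%g)).
  - exact: (@lie_mul_continuous _ _ G (g^-1, g)%g).
  - exact: lie_inv_continuous.
  - exact: (@cvg_cst G _ _ (nbhs g) _).
split.
  apply: (@filterS _ (nbhs g) _ _ _ _ (C1 _ N1)) => g' [h hh E]; exists h => //.
  by rewrite -E mulVKg.
apply: (@filterS _ (nbhs g) _ _ _ _ (C2 _ N1)) => g' [h hh E]; exists h => //.
by rewrite -E mulVKg.
Qed.

End LieDerivative.

(** * The formal expansion in the Lie jet *)

Section TriangularSums.
Context (R : numDomainType).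

Lemma ler_sum_widen N N' (F : nat -> R) : (forall i, 0 <= F i) -> (N <= N')%N ->
  \sum_(i < N) F i <= \sum_(i < N') F i.
Proof.
move=> F0 NN; rewrite (big_ord_widen N' F NN) [leLHS]big_mkcond ler_sum// => i _.
by case: ifP.
Qed.

(** Truncated Cauchy product: the index pairs of the triangle lie in the square. *)
Lemma triangle_sum_le D (x y : nat -> R) : (forall i, 0 <= x i) -> (forall i, 0 <= y i) ->
  \sum_(d < D) \sum_(m < d.+1) x m * y (d - m)%N <= (\sum_(m < D) x m) * \sum_(d < D) y d.
Proof.
move=> x0 y0.
have -> : \sum_(d < D) \sum_(m < d.+1) x m * y (d - m)%N =
    \sum_(m < D) x m * \sum_(d < D | (m <= d)%N) y (d - m)%N.
  under [RHS]eq_bigr do rewrite mulr_sumr.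
  have E (d : 'I_D) : \sum_(m < d.+1) x m * y (d - m)%N =
      \sum_(m < D | (m < d.+1)%N) x m * y (d - m)%N.
    exact: (big_ord_widen D (fun m => x m * y (d - m)%N) (ltn_ord d)).
  rewrite (eq_bigr _ (fun d _ => E d)).
  by rewrite (exchange_big_dep xpredT)//=.
rewrite mulr_suml; apply: ler_sum => m _; rewrite ler_wpM2l//.
rewrite -(big_mkord (fun d => m <= d)%N (fun d => y (d - m)%N)).
have -> : \sum_(0 <= d < D | (m <= d)%N) y (d - m)%N = \sum_(m <= d < D) y (d - m)%N.
  by rewrite (big_nat_widenl m 0%N).
rewrite -{1}[nat_of_ord m]add0n big_addn; under eq_bigr do rewrite addnK.
by rewrite big_mkord ler_sum_widen// leq_subr.
Qed.

End TriangularSums.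

Section FormalSolution.
Context (R : realType) (n : nat) (o : 'I_n -> seq 'I_n -> R).
Implicit Types (T : seq 'I_n -> R) (w v : seq 'I_n).

(* Solves  E f_w = \sum_i o_i f_(i :: w),  f_w(0) = T w,  where E is the Euler
   operator, by comparing coefficients; N is the recursion fuel. *)
Fixpoint tsolve N T w v : R :=
  if N isn't N'.+1 then T w else
  if v is [::] then T w else
  (size v)%:R^-1 * \sum_i \sum_(m < size v)
     o i (take m.+1 v) * tsolve N' T (i :: w) (drop m.+1 v).

(** Each step of the recursion removes at least one letter of [v], so its size is enough fuel. *)
Definition tcoef T w v := tsolve (size v) T w v.

Lemma tsolve_fuel N N' T w v : (size v <= N)%N -> (size v <= N')%N ->
  tsolve N T w v = tsolve N' T w v.
Proof.
elim: N N' w v => [|N ih] [|N'] w v //.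
- by rewrite leqn0 => /eqP/size0nil ->.
- by move=> _; rewrite leqn0 => /eqP/size0nil ->.
case: v => [//|j v] vN vN'; rewrite /tsolve -/tsolve; congr (_ * _).
apply: eq_bigr => i _; apply: eq_bigr => m _; congr (_ * _).
by apply: ih; rewrite size_drop /= subSS; [move: vN|move: vN'] => /=; lia.
Qed.

Lemma tcoef_nil T w : tcoef T w [::] = T w.
Proof. by []. Qed.

Lemma tcoefS T w v : (0 < size v)%N ->
  tcoef T w v = (size v)%:R^-1 * \sum_i \sum_(m < size v)
     o i (take m.+1 v) * tcoef T (i :: w) (drop m.+1 v).
Proof.
rewrite /tcoef; case: v => // j v _; rewrite [LHS]/= ; congr (_ * _).
apply: eq_bigr => i _; apply: eq_bigr => m _; congr (_ * _).
by apply: tsolve_fuel; rewrite size_drop //=; lia.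
Qed.

Lemma tsolveB N T T' w v :
  tsolve N (fun w => T w - T' w) w v = tsolve N T w v - tsolve N T' w v.
Proof.
elim: N w v => [//|N ih] w [//|j v]; rewrite /tsolve -/tsolve -mulrBr -sumrB; congr (_ * _).
apply: eq_bigr => i _; rewrite -sumrB; apply: eq_bigr => m _.
by rewrite ih mulrBr.
Qed.

Lemma tcoefB T T' w v :
  tcoef (fun w => T w - T' w) w v = tcoef T w v - tcoef T' w v.
Proof. exact: tsolveB. Qed.

Lemma wsum_split_at (V : nmodType) d m (F : seq 'I_n -> seq 'I_n -> V) : (m <= d)%N ->
  wsum d.+1 (fun v => F (take m.+1 v) (drop m.+1 v)) =
  wsum m.+1 (fun u => wsum (d - m) (F u)).
Proof.
move=> md; have -> : d.+1 = (m.+1 + (d - m))%N by lia.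
rewrite wsum_cat; apply: eq_wsum => u um; apply: eq_wsum => v _.
by rewrite -um take_size_cat// drop_size_cat.
Qed.

Lemma hom_tcoefS T w d h :
  hom (tcoef T w) d.+1 h = d.+1%:R^-1 * \sum_i \sum_(m < d.+1)
     hom (o i) m.+1 h * hom (tcoef T (i :: w)) (d - m) h.
Proof.
rewrite /hom -[LHS]/(wsum d.+1 (fun v => tcoef T w v * monom h v)).
under eq_wsum => v vd.
  rewrite tcoefS vd// -mulrA mulr_suml.
  under eq_bigr do rewrite mulr_suml.
  over.
rewrite wsumZ; congr (_ * _); rewrite wsum_sum; apply: eq_bigr => i _.
rewrite wsum_sum; apply: eq_bigr => m _.
transitivity (wsum m.+1 (fun u => wsum (d - m) (fun v =>
  o i u * monom h u * (tcoef T (i :: w) v * monom h v)))).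
  pose F u v := o i u * monom h u * (tcoef T (i :: w) v * monom h v).
  have md : (m <= d)%N by rewrite -ltnS.
  transitivity (wsum d.+1 (fun v => F (take m.+1 v) (drop m.+1 v))); last exact: (wsum_split_at F md).
  by rewrite /F; apply: eq_wsum => v _; rewrite -{3}(cat_take_drop m.+1 v) monom_cat; ring.
by rewrite -wsumZr; apply: eq_wsum => u _; rewrite wsumZ.
Qed.

Lemma nrm_tcoefS T w d :
  nrm (tcoef T w) d.+1 <= d.+1%:R^-1 * \sum_i \sum_(m < d.+1)
     nrm (o i) m.+1 * nrm (tcoef T (i :: w)) (d - m).
Proof.
have d0 : 0 <= (d.+1%:R : R)^-1 by rewrite invr_ge0 ler0n.
apply: (@le_trans _ _ (wsum d.+1 (fun v => d.+1%:R^-1 * \sum_i \sum_(m < d.+1)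
     `|o i (take m.+1 v)| * `|tcoef T (i :: w) (drop m.+1 v)|))).
  apply: ler_wsum => v vd; rewrite tcoefS vd// normrM (ger0_norm d0) ler_wpM2l//.
  rewrite (le_trans (ler_norm_sum _ _ _))// ler_sum// => i _.
  rewrite (le_trans (ler_norm_sum _ _ _))// ler_sum// => m _.
  by rewrite normrM.
rewrite wsumZ ler_wpM2l// wsum_sum ler_sum// => i _.
rewrite wsum_sum ler_sum// => m _.
pose F u v := `|o i u| * `|tcoef T (i :: w) v|.
have md : (m <= d)%N by rewrite -ltnS.
have E : wsum d.+1 (fun v => F (take m.+1 v) (drop m.+1 v)) = wsum m.+1 (fun u => wsum (d - m) (F u)).
  exact: (wsum_split_at F md).
rewrite [leLHS]E /F.
by rewrite /nrm -wsumZr; apply: ler_wsum => u _; rewrite wsumZ.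
Qed.

Section Majorant.
Context (rho B : R) (T : seq 'I_n -> R).
Hypothesis rho0 : 0 <= rho.

Let x m := \sum_i nrm (o i) m.+1 * rho ^+ m.+1.
Hypothesis xB : forall K, \sum_(m < K) x m <= B.

Let x_ge0 m : 0 <= x m.
Proof. by apply: sumr_ge0 => i _; rewrite mulr_ge0 ?nrm_ge0 ?exprn_ge0. Qed.

Let B0 : 0 <= B.
Proof. by have := xB 0; rewrite big_ord0. Qed.

(** The coefficient of s^d in X(s)^j / j!, where X(s) is the sum of the x m s^(m+1). As X(1) <= B,
    the sum over d is at most B^j / j!. *)
Fixpoint majc (j d : nat) : R :=
  if j is j'.+1 then (if d is d'.+1 then j'.+1%:R^-1 * \sum_(m < d'.+1) x m * majc j' (d' - m) else 0)
  else (d == 0%N)%:R.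

Let majc_ge0 j d : 0 <= majc j d.
Proof.
elim: j d => [|j ih] [|d] //=.
by rewrite mulr_ge0 ?invr_ge0 ?ler0n// sumr_ge0// => m _; rewrite mulr_ge0.
Qed.

Let majc_sum j D : \sum_(d < D) majc j d <= B ^+ j / j`!%:R.
Proof.
elim: j D => [|j ih] D.
  rewrite expr0 fact0 divr1; case: D => [|D]; first by rewrite big_ord0.
  by rewrite big_ord_recl /= big1 ?addr0.
case: D => [|D].
  by rewrite big_ord0 divr_ge0// exprn_ge0.
rewrite big_ord_recl /= add0r.
have -> : B ^+ j.+1 / j.+1`!%:R = j.+1%:R^-1 * (B * (B ^+ j / j`!%:R)).
  by rewrite factS natrM exprS invfM; ring.
rewrite -mulr_sumr ler_wpM2l ?invr_ge0 ?ler0n//.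
apply: le_trans (ler_pM _ _ (xB D) (ih D)); rewrite ?sumr_ge0//.
exact: triangle_sum_le.
Qed.

Let S d k := wsum k (fun w => nrm (tcoef T w) d) * rho ^+ d.

(** Each use of the recursion lengthens the jet word by one letter and consumes at least one degree,
    so the index j never exceeds the degree d. The Euler factor 1 / (d + 1) is therefore at most 1 /
    (j + 1), and these weaker factors build up the 1 / j! of [majc]. *)
Let S_le d k : S d k <= \sum_(j < d.+1) majc j d * wsum (k + j) (fun w => `|T w|).
Proof.
elim/ltn_ind: d k => -[_ k|d ih k].
  rewrite big_ord1 /= /S expr0 mulr1 mul1r addn0 le_eqVlt; apply/orP; left; apply/eqP.
  by apply: eq_wsum => w _.
have d0 : 0 <= (d.+1%:R : R)^-1 by rewrite invr_ge0 ler0n.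
have step : S d.+1 k <= d.+1%:R^-1 * \sum_(m < d.+1) x m * S (d - m)%N k.+1.
  rewrite {1}/S -wsumZr.
  apply: (@le_trans _ _ (wsum k (fun w => d.+1%:R^-1 * \sum_i \sum_(m < d.+1)
     (nrm (o i) m.+1 * rho ^+ m.+1) * (nrm (tcoef T (i :: w)) (d - m) * rho ^+ (d - m))))).
    apply: ler_wsum => w _.
    rewrite (le_trans (ler_wpM2r (exprn_ge0 _ rho0) (nrm_tcoefS T w d)))// -mulrA ler_wpM2l//.
    rewrite mulr_suml ler_sum// => i _; rewrite mulr_suml ler_sum// => m _.
    have E : rho ^+ d.+1 = rho ^+ m.+1 * rho ^+ (d - m).
      by rewrite -exprD; congr (_ ^+ _); have := ltn_ord m; lia.
    by rewrite E mulrACA.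
  rewrite wsumZ ler_wpM2l// wsum_sum.
  under eq_bigr do rewrite wsum_sum.
  rewrite exchange_big /= ; apply: ler_sum => m _.
  rewrite /x mulr_suml; apply: ler_sum => i _; rewrite wsumZ ler_wpM2l ?mulr_ge0 ?nrm_ge0 ?exprn_ge0//.
  (* The words that begin with [i] are only part of the words of length k + 1; enlarging to all of
     them allows the sum over [i] to be collected in x m. *)
  rewrite /S /= mulr_suml (bigD1 i)//= -wsumZr lerDl sumr_ge0// => i' _.
  by rewrite mulr_ge0 ?exprn_ge0// wsum_ge0// => w; exact: nrm_ge0.
apply: le_trans step _.
rewrite [leRHS]big_ord_recl (_ : majc (@ord0 d.+1) d.+1 = 0)// mul0r add0r.
pose M j := wsum (k.+1 + j) (fun w => `|T w|).
have M0 j : 0 <= M j by exact: wsum_ge0.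
apply: (@le_trans _ _ (d.+1%:R^-1 * \sum_(m < d.+1) x m * \sum_(j < d.+1) majc j (d - m) * M j)).
  rewrite ler_wpM2l// ler_sum// => m _; rewrite ler_wpM2l//.
  have dm : (d - m < d.+1)%N by lia.
  rewrite (le_trans (ih _ dm k.+1))//.
  by apply: (ler_sum_widen (F := fun j => majc j (d - m) * M j)) => // j; rewrite mulr_ge0.
have -> : d.+1%:R^-1 * \sum_(m < d.+1) x m * \sum_(j < d.+1) majc j (d - m) * M j =
    \sum_(j < d.+1) d.+1%:R^-1 * (\sum_(m < d.+1) x m * majc j (d - m)) * M j.
  under [X in _ * X]eq_bigr do rewrite mulr_sumr.
  rewrite exchange_big /= mulr_sumr; apply: eq_bigr => j _.
  by rewrite -mulrA mulr_suml; congr (_ * _); apply: eq_bigr => m _; exact: mulrA.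
apply: ler_sum => j _; rewrite (_ : (lift ord0 j : nat) = j.+1)// addnS -addSn -/(M j).
apply: ler_wpM2r; first exact: M0.
rewrite [majc j.+1 d.+1]/=; apply: ler_wpM2r; first by rewrite sumr_ge0// => m _; rewrite mulr_ge0.
by rewrite lef_pV2 ?posrE ?ltr0n// ler_nat ltn_ord.
Qed.

(* The exponential of the majorant of the form o: B^j / j! is what makes the
   bound finite for functions that are only entire of order r = 0. *)
Lemma tcoef_bound Q :
  (forall K, \sum_(j < K) B ^+ j / j`!%:R * wsum j (fun w => `|T w|) <= Q) ->
  forall K, \sum_(d < K) nrm (tcoef T [::]) d * rho ^+ d <= Q.
Proof.
move=> hQ K; apply: le_trans (hQ K).
have M0 j : 0 <= wsum j (fun w => `|T w|) by exact: wsum_ge0.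
apply: (@le_trans _ _ (\sum_(d < K) \sum_(j < K) majc j d * wsum j (fun w => `|T w|))).
  apply: ler_sum => d _; apply: le_trans (S_le d 0) _.
  by apply: (ler_sum_widen (F := fun j => majc j d * wsum j (fun w => `|T w|))) => // j; rewrite mulr_ge0.
rewrite exchange_big /=; apply: ler_sum => j _.
by rewrite -mulr_suml; apply: ler_wpM2r => //; exact: majc_sum.
Qed.

End Majorant.
End FormalSolution.

(** * Convergence of the expansion *)

Section FlatFunctions.
Context (R : realType).
Implicit Types (f g u c : R -> R) (p q : {poly R}).

Definition flatO N f := exists C d, 0 < d /\ forall t, `|t| < d -> `|f t| <= C * `|t| ^+ N.

Lemma flatO_eq N f g : f =1 g -> flatO N f -> flatO N g.
Proof. by move=> fg [C [d [d0 H]]]; exists C, d; split=> // t /H; rewrite fg. Qed.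

Lemma flatOD N f g : flatO N f -> flatO N g -> flatO N (fun t => f t + g t).
Proof.
move=> [C [d [d0 H]]] [C' [d' [d0' H']]]; exists (C + C'), (Num.min d d').
split; first by rewrite lt_min d0.
move=> t; rewrite lt_min => /andP[/H h /H' h'].
by rewrite (le_trans (ler_normD _ _))// mulrDl lerD.
Qed.

Lemma flatO_sum (I : Type) (r : seq I) N (F : I -> R -> R) :
  (forall i, flatO N (F i)) -> flatO N (fun t => \sum_(i <- r) F i t).
Proof.
move=> FN; elim: r => [|i r ih].
  by exists 0, 1; split=> // t _; rewrite big_nil normr0 mul0r.
by apply: flatO_eq (flatOD (FN i) ih) => t; rewrite big_cons.
Qed.

Lemma flatOM N M f g : flatO N f -> flatO M g -> flatO (N + M) (fun t => f t * g t).
Proof.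
move=> [C [d [d0 H]]] [C' [d' [d0' H']]]; exists (C * C'), (Num.min d d').
split; first by rewrite lt_min d0.
move=> t; rewrite lt_min => /andP[/H h /H' h'].
by rewrite normrM exprD mulrACA ler_pM.
Qed.

Lemma flatO_leq N M f : (N <= M)%N -> flatO M f -> flatO N f.
Proof.
move=> NM [C [d [d0 H]]]; exists `|C|, (Num.min d 1); split; first by rewrite lt_min d0 ltr01.
move=> t; rewrite lt_min => /andP[/H h t1].
apply: (le_trans h); apply: le_trans (ler_wpM2r _ (ler_norm C)) _; first by rewrite exprn_ge0.
by rewrite ler_wpM2l// -(subnKC NM) exprD ler_piMr ?exprn_ge0// exprn_ile1// ltW.
Qed.

Lemma flatO_horner p : flatO 0 (horner p).
Proof.
exists (\sum_(i < size p) `|p`_i|), 1; split=> // t t1.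
rewrite expr0 mulr1 horner_coef (le_trans (ler_norm_sum _ _ _))// ler_sum// => i _.
by rewrite normrM ler_piMr// normrX exprn_ile1// ltW.
Qed.

Lemma flatO_expr N : flatO N (fun t : R => t ^+ N).
Proof. by exists 1, 1; split=> // t _; rewrite normrX mul1r. Qed.

Lemma flatO_prod N c u p q :
  flatO N (fun t => c t - p.[t]) -> flatO N (fun t => u t - q.[t]) ->
  flatO N (fun t => c t * u t - (take_poly N (p * q)).[t]).
Proof.
move=> cp uq.
have h1 := flatO_leq (leq_addr N N) (flatOM cp uq).
have h2 : flatO N (fun t => (c t - p.[t]) * q.[t]).
  by have := flatOM cp (flatO_horner q); rewrite addn0.
have h3 := flatOM (flatO_horner p) uq.
have h4 : flatO N (fun t => (drop_poly N (p * q)).[t] * t ^+ N) := flatOM (flatO_horner _) (flatO_expr N).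
apply: flatO_eq (flatOD (flatOD (flatOD h1 h2) h3) h4) => t.
have E : p.[t] * q.[t] = (take_poly N (p * q)).[t] + (drop_poly N (p * q)).[t] * t ^+ N.
  by rewrite -hornerM -{1}(poly_take_drop N (p * q)) hornerD hornerM hornerXn.
have -> : (drop_poly N (p * q)).[t] * t ^+ N = p.[t] * q.[t] - (take_poly N (p * q)).[t].
  by rewrite E addrAC subrr add0r.
ring.
Qed.

(** Mean value theorem between 0 and t: integration gains one order. *)
Lemma flatO_int N f df d : 0 < d ->
  (forall t : R, `|t| < d -> is_derive t 1 f (df t)) -> f 0 = 0 -> flatO N df -> flatO N.+1 f.
Proof.
move=> d0 fd f0 [C [d' [d0' H]]]; exists `|C|, (Num.min d d').
split; first by rewrite lt_min d0.
move=> t; rewrite lt_min => /andP[td td'].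
have bound a : `|a| <= `|t| -> `|df a| <= `|C| * `|t| ^+ N.
  move=> at'; apply: le_trans (H a (le_lt_trans at' td')) _.
  apply: le_trans (ler_wpM2r _ (ler_norm C)) _; first by rewrite exprn_ge0.
  by rewrite ler_wpM2l// lerXn2r ?nnegrE.
have mvt (a a' : R) : a <= a' -> `|a| <= `|t| -> `|a'| <= `|t| ->
    `|f a' - f a| <= `|C| * `|t| ^+ N * (a' - a).
  move=> aa' ha ha'.
  have inn x : x \in `[a, a'] -> `|x| <= `|t|.
    rewrite in_itv /= => /andP[ax xa'].
    by move: ha ha'; rewrite !ler_norml => /andP[h1 h2] /andP[h3 h4]; apply/andP; split; [exact: le_trans ax|exact: le_trans xa' _].
  have [||x xi ->] := @MVT_segment _ f df a a' aa'.
  - move=> x xi; apply: fd; apply: le_lt_trans td; apply: inn.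
    by apply: subset_itv_oo_cc xi.
  - apply: derivable_within_continuous => x xi.
    by have [] := fd x (le_lt_trans (inn x xi) td).
  - by rewrite normrM (ger0_norm (_ : 0 <= a' - a)) ?subr_ge0// ler_wpM2r ?subr_ge0// bound// inn.
rewrite exprSr mulrA; have [t0|t0] := leP 0 t.
  have := mvt 0 t t0; rewrite normr0 f0 !subr0 => /(_ (normr_ge0 _) (lexx _)).
  by rewrite (ger0_norm t0).
have := mvt t 0 (ltW t0) (lexx _); rewrite normr0 f0 sub0r normrN sub0r => /(_ (normr_ge0 _)).
by rewrite (ltr0_norm t0).
Qed.

Lemma flatO_left f : (forall N, flatO N f) -> flat_left f 0.
Proof.
move=> H N; have [C [d [d0 h]]] := H N; exists C, d; split=> // s sd s0.
by rewrite add0r; apply: h; rewrite ltr0_norm// ltrNl.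
Qed.

Lemma repc_trunc m rho M a (f : 'rV[R]_m -> R) h t N : 0 < rho -> repc rho M a f -> box rho h ->
  `|t| <= 1 -> `|f (t *: h) - \sum_(k < N) hom a k h * t ^+ k| <= M * `|t| ^+ N.
Proof.
move=> r0 [aM af] hh t1.
have th : box rho (t *: h).
  by move=> i; rewrite mxE normrM (le_lt_trans _ (hh i))// ler_piMl.
apply: (cvgn_dist_le (N := N) (af _ th)) => K NK.
have [L ->] : exists L, K = (N + L)%N by exists (K - N)%N; rewrite subnKC.
rewrite seriesEord /= big_split_ord /=.
under eq_bigr do rewrite homZ mulrC.
rewrite addrAC subrr add0r (le_trans (ler_norm_sum _ _ _))//.
have tN : 0 <= `|t| ^+ N by rewrite exprn_ge0.
apply: le_trans (ler_wpM2r tN (aM (N + L)%N)); rewrite big_split_ord /= mulrDl.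
rewrite -[leLHS]add0r lerD//.
  by rewrite mulr_ge0// sumr_ge0// => i _; rewrite mulr_ge0 ?nrm_ge0 ?exprn_ge0// ltW.
rewrite mulr_suml ler_sum// => i _; rewrite homZ normrM mulrC normrX exprD.
apply: ler_pM => //; first by apply: hom_le => j; exact: ltW.
by rewrite ler_piMr// exprn_ile1.
Qed.

End FlatFunctions.

(** * The expansion of an analytic function in its Lie jet *)

Section TaylorStep.
Context (R : realType) (n : nat) (G : lieGroupType R n) (e : lie_basis G).

Notation b := (bchart e).
Notation x0 := (cmap (bchart e) 1%g).

(** For T the jet at a point this says q_(0,B) <= Q there. Partial sums keep the statement inside
    the real numbers. *)
Definition taylor_bound (B : R) (T : seq 'I_n -> R) Q :=
  forall K, \sum_(j < K) B ^+ j / j`!%:R * wsum j (fun w => `|T w|) <= Q.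

(** The bound for an arbitrary family T is kept apart from the expansion of a function, because it
    is also applied to differences and limits of jets, where no function is available yet. *)
Lemma taylor_step : exists (rho B : R) (o : 'I_n -> seq 'I_n -> R),
  [/\ 0 < rho, 0 <= B, forall h, box rho h -> cimg b (x0 + h),
    forall T Q, taylor_bound B T Q ->
      forall K, \sum_(d < K) nrm (tcoef o T [::]) d * rho ^+ d <= Q &
    forall u g Q, ranal u -> taylor_bound B (fun w => rlds e w u g) Q ->
      repc rho Q (tcoef o (fun w => rlds e w u g) [::])
        (fun h => u (g * cinv b (x0 + h))%g)].
Proof.
have [rho [W [om [r0 omW imgb MC]]]] := maurer_cartan e.
have /choice[a_ Ha_] : forall ij, exists a, repc rho (W ij.1 ij.2) a (om ij.1 ij.2).
  by move=> [i j]; exact: omW.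
pose a i j := a_ (i, j); have Ha i j : repc rho (W i j) (a i j) (om i j) := Ha_ (i, j).
(* The form contracted with the radial direction: o i stands for the sum of h_j om i j h over j. Its
   constant term is 0, and its majorant at rho is at most B. *)
pose o i w := if w is j :: v then a i j v else 0.
have nrmo i m : nrm (o i) m.+1 = \sum_j nrm (a i j) m by [].
have homo i m h : hom (o i) m.+1 h = \sum_j h 0 j * hom (a i j) m h.
  rewrite /hom /=; apply: eq_bigr => j _; rewrite -wsumZ; apply: eq_wsum => w _.
  by rewrite monom_cons mulrCA.
pose B := \sum_i \sum_j rho * W i j.
have xB K : \sum_(m < K) \sum_i nrm (o i) m.+1 * rho ^+ m.+1 <= B.
  rewrite exchange_big /=; apply: ler_sum => i _.
  under eq_bigr do rewrite nrmo mulr_suml.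
  rewrite exchange_big /=; apply: ler_sum => j _.
  rewrite (le_trans _ (ler_wpM2l (ltW r0) ((Ha i j).1 K)))// mulr_sumr ler_sum// => m _.
  by rewrite exprS mulrCA.
have B0 : 0 <= B by have := xB 0; rewrite big_ord0.
have bnd T Q := @tcoef_bound R n o rho B T (ltW r0) xB Q.
exists rho, B, o; split=> // u g Q ua uQ.
set T := fun w => rlds e w u g.
have TQ := bnd T Q uQ; split=> // h hh.
have cS : cvgn (series (fun d => hom (tcoef o T [::]) d h)).
  by apply: (abs_series_cvgn (M := fun d => nrm (tcoef o T [::]) d * rho ^+ d)) TQ => d; apply: hom_le => i; exact: ltW.
pose S h := limn (series (fun d => hom (tcoef o T [::]) d h)).
have Srep : repc rho Q (tcoef o T [::]) S.
  split=> // h' hh'; suff : cvgn (series (fun d => hom (tcoef o T [::]) d h')) by [].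
  by apply: (abs_series_cvgn (M := fun d => nrm (tcoef o T [::]) d * rho ^+ d)) TQ => d; apply: hom_le => i; exact: ltW.
suff -> : u (g * cinv b (x0 + h))%g = S h by exact: Srep.2.
have boxt t : `|t| <= 1 -> box rho (t *: h).
  by move=> t1 i; rewrite mxE normrM (le_lt_trans _ (hh i))// ler_piMl.
pose U w t := rlds e w u (g * cinv b (x0 + t *: h))%g.
pose c i t := \sum_j h 0 j * om i j (t *: h).
have dU w t : `|t| < 1 -> is_derive t (1 : R) (U w) (\sum_i c i t * U (i :: w) t).
  move=> t1; apply: (@quad1_is_derive R R^o).
  have := MC (rlds e w u) g (t *: h) h (rlds_ranal e w ua) (boxt t (ltW t1)).
  apply: (quad1_eq ltr01) => s _.
  by rewrite /U; congr (rlds e w u (g * cinv b _)%g); rewrite addrA -addrA -scalerDl /GRing.scale /= mulr1.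
have cflat N i : flatO N (fun t => c i t - (\poly_(m < N) hom (o i) m.+1 h).[t]).
  have -> : (fun t => c i t - (\poly_(m < N) hom (o i) m.+1 h).[t]) =
      (fun t => \sum_j h 0 j * (om i j (t *: h) - \sum_(m < N) hom (a i j) m h * t ^+ m)).
    apply/funext => t; rewrite horner_poly /c.
    under [X in _ - X]eq_bigr do rewrite homo mulr_suml.
    rewrite exchange_big -sumrB; apply: eq_bigr => j _.
    by rewrite mulrBr mulr_sumr; congr (_ - _); apply: eq_bigr => m _; rewrite mulrA.
  apply: flatO_sum => j; exists (`|h 0 j| * W i j), 1; split=> // t t1.
  by rewrite normrM -mulrA ler_wpM2l// (repc_trunc N r0 (Ha i j) hh (ltW t1)).
(* The equation for [w] involves the longer words [i :: w], so the induction on the order treats all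
   words at once; each integration gains one order. *)
have Uflat : forall N w, flatO N (fun t => U w t - (\poly_(d < N) hom (tcoef o T w) d h).[t]).
  elim=> [|N ih] w.
    have an : analytic_at (fun x => rlds e w u (g * cinv b x)%g) (x0 + 0 *: h).
      by rewrite scale0r addr0; apply: translate_analytic (cimg1 e); exact: rlds_ranal.
    have [cc [rh [M [rh0 cM cu]]]] := analytic_line an.
    exists M, rh; split=> // t tr; rewrite poly_def big_ord0 horner0 subr0 expr0 mulr1.
    have := cu t tr; rewrite add0r => H; apply: series_norm_le H _ => K.
    apply: le_trans (cM K); apply: ler_sum => k _; rewrite normrM ler_wpM2l// normrX.
    by rewrite lerXn2r ?nnegrE// ltW.
  set Pw := \poly_(d < N.+1) _.
  pose p i := \poly_(m < N) hom (o i) m.+1 h.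
  pose q i := \poly_(d < N) hom (tcoef o T (i :: w)) d h.
  apply: (@flatO_int R N (fun t => U w t - Pw.[t]) (fun t => \sum_i (c i t * U (i :: w) t) - Pw^`().[t]) 1) => //.
  - by move=> t t1; apply: is_deriveB; exact: dU.
  - rewrite /U scale0r addr0 (cinv1 e) mulg1 horner_coef0 coef_poly /= /hom /=.
    by rewrite tcoef_nil monom_nil mulr1 subrr.
  (* Differentiation multiplies the coefficient of degree d + 1 by d + 1, which cancels the Euler
     denominator in [hom_tcoefS]; the rest is a coefficient of the product. *)
  - have -> : Pw^`() = \sum_i take_poly N (p i * q i).
      apply/polyP => d; rewrite coef_deriv coef_poly coef_sum ltnS.
      under [RHS]eq_bigr do rewrite coef_take_poly.
      case: ltnP => dN; last by rewrite mul0rn big1.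
      rewrite hom_tcoefS -[LHS]mulr_natl mulrA mulfV ?pnatr_eq0// mul1r.
      apply: eq_bigr => i _; rewrite coefM; apply: eq_bigr => m _.
      have md : (m <= d)%N by rewrite -ltnS.
      by rewrite !coef_poly (leq_ltn_trans md dN) (leq_ltn_trans (leq_subr m d) dN).
    apply: flatO_eq (flatO_sum _ (fun i => flatO_prod (cflat N i) (ih (i :: w)))) => t /=.
    by rewrite horner_sum -sumrB.
have Sflat N : flatO N (fun t => S (t *: h) - (\poly_(d < N) hom (tcoef o T [::]) d h).[t]).
  exists Q, 1; split=> // t t1; rewrite horner_poly.
  exact: (repc_trunc N r0 Srep hh (ltW t1)).
(* The function and the series agree to every order at t = 0 and are analytic along the whole
   segment, so they agree at its end. *)
have D1 : (fun t => U [::] t - S (t *: h)) 1 = 0.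
  apply: (@ana1_identity R (fun t => U [::] t - S (t *: h))) => [t /andP[t0 t1]|].
    have tn : `|t| <= 1 by rewrite ger0_norm.
    apply: ana1B.
      apply: (analytic_line (f := fun x => u (g * cinv b x)%g)).
      by apply: translate_analytic => //; apply/imgb/boxt.
    have := @analytic_line R n S 0 h t; under eq_fun do rewrite add0r; apply.
    by rewrite add0r; apply: (rep_analytic r0 (_ : rep rho Q S)); [exists (tcoef o T [::])|exact: boxt].
  apply: flatO_left => N.
  have h2 : flatO N (fun t => -1 * (S (t *: h) - (\poly_(d < N) hom (tcoef o T [::]) d h).[t])).
    by have := flatOM (flatO_horner (-1)%:P) (Sflat N); apply: flatO_eq => t; rewrite hornerC.
  apply: flatO_eq (flatOD (Uflat N [::]) h2) => t /=; ring.
by apply/eqP; rewrite -subr_eq0; move/eqP: D1; rewrite /U /= scale1r.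
Qed.

End TaylorStep.

(** * Bounds at every point *)

Section TaylorBounds.
Context (R : realType) (n : nat).
Implicit Types (T : seq 'I_n -> R) (c B Q : R).

Lemma taylor_bound_ge0 c T Q : taylor_bound c T Q -> 0 <= Q.
Proof. by move=> /(_ 0%N); rewrite big_ord0. Qed.

Lemma taylor_bound_term c T Q w : 0 <= c -> taylor_bound c T Q -> c ^+ size w * `|T w| <= (size w)`!%:R * Q.
Proof.
move=> c0 /(_ (size w).+1); rewrite big_ord_recr /= => h.
have f0 : (0 : R) < (size w)`!%:R by rewrite ltr0n fact_gt0.
have s0 : 0 <= \sum_(i < size w) c ^+ i / i`!%:R * wsum i (fun w => `|T w|).
  by apply: sumr_ge0 => i _; rewrite mulr_ge0 ?divr_ge0 ?exprn_ge0 ?wsum_ge0.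
have h' : c ^+ size w / (size w)`!%:R * wsum (size w) (fun w => `|T w|) <= Q.
  by apply: le_trans h; rewrite lerDr.
rewrite -ler_pdivrMl// mulrA [_^-1 * _]mulrC; apply: le_trans h'.
rewrite ler_wpM2l ?divr_ge0 ?exprn_ge0//.
exact: (@ler_wsum_term _ _ _ (fun w => `|T w|)).
Qed.

Lemma taylor_boundD c T T' Q Q' : 0 <= c -> taylor_bound c T Q -> taylor_bound c T' Q' ->
  taylor_bound c (fun w => T w + T' w) (Q + Q').
Proof.
move=> c0 hT hT' K; apply: le_trans (lerD (hT K) (hT' K)); rewrite -big_split ler_sum//= => j _.
rewrite -mulrDr ler_wpM2l ?divr_ge0 ?exprn_ge0// -wsumD.
by apply: ler_wsum => w _; exact: ler_normD.
Qed.

Lemma taylor_boundW c c' T Q : 0 <= c -> c <= c' -> taylor_bound c' T Q -> taylor_bound c T Q.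
Proof.
move=> c0 cc h K; apply: le_trans (h K); apply: ler_sum => j _.
apply: ler_wpM2r; first exact: wsum_ge0.
by rewrite ler_wpM2r ?invr_ge0// lerXn2r ?nnegrE// (le_trans c0).
Qed.

Lemma taylor_bound_lim c (T_ : nat -> seq 'I_n -> R) T Q N : 0 <= c ->
  (forall w, T_ ^~ w @ \oo --> T w) -> (forall i, (N <= i)%N -> taylor_bound c (T_ i) Q) ->
  taylor_bound c T Q.
Proof.
move=> c0 TT hT K.
have cv : (fun i => \sum_(j < K) c ^+ j / j`!%:R * wsum j (fun w => `|T_ i w|)) @ \oo -->
    \sum_(j < K) c ^+ j / j`!%:R * wsum j (fun w => `|T w|).
  apply: (cvg_bigsum (u := fun (j : 'I_K) i => c ^+ j / j`!%:R * wsum j (fun w => `|T_ i w|))) => j.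
  apply: cvgM; first exact: cvg_cst.
  apply: (@cvg_wsum R nat _ _ n j (fun w i => `|T_ i w|) (fun w => `|T w|)) => w.
  by apply: cvg_norm; exact: TT.
have S0 (T' : seq 'I_n -> R) : 0 <= \sum_(j < K) c ^+ j / j`!%:R * wsum j (fun w => `|T' w|).
  by apply: sumr_ge0 => j _; rewrite mulr_ge0 ?divr_ge0 ?exprn_ge0 ?wsum_ge0.
rewrite -[leLHS]ger0_norm// -[X in `|X|]subr0.
apply: (cvgn_dist_le (N := N) cv) => i Ni; rewrite subr0 ger0_norm//; exact: hT.
Qed.

Lemma binomial_fact c B m :
  \sum_(k < m.+1) (c ^+ k / k`!%:R) * (B ^+ (m - k) / (m - k)`!%:R) = (c + B) ^+ m / m`!%:R.
Proof.
rewrite addrC exprDn mulr_suml; apply: eq_bigr => k _.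
have km : (k <= m)%N by rewrite -ltnS.
rewrite -(bin_fact km) -mulr_natr !natrM.
have f0 j : (j`!%:R : R) != 0 by rewrite pnatr_eq0 -lt0n fact_gt0.
have b0 : ('C(m, k)%:R : R) != 0 by rewrite pnatr_eq0 -lt0n bin_gt0.
by field; rewrite !f0 b0.
Qed.

Lemma binomial_fact_le c B j k : 0 <= c -> 0 <= B ->
  (c ^+ k / k`!%:R) * (B ^+ j / j`!%:R) <= (c + B) ^+ (j + k) / (j + k)`!%:R.
Proof.
move=> c0 B0; rewrite -binomial_fact.
have kj : (k < (j + k).+1)%N by rewrite ltnS leq_addl.
rewrite (bigD1 (Ordinal kj))//= addnK lerDl sumr_ge0// => i _.
by rewrite mulr_ge0 ?divr_ge0 ?exprn_ge0.
Qed.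

Lemma wsum_shift j k (F : seq 'I_n -> R) :
  wsum k (fun w => wsum j (fun w' => F (w' ++ w))) = wsum (j + k) F.
Proof. by rewrite wsum_cat wsum_exchange. Qed.

(** With k the length of [w], B^j / j! <= k! (B + 1)^(j + k) / (j + k)!, since a single term of the
    binomial expansion is at most the whole. *)
Lemma taylor_bound_shift B T Q w : 0 <= B -> taylor_bound (B + 1) T Q ->
  taylor_bound B (fun w' => T (w' ++ w)) ((size w)`!%:R * Q).
Proof.
move=> B0 h K; set k := size w; have f0 : (0 : R) < k`!%:R by rewrite ltr0n fact_gt0.
apply: (@le_trans _ _ (k`!%:R * \sum_(j < K) (B + 1) ^+ (j + k) / (j + k)`!%:R * wsum (j + k) (fun w => `|T w|))).
  rewrite mulr_sumr ler_sum// => j _.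
  have h1 : wsum j (fun w' => `|T (w' ++ w)|) <= wsum (j + k) (fun w => `|T w|).
    rewrite -wsum_shift; apply: (@ler_wsum_term _ _ _ (fun w => wsum j (fun w' => `|T (w' ++ w)|))) => // v.
    exact: wsum_ge0.
  rewrite mulrA; apply: ler_pM => //; rewrite ?wsum_ge0 ?divr_ge0 ?exprn_ge0//.
  have := binomial_fact_le j k ler01 B0; rewrite expr1n mul1r addrC.
  by rewrite ler_pdivrMl.
rewrite ler_wpM2l ?(ltW f0)//; apply: le_trans (h (K + k)%N).
rewrite -(big_mkord xpredT (fun j => (B + 1) ^+ (j + k) / (j + k)`!%:R * wsum (j + k) (fun w => `|T w|))).
rewrite -(big_mkord xpredT (fun j => (B + 1) ^+ j / j`!%:R * wsum j (fun w => `|T w|))).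
rewrite -[in leLHS](addnK k K) -(big_addn 0 _ k xpredT (fun j => (B + 1) ^+ j / j`!%:R * wsum j (fun w => `|T w|))) add0n.
rewrite (@big_cat_nat _ _ _ k 0 (K + k)%N)//= ?leq_addl// lerDr sumr_ge0// => j _.
by rewrite mulr_ge0 ?divr_ge0 ?exprn_ge0 ?wsum_ge0// addr_ge0.
Qed.

(** After the binomial theorem, the pairs (k, j) form a part of the expansion of the terms m = j + k
    < K + J. *)
Lemma taylor_bound_double c B T Q K J : 0 <= c -> 0 <= B -> taylor_bound (c + B) T Q ->
  \sum_(k < K) c ^+ k / k`!%:R * \sum_(j < J) B ^+ j / j`!%:R * wsum (j + k) (fun w => `|T w|) <= Q.
Proof.
move=> c0 B0 h; apply: le_trans (h (K + J)%N).
pose A m := wsum m (fun w => `|T w|); have A0 m : 0 <= A m by exact: wsum_ge0.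
pose F k j := c ^+ k / k`!%:R * (B ^+ j / j`!%:R).
have F0 k j : 0 <= F k j by rewrite !mulr_ge0 ?invr_ge0 ?exprn_ge0.
have -> : \sum_(m < K + J) (c + B) ^+ m / m`!%:R * A m = \sum_(m < K + J) \sum_(k < m.+1) F k (m - k)%N * A m.
  by apply: eq_bigr => m _; rewrite -binomial_fact mulr_suml.
have E (m : 'I_(K + J)) : \sum_(k < m.+1) F k (m - k)%N * A m =
    \sum_(k < K + J | (k < m.+1)%N) F k (m - k)%N * A m.
  exact: (big_ord_widen _ (fun k => F k (m - k)%N * A m) (ltn_ord m)).
rewrite (eq_bigr _ (fun m _ => E m)) (exchange_big_dep xpredT)//=.
pose H k := \sum_(m < K + J | (k < m.+1)%N) F k (m - k)%N * A m.
have H0 k : 0 <= H k by apply: sumr_ge0 => m _; rewrite mulr_ge0.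
apply: (@le_trans _ _ (\sum_(k < K) H k)); last exact: (ler_sum_widen H0 (leq_addr _ _)).
apply: ler_sum => k _; rewrite mulr_sumr /H.
rewrite -(big_mkord (fun m => k < m.+1)%N (fun m => F k (m - k)%N * A m)).
have -> : \sum_(0 <= m < K + J | (k < m.+1)%N) F k (m - k)%N * A m = \sum_(k <= m < K + J) F k (m - k)%N * A m.
  by rewrite (big_nat_widenl k 0%N).
rewrite -[X in \sum_(X <= _ < _) _]add0n big_addn; under [leRHS]eq_bigr do rewrite addnK.
rewrite big_mkord.
under eq_bigr do rewrite mulrA -/(F k _) -/(A _).
apply: (@ler_sum_widen _ _ _ (fun j => F k j * A (j + k)%N)).
  by move=> j; rewrite mulr_ge0.
by rewrite -addnBAC ?leq_addl// ltnW.
Qed.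

End TaylorBounds.

(** * Spreading the bounds over a connected group *)

Section Propagation.
Context (R : realType) (n : nat) (G : lieGroupType R n) (e : lie_basis G).
Notation b := (bchart e).
Notation x0 := (cmap (bchart e) 1%g).

Definition ent (u : G -> R) g := forall c, 0 <= c -> exists Q, taylor_bound c (fun w => rlds e w u g) Q.

(** The translates of one chart at the unit suffice, because g^-1 cinv k is analytic into G for
    every chart k. This makes limits analytic that are known only through their expansions in such
    translates. *)
Lemma translate_ranal (v : G -> R) :
  (forall g, analytic_at (fun x => v (g * cinv b x)%g) x0) -> ranal v.
Proof.
move=> va k ak g kg; set y0 := cmap k g.
have gP : gan (fun x => g^-1 * cinv k x)%g y0.
  by apply: gan_mul; [exact: gan_cst|apply: gan_cinv => //; exists g].
have [_ _ _ _ kK] := atlas_chart _ ak.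
have P0 : (g^-1 * cinv k y0)%g = 1%g by rewrite /y0 kK// mulVg.
have bP : cdom b (g^-1 * cinv k y0)%g by rewrite P0; exact: bchart1.
have pa := gP.2 b (bchart_atlas e) bP.
have := @analytic_comp _ _ _ (fun x => v (g * cinv b x)%g) (cmap b \o (fun x => g^-1 * cinv k x)%g) y0.
rewrite [X in analytic_at _ X]/= P0 => /(_ (va g) pa); apply: analytic_near.
apply: (@filterS _ (nbhs y0) _ _ _ _ (gan_in_chart gP (bchart_atlas e) bP)) => y /= ->.
by rewrite mulVKg.
Qed.

(** Each derivative X_w u at the new point is at most the majorant of its own expansion, a sum of
    B^j / j! |X_(w'w) u (g)| over words w' of length j. Summed over w with the weight c^k / k!,
    these form a double series that [taylor_bound_double] bounds with c + B. *)
Lemma propagate : exists B : R, 0 <= B /\ exists2 rho, 0 < rho &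
  forall u g h c Q, ranal u -> ent u g -> box rho h -> 0 <= c ->
  taylor_bound (c + B) (fun w => rlds e w u g) Q ->
  taylor_bound c (fun w => rlds e w u (g * cinv b (x0 + h))%g) Q.
Proof.
have [rho [B [oo [r0 B0 imgb bnd step]]]] := taylor_step e.
exists B; split=> //; exists rho => // u g h c Q ua ug hh c0 hQ K.
have B10 : 0 <= B + 1 by rewrite addr_ge0.
have [Q1 hQ1] := ug (B + 1) B10.
pose t w j := B ^+ j / j`!%:R * wsum j (fun w' => `|rlds e (w' ++ w) u g|).
have t0 w j : 0 <= t w j by rewrite mulr_ge0 ?divr_ge0 ?exprn_ge0 ?wsum_ge0.
have tb w := @taylor_bound_shift R n B _ Q1 w B0 hQ1.
have ct w : cvgn (series (t w)) by exact: bounded_series_cvgn (t0 w) (tb w).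
have vle w : `|rlds e w u (g * cinv b (x0 + h))%g| <= limn (series (t w)).
  have hb : taylor_bound B (fun w' => rlds e w' (rlds e w u) g) (limn (series (t w))).
    move=> J; under [X in X <= _]eq_bigr do under eq_wsum do rewrite -rlds_cat.
    have := nondecreasing_cvgn_le _ (ct w) J; rewrite [X in X J]seriesEord; apply.
    by apply: nondecreasing_series => j _ _.
  exact: repc_le (step _ _ _ (rlds_ranal e w ua) hb) hh.
have cv : (fun J => \sum_(k < K) c ^+ k / k`!%:R * wsum k (fun w => series (t w) J)) @ \oo -->
    \sum_(k < K) c ^+ k / k`!%:R * wsum k (fun w => limn (series (t w))).
  apply: (cvg_bigsum (u := fun (k : 'I_K) J => c ^+ k / k`!%:R * wsum k (fun w => series (t w) J))) => k.
  apply: cvgM; first exact: cvg_cst.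
  apply: (@cvg_wsum R nat _ _ n k (fun w J => series (t w) J) (fun w => limn (series (t w)))) => w.
  exact: ct.
apply: (@le_trans _ _ (\sum_(k < K) c ^+ k / k`!%:R * wsum k (fun w => limn (series (t w))))).
  by apply: ler_sum => k _; rewrite ler_wpM2l ?divr_ge0 ?exprn_ge0// ler_wsum.
rewrite (le_trans (ler_norm _))// -[X in `|X|]subr0.
apply: (cvgn_dist_le (N := 0) cv) => J _; rewrite subr0 ger0_norm; last first.
  apply: sumr_ge0 => k _; rewrite mulr_ge0 ?divr_ge0 ?exprn_ge0// wsum_ge0// => w.
  by rewrite seriesEord /= sumr_ge0.
apply: le_trans (taylor_bound_double K J c0 B0 hQ); rewrite le_eqVlt; apply/orP; left; apply/eqP.
apply: eq_bigr => k _; congr (_ * _); under eq_wsum do rewrite seriesEord /=.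
rewrite wsum_sum; apply: eq_bigr => j _; rewrite wsumZ; congr (_ * _).
exact: (wsum_shift j k (fun w => `|rlds e w u g|)).
Qed.

(** The set of g with such a constant C is open and closed, a box step replacing C by C + B. That C
    precedes u is what allows the bound to be applied to differences of a Cauchy sequence. *)
Lemma global_bound : connected [set: G] -> forall g, exists C, 0 <= C /\
  forall u, ranal u -> ent u 1%g -> forall c Q, 0 <= c ->
    taylor_bound (c + C) (fun w => rlds e w u 1%g) Q -> taylor_bound c (fun w => rlds e w u g) Q.
Proof.
move=> cG; pose O := [set g : G | exists C, 0 <= C /\
  forall u, ranal u -> ent u 1%g -> forall c Q, 0 <= c ->
    taylor_bound (c + C) (fun w => rlds e w u 1%g) Q -> taylor_bound c (fun w => rlds e w u g) Q].
have [B [B0 [rho r0 prop]]] := propagate.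
have step g h : O g -> box rho h -> O (g * cinv b (x0 + h))%g.
  move=> [C [C0 H]] hh; exists (C + B); split=> [|u ua u1 c Q c0 hQ]; first exact: addr_ge0.
  apply: prop => //.
    move=> c' c0'; have [Q' hQ'] := u1 (c' + C) (addr_ge0 c0' C0).
    by exists Q'; exact: H.
  apply: H => //; first exact: addr_ge0.
  by rewrite -addrA (addrC B).
have O1 : O 1%g by exists 0; split=> // u ua u1 c Q c0; rewrite addr0.
have Oo : open O.
  rewrite openE => g Og; have [N _] := near_translate e g r0.
  by apply: (@filterS _ (nbhs g) _ _ _ _ N) => g' [h hh ->]; exact: step.
have Oc : closed O.
  rewrite -(setCK O); apply: open_closedC; rewrite openE => g Og.
  have [_ N] := near_translate e g r0.
  apply: (@filterS _ (nbhs g) _ _ _ _ N) => g' [h hh E] Og'; apply: Og.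
  by rewrite E; exact: step.
have OT : O = [set: G].
  apply: cG; first by exists 1%g.
    by exists O => //; rewrite setTI.
  by exists O => //; rewrite setTI.
by move=> g; have : [set: G] g by []; rewrite -OT.
Qed.

Hypothesis cG : connected [set: G].

Lemma ent_all u g : ranal u -> ent u 1%g -> ent u g.
Proof.
move=> ua u1 c c0; have [C [C0 H]] := global_bound cG g.
by have [Q hQ] := u1 (c + C) (addr_ge0 c0 C0); exists Q; exact: H.
Qed.

(** A zero jet at the unit satisfies every bound with Q = 0, and [global_bound] carries this to
    g. *)
Lemma ent_eq0 u : ranal u -> (forall w, rlds e w u 1%g = 0) -> u =1 cst 0.
Proof.
move=> ua u0 g; have z c : taylor_bound c (fun w => rlds e w u 1%g) 0.
  move=> K; rewrite big1// => j _.
  by under eq_wsum do rewrite u0 normr0; rewrite wsum0 mulr0.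
have [C [C0 H]] := global_bound cG g.
have u1 : ent u 1%g by move=> c _; exists 0.
have := @taylor_bound_term R n 0 _ _ [::] (lexx _) (H u ua u1 0 0 (lexx _) (z _)).
by rewrite /= expr0 mul1r mulr0 normr_le0 => /eqP.
Qed.

End Propagation.

(** * Completeness for real-valued functions *)

Section RealCompleteness.
Context (R : realType) (n : nat) (G : lieGroupType R n) (e : lie_basis G).
Notation b := (bchart e).
Notation x0 := (cmap (bchart e) 1%g).

Lemma cauchy_seq_cvgn (u : nat -> R) :
  (forall eps, 0 < eps -> exists N, forall i j, (N <= i)%N -> (N <= j)%N -> `|u i - u j| <= eps) ->
  cvgn u.
Proof.
move=> H; apply: cauchy_cvg; apply: cauchy_exP => eps e0.
have e2 : 0 < eps / 2 by rewrite divr_gt0.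
have [N hN] := H _ e2; exists (u N), N => // i /= Ni.
by rewrite /ball /= (le_lt_trans (hN N i (leqnn _) Ni))//; lra.
Qed.

Lemma taylor_boundN c (T : seq 'I_n -> R) Q : taylor_bound c T Q -> taylor_bound c (fun w => - T w) Q.
Proof.
move=> h K; apply: le_trans (h K); rewrite le_eqVlt; apply/orP; left; apply/eqP.
by apply: eq_bigr => j _; congr (_ * _); apply: eq_wsum => w _; rewrite normrN.
Qed.

Lemma taylor_boundB c (T T' : seq 'I_n -> R) Q Q' : 0 <= c -> taylor_bound c T Q -> taylor_bound c T' Q' ->
  taylor_bound c (fun w => T w - T' w) (Q + Q').
Proof. by move=> c0 h /taylor_boundN; exact: taylor_boundD. Qed.

Lemma taylor_bound_eq c (T T' : seq 'I_n -> R) Q : T =1 T' -> taylor_bound c T Q -> taylor_bound c T' Q.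
Proof. by move=> /funext ->. Qed.

Lemma ent_sub (u v : G -> R) g : ranal u -> ranal v -> ent e u g -> ent e v g ->
  ent e (fun g => u g - v g) g.
Proof.
move=> ua va ug vg c c0; have [Q hQ] := ug c c0; have [Q' hQ'] := vg c c0.
exists (Q + Q'); apply: taylor_bound_eq (taylor_boundB c0 hQ hQ') => w.
by rewrite rldsB.
Qed.

Hypothesis cG : connected [set: G].

Section Limit.
Variable u_ : nat -> G -> R.
Hypothesis ua : forall i, ranal (u_ i).
Hypothesis u1 : forall i, ent e (u_ i) 1%g.
Hypothesis uC : forall c eps, 0 <= c -> 0 < eps -> exists N, forall i j, (N <= i)%N -> (N <= j)%N ->
  taylor_bound c (fun w => rlds e w (u_ i) 1%g - rlds e w (u_ j) 1%g) eps.

(** The limit is taken for each derivative separately; [Lrld] shows afterwards that these limits are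
    derivatives of one function. *)
Let L w g := limn (fun i => rlds e w (u_ i) g).

Let uCg g c eps : 0 <= c -> 0 < eps -> exists N, forall i j, (N <= i)%N -> (N <= j)%N ->
  taylor_bound c (fun w => rlds e w (u_ i) g - rlds e w (u_ j) g) eps.
Proof.
move=> c0 e0; have [C [C0 H]] := global_bound e cG g.
have [N hN] := uC (addr_ge0 c0 C0) e0; exists N => i j Ni Nj.
have := H (fun g => u_ i g - u_ j g) (ranalB (ua i) (ua j)) (ent_sub (ua i) (ua j) (u1 i) (u1 j)) c eps c0.
move=> h; apply: (taylor_bound_eq _ (h _)) => [w|]; first by rewrite rldsB.
by apply: taylor_bound_eq (hN i j Ni Nj) => w; rewrite rldsB.
Qed.

Let Lcvg w g : (fun i => rlds e w (u_ i) g) @ \oo --> L w g.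
Proof.
suff : cvgn (fun i => rlds e w (u_ i) g) by [].
apply: cauchy_seq_cvgn => eps e0.
have f0 : (0 : R) < (size w)`!%:R by rewrite ltr0n fact_gt0.
have [N hN] := uCg g ler01 (divr_gt0 e0 f0); exists N => i j Ni Nj.
have := @taylor_bound_term R n 1 _ _ w ler01 (hN i j Ni Nj).
by rewrite expr1n mul1r mulrC divfK// gt_eqF.
Qed.

Let Lbound g c eps : 0 <= c -> 0 < eps -> exists N, forall i, (N <= i)%N ->
  taylor_bound c (fun w => L w g - rlds e w (u_ i) g) eps.
Proof.
move=> c0 e0; have [N hN] := uCg g c0 e0; exists N => i Ni.
apply: (@taylor_bound_lim _ _ _ (fun k w => rlds e w (u_ k) g - rlds e w (u_ i) g) _ _ N) => // [w|k Nk].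
  by apply: cvgB; [exact: Lcvg|exact: cvg_cst].
exact: hN.
Qed.

Let Lshift g w c eps : 0 <= c -> 0 < eps -> exists N, forall i, (N <= i)%N ->
  taylor_bound c (fun w' => L (w' ++ w) g - rlds e w' (rlds e w (u_ i)) g) eps.
Proof.
move=> c0 e0; have f0 : (0 : R) < (size w)`!%:R by rewrite ltr0n fact_gt0.
have [N hN] := Lbound g (addr_ge0 c0 ler01) (divr_gt0 e0 f0); exists N => i Ni.
have := @taylor_bound_shift R n c _ _ w c0 (hN i Ni).
by rewrite mulrC divfK ?gt_eqF//; apply: taylor_bound_eq => w'; rewrite rlds_cat.
Qed.

(** The expansions of all X_w u_i hold on a box independent of i, w and g. Convergence of the jets
    becomes convergence of the coefficients in the majorant norm, so the limit has the expansion
    built from the limit jet. *)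
Let Lexp : exists2 rho, 0 < rho & exists o, forall w g,
  (exists Q, repc rho Q (tcoef o (fun w' => L (w' ++ w) g) [::])
    (fun h => L w (g * cinv b (x0 + h))%g)) /\
  forall i, exists Q, repc rho Q (tcoef o (fun w' => rlds e w' (rlds e w (u_ i)) g) [::])
    (fun h => rlds e w (u_ i) (g * cinv b (x0 + h))%g) /\
  forall eps, 0 < eps -> exists N, forall i, (N <= i)%N ->
  forall K, \sum_(d < K) nrm (tcoef o (fun w' => L (w' ++ w) g - rlds e w' (rlds e w (u_ i)) g) [::]) d * rho ^+ d <= eps.
Proof.
have [rho [B [oo [r0 B0 imgb bnd step]]]] := taylor_step e.
exists rho => //; exists oo => w g.
have entw i : exists Q, taylor_bound B (fun w' => rlds e w' (rlds e w (u_ i)) g) Q.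
  have [Q hQ] := ent_all cG g (ua i) (u1 i) (addr_ge0 B0 ler01).
  exists ((size w)`!%:R * Q); apply: taylor_bound_eq (@taylor_bound_shift R n B _ Q w B0 hQ) => w'.
  by rewrite rlds_cat.
have repi i : exists Q, repc rho Q (tcoef oo (fun w' => rlds e w' (rlds e w (u_ i)) g) [::])
    (fun h => rlds e w (u_ i) (g * cinv b (x0 + h))%g).
  have [Q hQ] := entw i; exists Q; apply: step => //; exact: rlds_ranal.
have small eps : 0 < eps -> exists N, forall i, (N <= i)%N ->
  forall K, \sum_(d < K) nrm (tcoef oo (fun w' => L (w' ++ w) g - rlds e w' (rlds e w (u_ i)) g) [::]) d * rho ^+ d <= eps.
  move=> e0; have [N hN] := Lshift g w B0 e0; exists N => i Ni.
  exact: bnd (hN i Ni).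
split; last by move=> i; have [Q hQ] := repi i; exists Q.
set T := fun w' => L (w' ++ w) g.
have [Q hQ] : exists Q, taylor_bound B T Q.
  have [N hN] := Lshift g w B0 ltr01; have [Q' hQ'] := entw N.
  exists (1 + Q'); apply: taylor_bound_eq (taylor_boundD B0 (hN N (leqnn _)) hQ') => w'.
  by rewrite subrK.
have TQ := bnd T Q hQ; exists Q; split=> // h hh.
have cS : cvgn (series (fun d => hom (tcoef oo T [::]) d h)).
  by apply: (abs_series_cvgn (M := fun d => nrm (tcoef oo T [::]) d * rho ^+ d)) TQ => d; apply: hom_le => i; exact: ltW.
suff -> : L w (g * cinv b (x0 + h))%g = limn (series (fun d => hom (tcoef oo T [::]) d h)) by exact: cS.
apply/eqP; rewrite -subr_eq0 -normr_le0; apply/ler_addgt0Pr => eps e0; rewrite add0r.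
have e2 : 0 < eps / 2 by rewrite divr_gt0.
have [N hN] := small _ e2.
have /cvgn_epsP/(_ _ e2)[N' hN'] := @Lcvg w (g * cinv b (x0 + h))%g.
pose i := maxn N N'; set S := limn _.
have [Qi [_ /(_ h hh) hi]] := repi i.
have cd : (series (fun d => hom (tcoef oo T [::]) d h) \- series (fun d => hom (tcoef oo (fun w' => rlds e w' (rlds e w (u_ i)) g) [::]) d h)) @ \oo -->
    S - rlds e w (u_ i) (g * cinv b (x0 + h))%g by apply: cvgB.
have h1 : `|S - rlds e w (u_ i) (g * cinv b (x0 + h))%g| <= eps / 2.
  rewrite -[X in `|X|]subr0; apply: (cvgn_dist_le (N := 0) cd) => K _.
  rewrite subr0 /= !seriesEord /= -sumrB (le_trans (ler_norm_sum _ _ _))//.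
  apply: le_trans (hN i (leq_maxl _ _) K); apply: ler_sum => d _.
  have -> : hom (tcoef oo T [::]) d h - hom (tcoef oo (fun w' => rlds e w' (rlds e w (u_ i)) g) [::]) d h =
     hom (tcoef oo (fun w' => L (w' ++ w) g - rlds e w' (rlds e w (u_ i)) g) [::]) d h.
    rewrite /hom -mulN1r -wsumZ -wsumD; apply: eq_wsum => v _.
    by rewrite tcoefB mulrBl mulN1r.
  by apply: hom_le => j; exact: ltW.
have h2 := hN' i (leq_maxr _ _).
have -> : L w (g * cinv b (x0 + h))%g - S = (L w (g * cinv b (x0 + h))%g - rlds e w (u_ i) (g * cinv b (x0 + h))%g) -
   (S - rlds e w (u_ i) (g * cinv b (x0 + h))%g) by ring.
by rewrite (le_trans (ler_normB _ _))// [leRHS]splitr lerD.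
Qed.

Let Lranal w : ranal (L w).
Proof.
have [rho r0 [oo H]] := Lexp; apply: (translate_ranal (e := e)) => g.
have [[Q hQ] _] := H w g; apply/analytic_atP; exists rho, Q; split=> //.
by exists (tcoef oo (fun w' => L (w' ++ w) g) [::]).
Qed.

(** A derivative along e_i is a fixed linear combination of the one-letter coefficients, and these
    converge; hence differentiation commutes with the limit. *)
Let Lrld i w : rld e i (L w) = L (i :: w).
Proof.
have [rho r0 [oo H]] := Lexp; apply/funext => g.
have [[Q hQ] Hk] := H w g.
have der (v : G -> R) Q' a : repc rho Q' a (fun h => v (g * cinv b (x0 + h))%g) ->
    rld e i v g = \sum_j bvec e i 0 j * a [:: j].
  move=> rv; apply: quadr_derive; exists (Q' / rho ^+ 2), rho; split=> // k kappa k0 kr kk.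
  have := repc_quad r0 rv k0 kr kk; rewrite addr0 expr_div_n => /le_trans; apply.
  by rewrite mulrA mulrAC.
have c1 : (fun k => rld e i (rlds e w (u_ k)) g) @ \oo --> L (i :: w) g by exact: (@Lcvg (i :: w) g).
have c2 : (fun k => rld e i (rlds e w (u_ k)) g) @ \oo --> rld e i (L w) g.
  have -> : (fun k => rld e i (rlds e w (u_ k)) g) = (fun k => \sum_j bvec e i 0 j *
      tcoef oo (fun w' => rlds e w' (rlds e w (u_ k)) g) [::] [:: j]).
    by apply/funext => k; have [Qk [hk _]] := Hk k; exact: der hk.
  rewrite (der _ _ _ hQ).
  apply: (cvg_bigsum (u := fun j k => bvec e i 0 j *
      tcoef oo (fun w' => rlds e w' (rlds e w (u_ k)) g) [::] [:: j])) => j.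
  apply: cvgM; first exact: cvg_cst.
  apply/cvgn_epsP => eps e0.
  (* The smallness clause is the same for every index, so it is taken from index 0. *)
  have [_ [_ sm]] := Hk 0%N; have [N hN] := sm _ (mulr_gt0 e0 r0).
  exists N => k Nk; rewrite -tcoefB.
  (* Two terms, so that the sum contains degree one, with its factor rho; hence the tolerance
     [eps * rho] above. *)
  have := hN k Nk 2%N; rewrite big_ord_recr big_ord1 /= expr0 mulr1 expr1 => h.
  rewrite -(ler_pM2r r0); apply: le_trans h.
  rewrite -[leLHS]add0r lerD ?nrm_ge0// ler_wpM2r ?(ltW r0)//.
  exact: (@ler_wsum_term _ _ 1 (fun v => `|tcoef oo _ [::] v|) [:: j]).
exact: (cvg_unique _ c2 c1).
Qed.

Lemma real_complete : exists u, ranal u /\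
  forall w g, (fun i => rlds e w (u_ i) g) @ \oo --> rlds e w u g.
Proof.
exists (L [::]); split=> // w g.
suff -> : rlds e w (L [::]) = L w by exact: Lcvg.
by elim: w => //= i w ->; exact: Lrld.
Qed.

End Limit.
End RealCompleteness.

Local Open Scope complex_scope.

(** * Hilbert seminorms *)

Section ComplexModulus.
Context (R : realType).
Implicit Types (z w : R[i]) (t : R).

Lemma cabsE z : `|z| = (cabs z)%:C.
Proof. by case: z. Qed.

Lemma cabs_ge0 z : 0 <= cabs z.
Proof. by case: z => a b; exact: sqrtr_ge0. Qed.

Lemma cabsD z w : cabs (z + w) <= cabs z + cabs w.
Proof. by rewrite -lecR rmorphD /= -!cabsE ler_normD. Qed.

Lemma cabsM z w : cabs (z * w) = cabs z * cabs w.
Proof. exact: Normc.normcM. Qed.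

Lemma cabsN z : cabs (- z) = cabs z.
Proof. by apply: complexI; rewrite -!cabsE normrN. Qed.

Lemma cabsB z w : cabs (z - w) <= cabs z + cabs w.
Proof. by rewrite -(cabsN w) cabsD. Qed.

Lemma cabs0 : cabs (0 : R[i]) = 0.
Proof. exact: Normc.normc0. Qed.

Lemma cabs_eq0 z : cabs z = 0 -> z = 0.
Proof. exact: Normc.eq0_normc. Qed.

Lemma cabsC t : cabs t%:C = `|t|.
Proof. by rewrite /= expr0n addr0 sqrtr_sqr. Qed.

Lemma cabs_conj z : cabs z^* = cabs z.
Proof. by apply: complexI; rewrite -!cabsE norm_conjC. Qed.

Lemma Re_le_cabs z : `|complex.Re z| <= cabs z.
Proof.
case: z => a b /=; rewrite -sqrtr_sqr ler_wsqrtr// lerDl; exact: sqr_ge0.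
Qed.

Lemma Im_le_cabs z : `|complex.Im z| <= cabs z.
Proof.
case: z => a b /=; rewrite -sqrtr_sqr ler_wsqrtr// lerDr; exact: sqr_ge0.
Qed.

Lemma cabs_le_ReIm z : cabs z <= `|complex.Re z| + `|complex.Im z|.
Proof.
case: z => a b /=; rewrite -(@ler_pXn2r _ 2)// ?nnegrE ?sqrtr_ge0 ?addr_ge0//.
rewrite sqr_sqrtr ?addr_ge0 ?sqr_ge0// sqrrD !real_normK ?num_real//.
by rewrite -addrA lerD// lerDr mulrn_wge0// mulr_ge0.
Qed.

Lemma ReD z w : complex.Re (z + w) = complex.Re z + complex.Re w.
Proof. by case: z => ? ?; case: w. Qed.

Lemma ReZ t z : complex.Re (t%:C * z) = t * complex.Re z.
Proof. by case: z => a b /=; rewrite mul0r subr0. Qed.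

Lemma Re_mul_conj z : complex.Re (z * z^*) = cabs z ^+ 2.
Proof.
case: z => a b /=; rewrite sqr_sqrtr ?addr_ge0 ?sqr_ge0//.
by rewrite mulrN opprK !expr2.
Qed.

Lemma Re_mul_conjC z w : complex.Re (z * w^*) = complex.Re (w * z^*).
Proof. by case: z => a b; case: w => c d /=; rewrite !mulrN !opprK; ring. Qed.

(* Rotate z onto the positive real axis. *)
Lemma cabs_phase z : exists u : R[i], cabs u = 1 /\ u * z = (cabs z)%:C.
Proof.
have [->|z0] := eqVneq z 0.
  by exists 1; rewrite mulr0 cabs0; split=> //; rewrite -[1](_ : (1:R)%:C = _)// cabsC normr1.
have cz : cabs z != 0 by apply: contra z0 => /eqP/cabs_eq0 ->.
have cC : (cabs z)%:C != 0 :> R[i] by rewrite -cabsE normr_eq0.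
exists (z^* / (cabs z)%:C); split.
  rewrite cabsM cabs_conj.
  have -> : cabs ((cabs z)%:C^-1 : R[i]) = (cabs z)^-1.
    apply: complexI; rewrite -[LHS]cabsE normfV cabsE cabsC ger0_norm ?cabs_ge0//.
    by rewrite fmorphV.
  by rewrite mulfV.
rewrite mulrAC -normCKC cabsE expr2 -mulrA mulfV// mulr1//.
Qed.

End ComplexModulus.

Section InnerProduct.
Context (R : realType) (E : lmodType R[i]).

Lemma discriminant_le (a b c : R) : 0 <= a ->
  (forall t, 0 <= a * t ^+ 2 + 2 * b * t + c) -> b ^+ 2 <= a * c.
Proof.
move=> a0 H; have [a00|an0] := eqVneq a 0.
  have [->|b0] := eqVneq b 0; first by rewrite a00 mul0r expr0n.
  have := H (- (c + 1) / (2 * b)); rewrite a00 mul0r add0r.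
  have -> : 2 * b * (- (c + 1) / (2 * b)) + c = -1 by field.
  by rewrite lerNr oppr0 ler10.
have ap : 0 < a by rewrite lt_neqAle eq_sym an0.
have := H (- b / a); have -> : a * (- b / a) ^+ 2 + 2 * b * (- b / a) + c = (a * c - b ^+ 2) / a by field.
by rewrite pmulr_lge0 ?invr_gt0// subr_ge0.
Qed.

(** The real part of a semidefinite Hermitian product. Real bilinearity suffices for minimisation,
    and [ip_adj] restores the homogeneity of the norm for complex scalars. *)
Record inner_product := InnerProduct {
  ip :> E -> E -> R;
  ipC : forall x y, ip x y = ip y x;
  ipD : forall x y z, ip (x + y) z = ip x z + ip y z;
  ipZ : forall (t : R) x y, ip (t%:C *: x) y = t * ip x y;
  ip_ge0 : forall x, 0 <= ip x x;
  ip_adj : forall (a : R[i]) x y, ip x (a *: y) = ip (a^* *: x) y }.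

Variable f : inner_product.

Definition ipnorm x := Num.sqrt (f x x).

Lemma ipnorm_ge0 x : 0 <= ipnorm x.
Proof. exact: sqrtr_ge0. Qed.

Lemma ipnorm_sqr x : ipnorm x ^+ 2 = f x x.
Proof. by rewrite sqr_sqrtr// ip_ge0. Qed.

Lemma ipN x y : f (- x) y = - f x y.
Proof. by have := ipZ f (-1) x y; rewrite rmorphN1 scaleN1r mulN1r. Qed.

Lemma ipB x y z : f (x - y) z = f x z - f y z.
Proof. by rewrite ipD ipN. Qed.

Lemma ipDr x y z : f x (y + z) = f x y + f x z.
Proof. by rewrite !(ipC _ x) ipD. Qed.

Lemma ipBr x y z : f x (y - z) = f x y - f x z.
Proof. by rewrite !(ipC _ x) ipB. Qed.

Lemma ipZr t x y : f x (t%:C *: y) = t * f x y.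
Proof. by rewrite !(ipC _ x) ipZ. Qed.

Lemma ip_sum_r (I : Type) (r : seq I) (F : I -> E) x :
  f x (\sum_(i <- r) F i) = \sum_(i <- r) f x (F i).
Proof.
elim: r => [|i r ih]; last by rewrite !big_cons ipDr ih.
by rewrite !big_nil; have := ipZr 0 x 0; rewrite scaler0 mul0r.
Qed.

Lemma ip_CS x y : `|f x y| <= ipnorm x * ipnorm y.
Proof.
rewrite -(@ler_pXn2r _ 2)// ?nnegrE ?mulr_ge0 ?ipnorm_ge0//.
rewrite exprMn !ipnorm_sqr real_normK ?num_real// mulrC.
apply: discriminant_le => [|t]; first exact: ip_ge0.
have := ip_ge0 f (x + t%:C *: y); rewrite ipD !ipDr ipZ !ipZr ipZ (ipC _ y x).
by congr (0 <= _); ring.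
Qed.

Lemma ipnormD x y : ipnorm (x + y) <= ipnorm x + ipnorm y.
Proof.
rewrite -(@ler_pXn2r _ 2)// ?nnegrE ?addr_ge0 ?ipnorm_ge0//.
rewrite sqrrD !ipnorm_sqr ipD !ipDr (ipC _ y x).
have := le_trans (ler_norm _) (ip_CS x y); lra.
Qed.

Lemma ipnormZ a x : ipnorm (a *: x) = cabs a * ipnorm x.
Proof.
rewrite /ipnorm ip_adj scalerA mulrC.
have -> : a * a^* = (cabs a ^+ 2)%:C by rewrite -normCK cabsE rmorphXn.
by rewrite ipZ sqrtrM ?sqr_ge0// sqrtr_sqr ger0_norm// cabs_ge0.
Qed.

Lemma ipnormN x : ipnorm (- x) = ipnorm x.
Proof. by rewrite -scaleN1r ipnormZ cabsN -[1](_ : (1:R)%:C = _)// cabsC normr1 mul1r. Qed.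

(* Any near-minimiser of |psi|^2 - 2 l(psi) nearly represents l. *)
Lemma approx_riesz (l : E -> R) K :
  (forall x y, l (x + y) = l x + l y) -> (forall (t : R) x, l (t%:C *: x) = t * l x) ->
  (forall x, `|l x| <= K * ipnorm x) ->
  forall eps, 0 < eps -> exists psi, forall x, `|l x - f x psi| <= eps * ipnorm x.
Proof.
move=> lD lZ lK eps e0.
pose J x := f x x - 2 * l x.
have J_ge x : - K ^+ 2 <= J x.
  rewrite /J -ipnorm_sqr; have := le_trans (ler_norm _) (lK x).
  by have := sqr_ge0 (ipnorm x - K); nra.
pose S := [set J x | x in [set: E]].
have infS : has_inf S.
  split; first by exists (J 0), 0.
  by exists (- K ^+ 2) => _ [x _ <-].
(* With psi minimal up to eps^2, the polynomial t^2 |x|^2 + 2 t (f x psi - l x) + eps^2 is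
   nonnegative for all t, and its discriminant gives the bound eps |x|. *)
have e20 : 0 < eps ^+ 2 by rewrite exprn_gt0.
have [_ [psi _ <-] Jpsi] := inf_adherent e20 infS.
exists psi => x; rewrite -(@ler_pXn2r _ 2)// ?nnegrE ?mulr_ge0 ?ipnorm_ge0 ?(ltW e0)//.
rewrite exprMn ipnorm_sqr real_normK ?num_real// mulrC -sqrrN opprB.
apply: discriminant_le => [|t]; first exact: ip_ge0.
have : inf S <= J (psi + t%:C *: x) by apply: ge_inf; [exact: infS.2|exists (psi + t%:C *: x)].
rewrite /J lD lZ ipD !ipDr ipZ !ipZr ipZ (ipC _ psi x) => h.
move: (lt_le_trans Jpsi (lerD h (lexx (eps ^+ 2)))); rewrite /J.
lra.
Qed.

End InnerProduct.

(* A complete separated space whose topology is given by the seminorms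
   x |-> sup_m om j m * |lam m x|, with summable quotients om j / om (j + 1). *)
Record nuclear_system (R : realType) (E : tvsType R[i]) := NuclearSystem {
  lam : nat -> E -> R[i];
  om : nat -> nat -> R;
  lamD : forall m x y, lam m (x + y) = lam m x + lam m y;
  lamZ : forall m a x, lam m (a *: x) = a * lam m x;
  om_gt0 : forall j m, 0 < om j m;
  om_le : forall j m, om j m <= om j.+1 m;
  om_sum : forall j, exists K, forall M, \sum_(m < M) om j m / om j.+1 m <= K;
  sys_nbhs : forall (x : E) (A : set E), nbhs x A <-> exists j eps, 0 < eps /\
    forall y, (forall m, om j m * cabs (lam m (y - x)) <= eps) -> A y;
  sys_complete : forall x_ : nat -> E,
    (forall j eps, 0 < eps -> exists N, forall i k, (N <= i)%N -> (N <= k)%N ->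
       forall m, om j m * cabs (lam m (x_ i - x_ k)) <= eps) ->
    exists x, forall j eps, 0 < eps -> exists N, forall i, (N <= i)%N ->
       forall m, om j m * cabs (lam m (x_ i - x)) <= eps;
  sys_separated : forall x, (forall m, lam m x = 0) -> x = 0 }.

(** * Hilbert seminorms of a nuclear system *)

Section NuclearSystemTheory.
Context (R : realType) (E : tvsType R[i]) (s : nuclear_system E).
Notation l := (lam s).
Notation w := (om s).

Definition sball j eps (x : E) := forall m, w j m * cabs (l m x) <= eps.

Lemma lamN m x : l m (- x) = - l m x.
Proof. by rewrite -scaleN1r lamZ mulN1r. Qed.

Lemma lamB m x y : l m (x - y) = l m x - l m y.
Proof. by rewrite lamD lamN. Qed.

Lemma sballZ j e a x : sball j e x -> sball j (cabs a * e) (a *: x).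
Proof. by move=> xe m; rewrite lamZ cabsM mulrCA ler_wpM2l ?cabs_ge0. Qed.

Lemma sball_le j a b x : a <= b -> sball j a x -> sball j b x.
Proof. by move=> ab xa m; apply: le_trans ab. Qed.

Lemma sball_ge0 j e x : sball j e x -> 0 <= e.
Proof. by move=> /(_ 0%N); apply: le_trans; rewrite mulr_ge0 ?cabs_ge0// ltW// om_gt0. Qed.

(** The suprema are finite: by continuity of scalar multiplication at (0, x), a small multiple of x
    lies in the unit ball of index j. *)
Lemma sball_absorb j x : exists S, sball j S x.
Proof.
have N0 : nbhs (0 : E) [set y | sball j 1 y].
  apply/(sys_nbhs s); exists j, 1; split=> // y; rewrite subr0.
  by move=> h m; exact: h.
have := @scale_continuous _ E (0, x) [set y | sball j 1 y].
rewrite /= scale0r => /(_ N0) [[B1 B2] /= [/nbhs_ballP[d d0 B1d] B2x] BB].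
have dn0 : d / 2 != 0 by rewrite mulf_neq0 ?invr_eq0 ?pnatr_eq0 ?gt_eqF.
have dB : B1 (d / 2).
  apply: B1d; rewrite -ball_normE /= sub0r normrN gtr0_norm ?divr_gt0//.
  by rewrite ltr_pdivrMr// ltr_pMr// ltr1n.
have := BB (d / 2, x) (conj dB (nbhs_singleton B2x)).
move=> /(sballZ (d / 2)^-1); rewrite /= scalerA mulVf// scale1r => h.
by exists (cabs (d / 2)^-1 * 1).
Qed.

Definition ratio j m := w j m / w j.+1 m.

Lemma ratio_ge0 j m : 0 <= ratio j m.
Proof. by rewrite divr_ge0// ltW// om_gt0. Qed.

Lemma ratio_le1 j m : ratio j m <= 1.
Proof. by rewrite ler_pdivrMr ?om_gt0// mul1r om_le. Qed.

Lemma ratio_om j m : ratio j m * w j.+1 m = w j m.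
Proof. by rewrite divfK// gt_eqF// om_gt0. Qed.

Lemma ratio_tail j e : 0 < e -> exists M, forall K, \sum_(M <= m < K) ratio j m <= e.
Proof.
move=> e0; have [K hK] := om_sum s j.
exact: (bounded_series_tail (ratio_ge0 j) hK).
Qed.

Lemma ratio_small j e : 0 < e -> exists M, forall m, (M <= m)%N -> ratio j m <= e.
Proof.
move=> /(ratio_tail j)[M hM]; exists M => m Mm; have := hM m.+1.
rewrite big_nat_recr//=; apply: le_trans; rewrite lerDr sumr_ge0// => i _; exact: ratio_ge0.
Qed.

Lemma sball_term j e x m : sball j.+1 e x -> w j m * cabs (l m x) <= ratio j m * e.
Proof. by move=> xe; rewrite -ratio_om -mulrA ler_wpM2l ?ratio_ge0. Qed.

Section Product.
Variable j : nat.

Definition ipterm (x y : E) m : R := w j m ^+ 2 * complex.Re (l m x * (l m y)^*).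

Lemma ipterm_le_mul x y m :
  `|ipterm x y m| <= (w j m * cabs (l m x)) * (w j m * cabs (l m y)).
Proof.
rewrite /ipterm normrM normrX (gtr0_norm (om_gt0 _ _ _)).
apply: le_trans (ler_wpM2l _ (Re_le_cabs _)) _; first by rewrite sqr_ge0.
by rewrite cabsM cabs_conj expr2 mulrACA.
Qed.

Lemma ipterm_le a b x y m : sball j.+1 a x -> sball j.+1 b y ->
  `|ipterm x y m| <= ratio j m * (a * b).
Proof.
move=> xa yb; have a0 := sball_ge0 xa; have b0 := sball_ge0 yb.
apply: le_trans (ipterm_le_mul x y m) _.
apply: le_trans (ler_pM _ _ (sball_term m xa) (sball_term m yb)) _.
- by rewrite mulr_ge0 ?cabs_ge0// ltW// om_gt0.
- by rewrite mulr_ge0 ?cabs_ge0// ltW// om_gt0.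
rewrite mulrACA ler_wpM2r ?mulr_ge0//.
by rewrite ler_piMr ?ratio_ge0 ?ratio_le1.
Qed.

Definition ipfun x y : R := limn (series (ipterm x y)).

Lemma ipfun_cvg x y : series (ipterm x y) @ \oo --> ipfun x y.
Proof.
have [a xa] := sball_absorb j.+1 x; have [b yb] := sball_absorb j.+1 y.
have [K hK] := om_sum s j.
suff : cvgn (series (ipterm x y)) by [].
apply: (abs_series_cvgn (M := fun m => ratio j m * (a * b)) (B := K * (a * b))) => [m|N].
  exact: ipterm_le.
by rewrite -mulr_suml ler_wpM2r// mulr_ge0 ?(sball_ge0 xa) ?(sball_ge0 yb).
Qed.

Lemma ipfun_eq x y c : series (ipterm x y) @ \oo --> c -> ipfun x y = c.
Proof. by move=> h; exact: (cvg_unique _ (@ipfun_cvg x y) h). Qed.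

Lemma ipfunC x y : ipfun x y = ipfun y x.
Proof. by congr (limn (series _)); apply/funext => m; rewrite /ipterm Re_mul_conjC. Qed.

Lemma ipfunD x y z : ipfun (x + y) z = ipfun x z + ipfun y z.
Proof.
apply: ipfun_eq; have -> : series (ipterm (x + y) z) = series (ipterm x z) \+ series (ipterm y z).
  apply/funext => M; rewrite /= !seriesEord /= -big_split; apply: eq_bigr => m _.
  by rewrite /ipterm lamD mulrDl ReD mulrDr.
by apply: cvgD; exact: ipfun_cvg.
Qed.

Lemma ipfunZ (t : R) x y : ipfun (t%:C *: x) y = t * ipfun x y.
Proof.
apply: ipfun_eq; have -> : series (ipterm (t%:C *: x) y) = (fun M => t * series (ipterm x y) M).
  apply/funext => M; rewrite /= !seriesEord /= mulr_sumr; apply: eq_bigr => m _.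
  by rewrite /ipterm lamZ -(mulrA t%:C) ReZ mulrCA.
by apply: cvgM; [exact: cvg_cst|exact: ipfun_cvg].
Qed.

Lemma ipterm_ge0 x m : 0 <= ipterm x x m.
Proof. by rewrite /ipterm Re_mul_conj mulr_ge0 ?sqr_ge0. Qed.

Lemma ipterm_sum_le x M : \sum_(m < M) ipterm x x m <= ipfun x x.
Proof.
have nd : nondecreasing_seq (series (ipterm x x)).
  by apply: nondecreasing_series => m _ _; exact: ipterm_ge0.
have := nondecreasing_cvgn_le nd _ M; rewrite [X in _ -> X M <= _]seriesEord; apply.
by apply/cvg_ex; exists (ipfun x x); exact: ipfun_cvg.
Qed.

Lemma ipfun_ge0 x : 0 <= ipfun x x.
Proof. by have := ipterm_sum_le x 0; rewrite big_ord0. Qed.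

Lemma ipfun_adj (a : R[i]) x y : ipfun x (a *: y) = ipfun (a^* *: x) y.
Proof.
congr (limn (series _)); apply/funext => m; rewrite /ipterm !lamZ rmorphM /=.
by congr (_ * complex.Re _); rewrite mulrCA mulrA.
Qed.

Definition sys_ip : inner_product E :=
  InnerProduct ipfunC ipfunD ipfunZ ipfun_ge0 ipfun_adj.

End Product.

(** By [sball_hn] and [hn_sball] it lies between the suprema of index j and, up to a constant, j +
    1, so these seminorms define the same topology. *)
Definition hn j (x : E) : R := ipnorm (sys_ip j) x.

Lemma hn_ge0 j x : 0 <= hn j x.
Proof. exact: ipnorm_ge0. Qed.

Lemma sball_hn j x : sball j (hn j x) x.
Proof.
move=> m; rewrite -(@ler_pXn2r _ 2)// ?nnegrE ?mulr_ge0 ?hn_ge0 ?cabs_ge0 ?(ltW (om_gt0 _ _ _))//.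
rewrite ipnorm_sqr exprMn -Re_mul_conj; apply: le_trans (ipterm_sum_le j x m.+1).
by rewrite big_ord_recr /= lerDr sumr_ge0// => i _; exact: ipterm_ge0.
Qed.

Lemma hn_sball j : exists2 K, 0 < K & forall x e, sball j.+1 e x -> hn j x <= K * e.
Proof.
have [K hK] := om_sum s j; have K0 : 0 <= K by have := hK 0%N; rewrite big_ord0.
exists (K + 1) => [|x e xe]; first by rewrite ltr_wpDl.
have e0 := sball_ge0 xe.
rewrite -(@ler_pXn2r _ 2)// ?nnegrE ?mulr_ge0 ?hn_ge0 ?addr_ge0// ipnorm_sqr /=.
have h : `|ipfun j x x| <= K * (e * e).
  apply: series_norm_le (@ipfun_cvg j x x) _ => M.
  apply: (@le_trans _ _ (\sum_(m < M) ratio j m * (e * e))).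
    by apply: ler_sum => m _; exact: ipterm_le.
  by rewrite -mulr_suml ler_wpM2r// mulr_ge0.
apply: le_trans (ler_norm _) _; apply: (le_trans h).
by rewrite exprMn -expr2 ler_wpM2r ?sqr_ge0//; nra.
Qed.

Lemma hn_mono j x : hn j x <= hn j.+1 x.
Proof.
rewrite -(@ler_pXn2r _ 2)// ?nnegrE ?hn_ge0// !ipnorm_sqr /=.
have cv := @ipfun_cvg j x x; rewrite -[leLHS]ger0_norm ?ipfun_ge0//.
apply: series_norm_le cv _ => M; apply: le_trans (ipterm_sum_le j.+1 x M).
apply: ler_sum => m _; rewrite ger0_norm ?ipterm_ge0// /ipterm ler_wpM2r//.
  by rewrite Re_mul_conj sqr_ge0.
by rewrite lerXn2r ?nnegrE ?om_le ?(ltW (om_gt0 _ _ _)).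
Qed.

Lemma hn_homo i j x : (i <= j)%N -> hn i x <= hn j x.
Proof.
move=> /subnK <-; elim: (j - i)%N => [|k ih]; first by rewrite add0n.
by rewrite addSn; exact: le_trans ih (hn_mono _ _).
Qed.

Lemma nbhs_hnP (x : E) (A : set E) :
  nbhs x A <-> exists j e, 0 < e /\ forall y, hn j (y - x) < e -> A y.
Proof.
split=> [/(sys_nbhs s)[j [e [e0 eA]]]|[j [e [e0 eA]]]].
  exists j, e; split=> // y ye; apply: eA.
  exact: (sball_le (ltW ye) (sball_hn j (y - x))).
have [K K0 hK] := hn_sball j.
apply/(sys_nbhs s); exists j.+1, (e / (2 * K)); split; first by rewrite divr_gt0// mulr_gt0.
move=> y ye; apply: eA; apply: le_lt_trans (hK _ _ ye) _.
have -> : K * (e / (2 * K)) = e / 2 by field; rewrite gt_eqF.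
lra.
Qed.

Lemma hn_eq0 x : (forall j, hn j x = 0) -> x = 0.
Proof.
move=> x0; apply: (sys_separated (n := s)) => m; apply: cabs_eq0; apply/eqP.
rewrite eq_le cabs_ge0 andbT -(ler_pM2l (om_gt0 s 0 m)) mulr0.
by rewrite -[leRHS](x0 0%N); exact: sball_hn.
Qed.

Lemma hn_complete (x_ : nat -> E) :
  (forall j e, 0 < e -> exists N, forall i k, (N <= i)%N -> (N <= k)%N -> hn j (x_ i - x_ k) <= e) ->
  exists x, forall j e, 0 < e -> exists N, forall i, (N <= i)%N -> hn j (x_ i - x) <= e.
Proof.
move=> xC; have [|x hx] := @sys_complete _ _ s x_.
  move=> j e e0; have [N hN] := xC j e e0; exists N => i k Ni Nk.
  exact: (sball_le (hN i k Ni Nk) (sball_hn j _)).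
exists x => j e e0; have [K K0 hK] := hn_sball j.
have [N hN] := hx j.+1 (e / K) (divr_gt0 e0 K0); exists N => i Ni.
by apply: le_trans (hK _ _ (hN i Ni)) _; rewrite mulrC divfK// gt_eqF.
Qed.

Lemma hnD j x y : hn j (x + y) <= hn j x + hn j y.
Proof. exact: ipnormD. Qed.

Lemma hnZ j a x : hn j (a *: x) = cabs a * hn j x.
Proof. exact: ipnormZ. Qed.

Lemma hnN j x : hn j (- x) = hn j x.
Proof. exact: ipnormN. Qed.

Lemma bounded_hn (B : set E) : tvs_bounded B -> forall j, exists2 M, 0 < M & forall x, B x -> hn j x <= M.
Proof.
move=> bB j; have N0 : nbhs (0 : E) [set y | hn j y < 1].
  by apply/nbhs_hnP; exists j, 1; split=> // y; rewrite subr0.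
have [t t0 H] := bB _ N0; exists t => // x Bx.
have tt : t <= cabs t%:C by rewrite cabsC ler_norm.
have [u /= u1 <-] := H _ tt _ Bx.
by rewrite hnZ cabsC gtr0_norm// ler_piMr ?ltW.
Qed.

Lemma hn_bounded (B : set E) : (forall j, exists M, forall x, B x -> hn j x <= M) -> tvs_bounded B.
Proof.
move=> H U /nbhs_hnP[j [e [e0 eU]]]; have [M hM] := H j.
exists ((`|M| + 1) / e); first by rewrite divr_gt0// ltr_wpDl.
move=> a ta x Bx; have ca : 0 < cabs a by apply: lt_le_trans ta; rewrite divr_gt0// ltr_wpDl.
have an0 : a != 0 by apply: contraTneq ca => ->; rewrite cabs0 ltxx.
exists (a^-1 *: x); last by rewrite scalerA mulfV// scale1r.
apply: eU; rewrite subr0 -(ltr_pM2l ca) -hnZ scalerA mulfV// scale1r.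
apply: (le_lt_trans (hM x Bx)); move: ta; rewrite ler_pdivrMr//.
by have := ler_norm M; lra.
Qed.

End NuclearSystemTheory.

(** * Nuclearity *)

Section RealNorm.
Context (R : realType) (V : normedModType R[i]).
Implicit Types (x y : V).

Definition rnorm x : R := complex.Re `|x|.

Lemma rnormE x : `|x| = (rnorm x)%:C.
Proof.
by have := normr_ge0 x; rewrite lecE /rnorm /=; case: `|x| => a b /= /andP[/eqP ->].
Qed.

Lemma rnorm_ge0 x : 0 <= rnorm x.
Proof. by rewrite -lecR -rnormE normr_ge0. Qed.

Lemma rnormD x y : rnorm (x + y) <= rnorm x + rnorm y.
Proof. by rewrite -lecR rmorphD /= -!rnormE ler_normD. Qed.

Lemma rnormN x : rnorm (- x) = rnorm x.
Proof. by rewrite /rnorm normrN. Qed.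

Lemma rnormB x y : rnorm (x - y) <= rnorm x + rnorm y.
Proof. by rewrite -(rnormN y) rnormD. Qed.

Lemma rnormZ a x : rnorm (a *: x) = cabs a * rnorm x.
Proof. by apply: complexI; rewrite rmorphM /= -rnormE normrZ cabsE rnormE. Qed.

Lemma rnorm0 : rnorm 0 = 0.
Proof. by rewrite /rnorm normr0. Qed.

Lemma rnorm_eq0 x : rnorm x <= 0 -> x = 0.
Proof.
move=> x0; apply/eqP; rewrite -normr_eq0 rnormE; apply/eqP; congr (_%:C).
by apply/eqP; rewrite eq_le x0 rnorm_ge0.
Qed.

Lemma rnorm_sum (I : Type) (r : seq I) (F : I -> V) :
  rnorm (\sum_(i <- r) F i) <= \sum_(i <- r) rnorm (F i).
Proof.
elim: r => [|i r ih]; first by rewrite !big_nil rnorm0.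
by rewrite !big_cons (le_trans (rnormD _ _))// lerD2l.
Qed.

Lemma nbhs_rnormP x (A : set V) :
  nbhs x A <-> exists2 e : R, 0 < e & forall y, rnorm (y - x) < e -> A y.
Proof.
split=> [/nbhs_ballP[d d0 dA]|[e e0 eA]].
  have dE : d = (complex.Re d)%:C.
    by move: d0; rewrite /= ltcE /= => /andP[/eqP + _]; case: (d) => a b /= ->.
  exists (complex.Re d); first by rewrite -ltcR -dE.
  by move=> y yx; apply: dA; rewrite -ball_normE /= distrC rnormE dE ltcR.
apply/nbhs_ballP; exists e%:C; first by rewrite /= ltcR.
by move=> y; rewrite -ball_normE /= distrC rnormE ltcR => h; exact: eA.
Qed.

(** The property shared by Banach spaces and the scalars [R[i]^o], the two kinds of target to which
    [dense_extension] is applied. *)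
Definition seq_complete := forall z : nat -> V,
  (forall e : R, 0 < e -> exists N, forall i k, (N <= i)%N -> (N <= k)%N -> rnorm (z i - z k) <= e) ->
  exists l, forall e : R, 0 < e -> exists N, forall i, (N <= i)%N -> rnorm (z i - l) <= e.

End RealNorm.

Lemma complete_seq_complete (R : realType) (V : completeNormedModType R[i]) : seq_complete V.
Proof.
move=> z zC; have cv : cvg (z @ \oo).
  apply: cauchy_cvg; apply: cauchy_exP => d d0.
  have dE : d = (complex.Re d)%:C.
    by move: d0; rewrite /= ltcE /= => /andP[/eqP + _]; case: (d) => a b /= ->.
  have e0 : 0 < complex.Re d / 2 by rewrite divr_gt0// -ltcR -dE.
  have [N hN] := zC _ e0; exists (z N); exists N => // i /= Ni.
  rewrite -ball_normE /= rnormE dE ltcR (le_lt_trans (hN N i (leqnn _) Ni))//.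
  by lra.
exists (lim (z @ \oo)) => e e0.
have : nbhs (lim (z @ \oo)) [set y | rnorm (y - lim (z @ \oo)) < e] by apply/nbhs_rnormP; exists e.
by move=> /cv [N _ hN]; exists N => i Ni; apply/ltW/hN.
Qed.

Lemma complex_seq_complete (R : realType) : seq_complete R[i]^o.
Proof.
have rE (z : R[i]^o) : rnorm z = cabs z by apply: complexI; rewrite -rnormE cabsE.
move=> z zC.
have part (f : R[i] -> R) : (forall x y, f (x - y) = f x - f y) -> (forall x, `|f x| <= cabs x) ->
    exists l : R, (fun i => f (z i)) @ \oo --> l.
  move=> fB fle; apply/(@cvg_ex R).
  apply: cauchy_cvg; apply: cauchy_exP => e e0.
  have e20 : 0 < e / 2 by rewrite divr_gt0.
  have [N hN] := zC _ e20; exists (f (z N)), N => // i /= Ni.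
  rewrite /ball /= -fB (le_lt_trans (fle _))// -rE (le_lt_trans (hN N i (leqnn _) Ni))//; lra.
have [a /cvgn_epsP ha] := part (@complex.Re R) (fun x y => ltac:(by case: x => ? ?; case: y)) (@Re_le_cabs R).
have [c /cvgn_epsP hc] := part (@complex.Im R) (fun x y => ltac:(by case: x => ? ?; case: y)) (@Im_le_cabs R).
exists (a +i* c) => e e0; have e20 : 0 < e / 2 by rewrite divr_gt0.
have [N hN] := ha _ e20; have [N' hN'] := hc _ e20.
exists (maxn N N') => i; rewrite geq_max => /andP[Ni N'i].
rewrite rE (le_trans (cabs_le_ReIm _))// [leRHS]splitr lerD//.
  by have := hN i Ni; rewrite distrC; case: (z i).
by have := hN' i N'i; rewrite distrC; case: (z i).
Qed.

Section DenseExtension.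
Context (R : realType) (V : lmodType R[i]) (q : V -> R) (F : normedModType R[i]) (j : {linear V -> F}).
Hypothesis jq : forall x, `|j x| = (q x)%:C.
Hypothesis jd : dense (range j).

Let rj x : rnorm (j x) = q x.
Proof. by apply: complexI; rewrite -rnormE jq. Qed.

Lemma dense_approx y (e : R) : 0 < e -> exists x, rnorm (j x - y) < e.
Proof.
move=> e0; pose O := ([set z | rnorm (z - y) < e] : set F)^°.
have yO : O y by apply/nbhs_rnormP; exists e.
have [z [Oz [x _ xz]]] := jd (ex_intro _ y yO) (@open_interior _ _).
by exists x; rewrite xz; exact: (interior_subset Oz).
Qed.

Lemma linear_pack (U W : lmodType R[i]) (f : U -> W) : linear f ->
  exists T : {linear U -> W}, forall x, T x = f x.
Proof.
by move=> lf; exists (HB.pack_for {linear U -> W} f (GRing.isLinear.Build R[i] U W *:%R f lf)).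
Qed.

(** T y is the limit of u along points whose images tend to y. The estimate [key] determines T y up
    to any error, and linearity, the extension property and the norm bound all follow from it. *)
Lemma dense_extension (H : normedModType R[i]) (u : V -> H) : seq_complete H ->
  linear u -> (forall x, rnorm (u x) <= q x) ->
  exists T : {linear F -> H}, (forall x, T (j x) = u x) /\ forall y, rnorm (T y) <= rnorm y.
Proof.
move=> Hc ul uq.
have uB x y : u (x - y) = u x - u y.
  by rewrite addrC -scaleN1r ul scaleN1r addrC.
have /choice[a Ha] : forall yn : F * nat, exists x, rnorm (j x - yn.1) < yn.2.+1%:R^-1.
  by move=> [y n]; apply: dense_approx; rewrite invr_gt0 ltr0n.
have small (e : R) : 0 < e -> exists N, forall n, (N <= n)%N -> n.+1%:R^-1 <= e.
  by move=> /invS_small[N hN]; exists N => n /hN/ltW.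
have dist x y : rnorm (u x - u y) <= rnorm (j x - j y).
  by rewrite -uB -linearB rj.
have lim y : exists l, forall e : R, 0 < e -> exists N, forall n, (N <= n)%N -> rnorm (u (a (y, n)) - l) <= e.
  apply: Hc => e e0; have e20 : 0 < e / 2 by rewrite divr_gt0.
  have [N hN] := small _ e20; exists N => i k Ni Nk.
  apply: le_trans (dist _ _) _.
  have -> : j (a (y, i)) - j (a (y, k)) = (j (a (y, i)) - y) - (j (a (y, k)) - y).
    by rewrite opprB addrA subrK.
  rewrite (le_trans (rnormB _ _))// [leRHS]splitr lerD//.
    exact: le_trans (ltW (Ha (y, i))) (hN i Ni).
  exact: le_trans (ltW (Ha (y, k))) (hN k Nk).
have /choice[T HT] := lim.
have key x y : rnorm (u x - T y) <= rnorm (j x - y).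
  apply/ler_addgt0Pr => e e0; have e20 : 0 < e / 2 by rewrite divr_gt0.
  have [N hN] := small _ e20; have [N' hN'] := HT y _ e20.
  pose n := maxn N N'; have h1 := hN n (leq_maxl _ _); have h2 := hN' n (leq_maxr _ _).
  have -> : u x - T y = (u x - u (a (y, n))) + (u (a (y, n)) - T y) by rewrite addrA subrK.
  apply: le_trans (rnormD _ _) _; apply: le_trans (lerD (dist _ _) h2) _.
  have -> : j x - j (a (y, n)) = (j x - y) - (j (a (y, n)) - y) by rewrite opprB addrA subrK.
  have := rnormB (j x - y) (j (a (y, n)) - y); have := lt_le_trans (Ha (y, n)) h1 => /= h3 h4.
  by move: h3 h4; set A1 := rnorm (j x - y - _); lra.
have Tlin : linear T.
  move=> c y y'; apply/eqP; rewrite -subr_eq0; apply/eqP/rnorm_eq0/ler_addgt0Pr => e e0; rewrite add0r.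
  have c0 := cabs_ge0 c; have d0 : 0 < e / (2 * (cabs c + 1)) by rewrite divr_gt0// mulr_gt0// ltr_wpDl.
  set d := e / _ in d0; have [x xy] := dense_approx y d0; have [x' xy'] := dense_approx y' d0.
  have h1 : rnorm (u (c *: x + x') - T (c *: y + y')) <= cabs c * d + d.
    apply: le_trans (key _ _) _; rewrite linearP.
    have -> : c *: j x + j x' - (c *: y + y') = c *: (j x - y) + (j x' - y').
      by rewrite scalerBr opprD addrACA.
    apply: le_trans (rnormD _ _) _; rewrite rnormZ lerD ?ler_wpM2l ?(ltW xy) ?(ltW xy')//.
  have h2 : rnorm (u (c *: x + x') - (c *: T y + T y')) <= cabs c * d + d.
    rewrite ul; have -> : c *: u x + u x' - (c *: T y + T y') = c *: (u x - T y) + (u x' - T y').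
      by rewrite scalerBr opprD addrACA.
    apply: le_trans (rnormD _ _) _; rewrite rnormZ lerD ?ler_wpM2l//; exact: le_trans (key _ _) (ltW _).
  have -> : T (c *: y + y') - (c *: T y + T y') =
     (u (c *: x + x') - (c *: T y + T y')) - (u (c *: x + x') - T (c *: y + y')).
    by rewrite opprB (addrC (_ - _)) addrA subrK.
  apply: le_trans (rnormB _ _) _; apply: le_trans (lerD h2 h1) _.
  rewrite le_eqVlt; apply/orP; left; apply/eqP; rewrite /d; field.
  by rewrite gt_eqF// ltr_wpDl.
have [T' T'E] := linear_pack Tlin.
exists T'; split=> [x|y].
  rewrite T'E; apply/eqP; rewrite eq_sym -subr_eq0; apply/eqP/rnorm_eq0.
  by have := key x (j x); rewrite subrr rnorm0.
rewrite T'E; have := key 0 y; rewrite linear0 sub0r rnormN.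
have -> : u 0 = 0 by have := uB 0 0; rewrite !subrr.
by rewrite sub0r rnormN.
Qed.

End DenseExtension.

Section Nuclear.
Context (R : realType) (E : tvsType R[i]) (s : nuclear_system E).

(** At x = d the hypothesis bounds h_j(d)^2 by K h_j(d). *)
Lemma hn_le_dual j (d : E) K : 0 <= K ->
  (forall x, `|sys_ip s j x d| <= K * hn s j x) -> hn s j d <= K.
Proof.
move=> K0 h; have := le_trans (ler_norm _) (h d); rewrite -ipnorm_sqr -/(hn s j d) expr2.
have := hn_ge0 s j d; rewrite le_eqVlt => /orP[/eqP <-//|d0].
by rewrite ler_pM2r.
Qed.

Lemma seminorm_hn (p : E -> R) : continuous_seminorm p ->
  exists j C, 0 < C /\ forall x, p x <= C * hn s j x.
Proof.
move=> [[pD pZ] pc].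
have pZ' a x : p (a *: x) = cabs a * p x by apply: pZ; rewrite inE.
have p0 : p 0 = 0 by rewrite -(scale0r (0 : E)) pZ' cabs0 mul0r.
have : nbhs (0 : E) [set x | p x < 1].
  apply: (pc 0 [set t | t < 1]); rewrite p0; exact: (@lt_nbhsl _ 0 1).
move=> /(nbhs_hnP s)[j [e [e0 H]]]; exists j, (2 / e); split; first exact: divr_gt0.
move=> x; apply/ler_addgt0Pr => d d0; have h0 := hn_ge0 s j x.
(* The summand d e / 2 keeps the denominator positive when the seminorm of x is 0, and it
   contributes exactly d to the final bound 2 c / e. *)
pose c := hn s j x + d * e / 2.
have c0 : 0 < c by rewrite ltr_wpDl// divr_gt0// mulr_gt0.
pose t := e / (2 * c); have t0 : 0 < t by rewrite divr_gt0// mulr_gt0.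
have : p (t%:C *: x) < 1.
  apply: H; rewrite subr0 hnZ cabsC gtr0_norm// /t.
  have -> : e / (2 * c) * hn s j x = e * (hn s j x / (2 * c)) by field; rewrite gt_eqF.
  rewrite gtr_pMr// ltr_pdivrMr ?mulr_gt0// mul1r.
  have : 0 < d * e / 2 by rewrite divr_gt0// mulr_gt0.
  rewrite /c; lra.
rewrite pZ' cabsC gtr0_norm// -ltr_pdivlMl// mulr1 => /ltW/le_trans; apply.
rewrite le_eqVlt; apply/orP; left; apply/eqP; rewrite /t /c; field.
by rewrite !gt_eqF// ltr_wpDl ?mulr_ge0// mulr_gt0.
Qed.

Lemma hn_continuous_seminorm j C : 0 < C -> continuous_seminorm (fun x => C * hn s j x).
Proof.
move=> C0; split.
  split=> [x y _ _|a x _]; first by rewrite -mulrDr ler_pM2l// hnD.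
  by rewrite hnZ mulrCA.
move=> x A /nbhs_ballP[e e0 eA].
apply/(nbhs_hnP s); exists j, (e / C); split; first exact: divr_gt0.
move=> y yx; apply: eA; rewrite /ball /= -mulrBr normrM gtr0_norm//.
rewrite mulrC -ltr_pdivlMr//; apply: le_lt_trans yx.
rewrite ler_norml; apply/andP; split.
  rewrite lerNl opprB lerBlDr -{1}(subrK x y); exact: hnD.
by rewrite lerBlDr -(hnN s j (y - x)) opprB -{1}(subrK y x); exact: hnD.
Qed.

(** psi stands in for the m-th unit vector of the weighted sequence space, which represents this
    functional exactly but may not come from E. *)
Lemma delta_riesz j m e : 0 < e -> exists psi, forall x,
  `|om s j m ^+ 2 * complex.Re (lam s m x) - sys_ip s j x psi| <= e * hn s j x.
Proof.
move=> e0; apply: (approx_riesz (l := fun x => om s j m ^+ 2 * complex.Re (lam s m x)) (K := om s j m)) => //.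
- by move=> x y; rewrite lamD ReD mulrDr.
- by move=> t x; rewrite lamZ ReZ mulrCA.
- move=> x; have w0 := om_gt0 s j m.
  rewrite normrM normrX (gtr0_norm w0) expr2 -mulrA ler_pM2l//.
  apply: le_trans (sball_hn s j x m); rewrite ler_pM2l//; exact: Re_le_cabs.
Qed.

(** On E, jp phi is the sum of the lam m phi y m, where y m is the image in Fp of the m-th unit
    vector, of norm at most C om j m. Multiplied by C om (j + 1) m, lam m extends to Fq with norm at
    most 1. The quotient of the two weights is the summable [ratio]. *)
Lemma nuclear_system_nuclear : nuclear_space E.
Proof.
move=> p pc; have [j [C [C0 pC]]] := seminorm_hn pc.
have [[pD pZ] _] := pc.
exists (fun x => C * hn s j.+1 x); split.
- exact: hn_continuous_seminorm.
- by move=> x; rewrite (le_trans (pC x))// ler_pM2l// hn_mono.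
move=> Fp Fq jp jq [jpE jpd] [jqE jqd].
have rjp x : rnorm (jp x) = p x by apply: complexI; rewrite -rnormE jpE.
have rjq x : rnorm (jq x) = C * hn s j.+1 x by apply: complexI; rewrite -rnormE jqE.
have Fc := @complete_seq_complete R Fp.
have [T [TE Tle]] := @dense_extension _ _ _ _ jq jqE jqd Fp jp Fc (fun a x y => linearP jp a x y)
  (fun x => ltac:(by rewrite rjp (le_trans (pC x))// ler_pM2l// hn_mono)).
exists T; split=> //.
(* The coordinate functionals need not have exact representers in E; the near-representers converge in Fp. *)
have e0 t : 0 < (t.+1%:R^-1 : R) by rewrite invr_gt0 ltr0n.
have /choice[ps Hps] : forall mt : nat * nat, exists psi, forall x,
    `|om s j mt.1 ^+ 2 * complex.Re (lam s mt.1 x) - sys_ip s j x psi| <= mt.2.+1%:R^-1 * hn s j x.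
  by move=> [m t]; exact: delta_riesz.
(* Both vectors nearly represent the same functional, so their difference is small against every x
   and [hn_le_dual] applies. *)
have psd m t t' : hn s j (ps (m, t) - ps (m, t')) <= t.+1%:R^-1 + t'.+1%:R^-1.
  apply: hn_le_dual => [|x]; first by rewrite addr_ge0// ltW.
  rewrite ipBr mulrDl; have h1 := Hps (m, t) x; have h2 := Hps (m, t') x.
  set l := _ ^+ 2 * _ in h1 h2.
  have -> : sys_ip s j x (ps (m, t)) - sys_ip s j x (ps (m, t')) =
    (l - sys_ip s j x (ps (m, t'))) - (l - sys_ip s j x (ps (m, t))) by ring.
  by rewrite (le_trans (ler_normB _ _))// addrC lerD.
have psn m t : hn s j (ps (m, t)) <= om s j m + t.+1%:R^-1.
  have w0 := om_gt0 s j m.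
  apply: hn_le_dual => [|x]; first by rewrite addr_ge0// ltW.
  have h1 := Hps (m, t) x.
  have h2 : `|om s j m ^+ 2 * complex.Re (lam s m x)| <= om s j m * hn s j x.
    rewrite normrM normrX (gtr0_norm w0) expr2 -mulrA ler_pM2l//.
    by apply: le_trans (sball_hn s j x m); rewrite ler_pM2l//; exact: Re_le_cabs.
  set l := om s j m ^+ 2 * _ in h1 h2.
  have -> : sys_ip s j x (ps (m, t)) = l - (l - sys_ip s j x (ps (m, t))) by ring.
  by rewrite mulrDl (le_trans (ler_normB _ _))// lerD.
have small (e : R) : 0 < e -> exists N, forall n, (N <= n)%N -> n.+1%:R^-1 <= e.
  by move=> /invS_small[N hN]; exists N => n /hN/ltW.
have pCr x : rnorm (jp x) <= C * hn s j x by rewrite rjp.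
have /choice[y Hy] : forall m, exists l, forall e : R, 0 < e -> exists N, forall t, (N <= t)%N -> rnorm (jp (ps (m, t)) - l) <= e.
  move=> m; apply: Fc => e e1; have e2 : 0 < e / (2 * C) by rewrite divr_gt0// mulr_gt0.
  have [N hN] := small _ e2; exists N => i k Ni Nk; rewrite -linearB (le_trans (pCr _))//.
  apply: (@le_trans _ _ (C * (e / (2 * C) + e / (2 * C)))).
    by rewrite ler_pM2l// (le_trans (psd _ _ _))// lerD// hN.
  by rewrite le_eqVlt; apply/orP; left; apply/eqP; field; rewrite gt_eqF.
have ydist m t : rnorm (jp (ps (m, t)) - y m) <= C * t.+1%:R^-1.
  apply/ler_addgt0Pr => e e1; have e20 : 0 < e / 2 by rewrite divr_gt0.
  have e2 : 0 < e / (2 * C) by rewrite divr_gt0// mulr_gt0.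
  have [N hN] := Hy m _ e20; have [N' hN'] := small _ e2; pose k := maxn N N'.
  have h1 := hN k (leq_maxl _ _); have h2 := hN' k (leq_maxr _ _).
  have -> : jp (ps (m, t)) - y m = (jp (ps (m, t)) - jp (ps (m, k))) + (jp (ps (m, k)) - y m).
    by rewrite addrA subrK.
  apply: le_trans (rnormD _ _) _; rewrite -linearB.
  have h3 : rnorm (jp (ps (m, t) - ps (m, k))) <= C * (t.+1%:R^-1 + e / (2 * C)).
    by rewrite (le_trans (pCr _))// ler_pM2l// (le_trans (psd _ _ _))// lerD2l.
  apply: le_trans (lerD h3 h1) _; rewrite le_eqVlt; apply/orP; left; apply/eqP.
  move: (t.+1%:R^-1 : R) => t1; field.
  by rewrite gt_eqF.
have yn m : rnorm (y m) <= C * om s j m.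
  apply/ler_addgt0Pr => e e1; have e2 : 0 < e / (2 * C) by rewrite divr_gt0// mulr_gt0.
  have [N hN] := small _ e2; have h := hN N (leqnn _).
  have -> : y m = jp (ps (m, N)) - (jp (ps (m, N)) - y m) by rewrite opprB addrC subrK.
  apply: le_trans (rnormB _ _) _; apply: le_trans (lerD (pCr _) (ydist m N)) _.
  have h1 := psn m N.
  have : C * hn s j (ps (m, N)) <= C * (om s j m + e / (2 * C)).
    by rewrite ler_pM2l// (le_trans h1)// lerD2l.
  have : C * N.+1%:R^-1 <= C * (e / (2 * C)) by rewrite ler_pM2l.
  have -> : C * (e / (2 * C)) = e / 2 by field; rewrite gt_eqF.
  have -> : C * (om s j m + e / (2 * C)) = C * om s j m + e / 2 by field; rewrite gt_eqF.
  move: (N.+1%:R^-1 : R) => u1; lra.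
have rE (z : R[i]^o) : rnorm z = cabs z by apply: complexI; rewrite -rnormE cabsE.
have /choice[a Ha] : forall m, exists a : {linear Fq -> R[i]^o},
    (forall x, a (jq x) = (C * om s j.+1 m)%:C * lam s m x) /\ forall z, rnorm (a z) <= rnorm z.
  move=> m; have w0 := om_gt0 s j.+1 m.
  apply: (@dense_extension _ _ _ _ jq jqE jqd R[i]^o (fun x => (C * om s j.+1 m)%:C * lam s m x)).
  - exact: complex_seq_complete.
  - move=> c x x'; rewrite lamD lamZ mulrDr; congr (_ + _); exact: mulrCA.
  - move=> x; rewrite rE cabsM cabsC gtr0_norm ?mulr_gt0// -mulrA ler_pM2l//.
    exact: sball_hn.
pose yy m := ((C * om s j m)^-1)%:C *: y m.
have yy1 m : rnorm (yy m) <= 1.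
  have w0 : 0 < C * om s j m by rewrite mulr_gt0// om_gt0.
  by rewrite rnormZ cabsC gtr0_norm ?invr_gt0// ler_pdivrMl// mulr1.
exists (fun m => (ratio s j m)%:C), a, yy; split.
- have [K hK] := om_sum s j; apply: (bounded_series_cvgn (B := K)) => [m|M]; first exact: cabs_ge0.
  by under eq_bigr do rewrite cabsC ger0_norm ?ratio_ge0//.
- by move=> m x; rewrite rnormE [leRHS]rnormE lecR; exact: (Ha m).2.
- by move=> m; rewrite rnormE -[1](_ : (1 : R)%:C = _)// lecR.
move=> x.
pose S M z := \sum_(m < M) ((ratio s j m)%:C * a m z) *: yy m.
have [K0 hK0] := om_sum s j.
have K00 : 0 <= K0 by have := hK0 0%N; rewrite big_ord0.
have Sle M z : rnorm (S M z) <= K0 * rnorm z.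
  apply: le_trans (rnorm_sum _ _) _; apply: le_trans (ler_wpM2r (rnorm_ge0 z) (hK0 M)).
  rewrite mulr_suml ler_sum// => m _; rewrite rnormZ cabsM cabsC ger0_norm ?ratio_ge0//.
  rewrite -mulrA ler_wpM2l ?ratio_ge0// -[leRHS]mulr1 ler_pM ?cabs_ge0 ?rnorm_ge0// -rE.
  exact: (Ha m).2.
have SB M z z' : S M (z - z') = S M z - S M z'.
  by rewrite /S -sumrB; apply: eq_bigr => m _; rewrite linearB mulrBr scalerBl.
have Sj M phi : S M (jq phi) = \sum_(m < M) lam s m phi *: y m.
  apply: eq_bigr => m _; rewrite (Ha m).1 /yy scalerA; congr (_ *: _).
  rewrite mulrA mulrC mulrA -!rmorphM /= mulrA.
  rewrite (_ : (C * om s j m)^-1 * ratio s j m * (C * om s j.+1 m) = 1) ?mul1r//.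
  by rewrite /ratio; field; rewrite !gt_eqF ?om_gt0.
(* On the image of E the truncation error has two parts: the tail of the inner product series, small
   by [ratio_tail], and the error of the near-representers, which for fixed M vanishes as t
   grows. *)
have Scv phi e : 0 < e -> exists N, forall M, (N <= M)%N -> rnorm (jp phi - S M (jq phi)) <= e.
  move=> e1; have [b phib] := sball_absorb s j.+1 phi; have b0 := sball_ge0 phib.
  have tau0 : 0 < e / (C * (b + 1)) by rewrite divr_gt0// mulr_gt0// ltr_wpDl.
  have [N hN] := ratio_tail s j tau0; exists N => M NM; rewrite Sj.
  set tau := e / (C * (b + 1)) in hN tau0.
  have tail x' : `|sys_ip s j x' phi - \sum_(m < M) ipterm s j x' phi m| <= hn s j x' * (b * tau).
    have le_t m : `|ipterm s j x' phi m| <= hn s j x' * b * ratio s j m.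
      apply: le_trans (ipterm_le_mul _ _ _ _ _) _; rewrite -(mulrA (hn s j x')) (mulrC b).
      apply: ler_pM; rewrite ?mulr_ge0 ?cabs_ge0 ?(ltW (om_gt0 _ _ _))//.
        exact: sball_hn.
      exact: sball_term.
    apply: (abs_series_tail (M := fun m => hn s j x' * b * ratio s j m) (B := hn s j x' * b * K0) le_t).
    - by move=> L; rewrite -mulr_sumr ler_wpM2l ?hK0 ?mulr_ge0 ?hn_ge0.
    - exact: ipfun_cvg.
    - move=> L; rewrite -mulr_sumr mulrA ler_wpM2l ?mulr_ge0 ?hn_ge0//.
      have [ML|/ltnW LM] := leqP M L; last by rewrite big_geq// ltW.
      apply: le_trans (hN L); rewrite [leRHS](big_cat_nat NM ML) /= lerDr sumr_ge0// => i _.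
      exact: ratio_ge0.
  pose A := \sum_(m < M) cabs (lam s m phi).
  have A0 : 0 <= A by apply: sumr_ge0 => m _; exact: cabs_ge0.
  have main t : rnorm (jp phi - \sum_(m < M) lam s m phi *: y m) <= C * (b * tau) + 2 * C * A * t.+1%:R^-1.
    pose D := phi - \sum_(m < M) lam s m phi *: ps (nat_of_ord m, t).
    have hD : hn s j D <= b * tau + A * t.+1%:R^-1.
      apply: hn_le_dual => [|x']; first by rewrite addr_ge0// mulr_ge0// ltW.
      rewrite ipBr ip_sum_r.
      have -> : sys_ip s j x' phi - \sum_(m < M) sys_ip s j x' (lam s m phi *: ps (nat_of_ord m, t)) =
         (sys_ip s j x' phi - \sum_(m < M) ipterm s j x' phi m) +
         \sum_(m < M) (ipterm s j x' phi m - sys_ip s j x' (lam s m phi *: ps (nat_of_ord m, t))).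
        by rewrite sumrB; ring.
      rewrite mulrDl (le_trans (ler_normD _ _))// lerD//; first by rewrite mulrC.
      apply: le_trans (ler_norm_sum _ _ _) _; rewrite /A !mulr_suml ler_sum// => m _.
      rewrite ip_adj; have := Hps (nat_of_ord m, t) ((lam s m phi)^* *: x').
      rewrite lamZ hnZ cabs_conj /= (mulrC (_^*)) => /le_trans; apply.
      by rewrite le_eqVlt; apply/orP; left; apply/eqP; ring.
    have -> : jp phi - \sum_(m < M) lam s m phi *: y m =
        jp D + \sum_(m < M) lam s m phi *: (jp (ps (nat_of_ord m, t)) - y m).
      rewrite /D linearB (linear_sum jp).
      under [X in _ = _ + X]eq_bigr do rewrite scalerBr.
      rewrite sumrB addrA; congr (_ - _).
      by under eq_bigr do rewrite linearZ; rewrite subrK.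
    apply: le_trans (rnormD _ _) _.
    have h1 : rnorm (jp D) <= C * (b * tau + A * t.+1%:R^-1) by rewrite (le_trans (pCr _))// ler_pM2l.
    have h2 : rnorm (\sum_(m < M) lam s m phi *: (jp (ps (nat_of_ord m, t)) - y m)) <= A * (C * t.+1%:R^-1).
      apply: le_trans (rnorm_sum _ _) _; rewrite /A mulr_suml ler_sum// => m _.
      by rewrite rnormZ ler_wpM2l ?cabs_ge0.
    apply: le_trans (lerD h1 h2) _; rewrite le_eqVlt; apply/orP; left; apply/eqP; ring.
  apply: (@le_trans _ _ (C * (b * tau))).
    apply/ler_addgt0Pr => d d0; have d1 : 0 < d / (2 * C * A + 1) by rewrite divr_gt0// ltr_wpDl// !mulr_ge0// ltW.
    have [t ht] := small _ d1; apply: le_trans (main t) _; rewrite lerD2l.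
    have := ht t (leqnn _); rewrite ler_pdivlMr; last by rewrite ltr_wpDl// !mulr_ge0// ltW.
    by have := ltW (e0 t); set u := _^-1; lra.
  rewrite /tau; have -> : C * (b * (e / (C * (b + 1)))) = e * (b / (b + 1)).
    by field; rewrite !gt_eqF// ltr_wpDl.
  by rewrite ler_piMr ?(ltW e1)// ler_pdivrMr ?ltr_wpDl// mul1r lerDl.
have Tcv e : 0 < e -> exists N, forall M, (N <= M)%N -> rnorm (S M x - T x) < e.
  (* Three errors d, K0 d and d add up to e / 2: density seen through T, density seen through the
     partial sums with their uniform bound [Sle], and [Scv]. *)
  move=> e1; have d0 : 0 < e / (2 * (K0 + 2)) by rewrite divr_gt0// mulr_gt0// ltr_wpDl.
  set d := e / _ in d0.
  have [phi xphi] := dense_approx jqd x d0; have [N hN] := Scv phi d d0.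
  exists N => M NM; have h := hN M NM.
  have -> : S M x - T x = (T (jq phi - x) - S M (jq phi - x)) - (jp phi - S M (jq phi)).
    rewrite linearB SB TE !opprB -addrA [S M x - _ + _]addrA subrK.
    by rewrite addrC addrA subrK.
  apply: le_lt_trans (rnormB _ _) _; apply: le_lt_trans (lerD (rnormB _ _) h) _.
  have h1 := Tle (jq phi - x); have h2 := Sle M (jq phi - x).
  have h3 : K0 * rnorm (jq phi - x) <= K0 * d by rewrite ler_wpM2l// ltW.
  have h4 : d * (2 * (K0 + 2)) = e by rewrite /d divfK// gt_eqF// mulr_gt0// ltr_wpDl.
  have := rnorm_ge0 (jq phi - x); nra.
move=> A /nbhs_rnormP[e e1 eA]; have [N hN] := Tcv e e1.
by exists N => // M /= NM; apply: eA; rewrite seriesEord; exact: hN.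
Qed.

End Nuclear.

(** * Completeness, compactness and separability *)

Section NuclearSystemTopology.
Context (R : realType) (E : tvsType R[i]) (s : nuclear_system E).

Lemma hn_small_eq x y : (forall j e, 0 < e -> hn s j (x - y) <= e) -> x = y.
Proof.
move=> H; apply: subr0_eq; apply: (hn_eq0 (s := s)) => j; apply/eqP.
rewrite eq_le hn_ge0 andbT; apply/ler_addgt0Pr => e e0; rewrite add0r; exact: H.
Qed.

Lemma hn_tri j x y z : hn s j (x - y) <= hn s j (x - z) + hn s j (z - y).
Proof. by rewrite -(subrKA z) hnD. Qed.

Lemma hn_distC j x y : hn s j (x - y) = hn s j (y - x).
Proof. by rewrite -hnN opprB. Qed.

Lemma filter_hn (F : set_system E) (FF : Filter F) (x : E) :
  (forall j e, 0 < e -> F [set y | hn s j (y - x) < e]) -> F --> x.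
Proof. by move=> H A /(nbhs_hnP s)[j [e [e0 eA]]]; exact: filterS (H j e e0). Qed.

(** A centre y k for the seminorm h_k and the radius 1 / (k + 1) replaces the filter by a Cauchy
    sequence, since any two of these balls meet. This serves both completeness and compactness. *)
Lemma hn_cauchy_filter (F : set_system E) : ProperFilter F ->
  (forall j e, 0 < e -> exists y, F [set z | hn s j (z - y) < e]) -> exists x : E, F --> x.
Proof.
move=> FF H; have e0 t : 0 < (t.+1%:R^-1 : R) by rewrite invr_gt0 ltr0n.
have /choice[y Hy] k := H k _ (e0 k).
have [|x Hx] := @hn_complete _ _ s y.
  move=> j e e1; have e2 : 0 < e / 2 by rewrite divr_gt0.
  have [N hN] := invS_small e2; exists (maxn j N) => i k.
  rewrite !geq_max => /andP[ji Ni] /andP[jk Nk].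
  have [z [/= zi zk]] := filter_ex (filterI (Hy i) (Hy k)).
  apply: le_trans (hn_tri _ _ _ z) _; rewrite [leRHS]splitr lerD//.
    rewrite hn_distC; apply: le_trans (hn_homo _ _ ji) _.
    exact: ltW (lt_trans zi (hN _ Ni)).
  apply: le_trans (hn_homo _ _ jk) _; exact: ltW (lt_trans zk (hN _ Nk)).
exists x; apply: filter_hn => j e e1; have e2 : 0 < e / 2 by rewrite divr_gt0.
have [N hN] := invS_small e2; have [N' hN'] := Hx j _ e2.
pose k := maxn j (maxn N N').
apply: filterS (Hy k) => z /= zk; apply: le_lt_trans (hn_tri _ _ _ (y k)) _.
rewrite [ltRHS]splitr ltr_leD//.
  apply: le_lt_trans (hn_homo _ _ (leq_maxl j _)) (lt_trans zk (hN _ _)).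
  by rewrite /k !leq_max leqnn !orbT.
by apply: hN'; rewrite /k !leq_max leqnn !orbT.
Qed.

Lemma nuclear_system_frechet :
  (forall A : set (E * E), entourage A <->
     exists U, nbhs (0 : E) U /\ forall xy, U (xy.1 - xy.2) -> A xy) ->
  frechet_space E.
Proof.
move=> entP; have entB j e : 0 < e -> entourage [set xy : E * E | hn s j (xy.1 - xy.2) < e].
  move=> e0; apply/entP; exists [set z | hn s j z < e]; split=> //.
  by apply/(nbhs_hnP s); exists j, e; split=> // y; rewrite subr0.
split.
- move=> p q pq; apply: hn_small_eq => j e e0; have e2 : 0 < e / 2 by rewrite divr_gt0.
  have N x : nbhs x [set y | hn s j (y - x) < e / 2] by apply/(nbhs_hnP s); exists j, (e / 2).
  have [z [/= zp zq]] := pq _ _ (N p) (N q).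
  apply: le_trans (hn_tri _ _ _ z) _; rewrite [leRHS]splitr hn_distC; exact: lerD (ltW _) (ltW _).
- apply/countable_uniformityP.
  have e0 t : 0 < (t.+1%:R^-1 : R) by rewrite invr_gt0 ltr0n.
  exists (fun k => [set xy : E * E | hn s k (xy.1 - xy.2) < k.+1%:R^-1]) => [A|k]; last exact: entB.
  move=> /entP[U [/(nbhs_hnP s)[j [e [e1 eU]]] UA]].
  have [N hN] := invS_small e1; exists (maxn j N) => -[x y] /= h; apply: UA; apply: eU; rewrite subr0.
  exact: le_lt_trans (hn_homo _ _ (leq_maxl j N)) (lt_trans h (hN _ (leq_maxr _ _))).
- move=> F FF Fc; apply: hn_cauchy_filter => j e e0.
  have [[A B] /= [FA FB] AB] := Fc _ (entB j e e0).
  have [y By] := filter_ex FB; exists y; apply: filterS FA => z Az; exact: (AB (z, y)).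
Qed.

Lemma ultra_bounded_cvg (F : set_system E) (B : set E) (f : E -> R) K : UltraFilter F -> F B ->
  (forall x, B x -> `|f x| <= K) -> exists c : R, forall e, 0 < e -> F [set x | `|f x - c| < e].
Proof.
move=> UF FB fK; have := @segment_compact R (- K) K; move=> /(_ (f @ F) _)[|c [_ cF]].
  by apply: (@filterS _ F _ _ _ _ FB) => x /fK; rewrite /= in_itv /= ler_norml.
exists c => e e0; have [//|nF] := in_ultra_setVsetC [set x | `|f x - c| < e] UF.
have [|t [/= nt ct]] := cF [set t | ~ `|t - c| < e] [set t | `|t - c| < e] nF.
  by apply/nbhs_ballP; exists e => //= t; rewrite /ball /= distrC.
by case: nt.
Qed.

Lemma filter_forall_lt (F : set_system E) (FF : Filter F) (P : nat -> set E) M :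
  (forall m, F (P m)) -> F [set x | forall m, (m < M)%N -> P m x].
Proof.
move=> FP; elim: M => [|M ih]; first exact: filterS filterT.
apply: filterS (filterI ih (FP M)) => x [/= xM xP] m; rewrite ltnS leq_eqVlt => /predU1P[->//|]; exact: xM.
Qed.

(** On a bounded set the coordinates from some M on are uniformly small, because the ratios tend to
    0, and each of the first M converges along an ultrafilter. So the ultrafilter is Cauchy. *)
Lemma nuclear_system_montel : montel E.
Proof.
move=> B bB cB; rewrite compact_ultra => F UF FB.
suff [x Fx] : exists x : E, F --> x.
  by exists x; split=> //; apply: cB => U Ux; exact: (@filter_ex _ F _ _ (filterI FB (Fx _ Ux))).
apply: hn_cauchy_filter => j e e0.
have [K K0 hK] := hn_sball s j; pose d := e / (2 * K).
have d0 : 0 < d by rewrite divr_gt0// mulr_gt0.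
(* Two indices above j: one is spent on passing from h_j to the supremum of index j + 1, the other
   on the factor [ratio] that makes the tail small. *)
have [b b0 Bb] := bounded_hn s bB j.+2.
have d1 : 0 < d / (2 * b) by rewrite divr_gt0// mulr_gt0.
have [M hM] := ratio_small s j.+1 d1.
have coord m : exists c, F [set x | om s j.+1 m * cabs (lam s m x - c) <= d / 2].
  have wp := om_gt0 s j.+1 m; have [b' b'0 Bb'] := bounded_hn s bB j.+1.
  have lb x : B x -> cabs (lam s m x) <= b' / om s j.+1 m.
    move=> /Bb' xb; rewrite ler_pdivlMr// mulrC; exact: le_trans (sball_hn s j.+1 x m) xb.
  have [p Hp] := ultra_bounded_cvg UF FB (fun x Bx => le_trans (Re_le_cabs (lam s m x)) (lb x Bx)).
  have [q Hq] := ultra_bounded_cvg UF FB (fun x Bx => le_trans (Im_le_cabs (lam s m x)) (lb x Bx)).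
  have t0 : 0 < d / (4 * om s j.+1 m) by rewrite divr_gt0// mulr_gt0.
  exists (p +i* q); apply: filterS (filterI (Hp _ t0) (Hq _ t0)) => x [/= xp xq].
  have : cabs (lam s m x - (p +i* q)) <= d / (4 * om s j.+1 m) + d / (4 * om s j.+1 m).
    apply: le_trans (cabs_le_ReIm _) _; move: xp xq; case: (lam s m x) => a a' /= xp xq.
    exact: lerD (ltW _) (ltW _).
  rewrite -(ler_pM2l wp) => /le_trans; apply.
  by rewrite le_eqVlt; apply/orP; left; apply/eqP; field; rewrite gt_eqF.
have /choice[c Hc] := coord.
have FF : ProperFilter F by exact: _.
have FS : F (B `&` [set x | forall m, (m < M)%N -> om s j.+1 m * cabs (lam s m x - c m) <= d / 2]).
  by apply: filterI => //; exact: (@filter_forall_lt F FF (fun m => [set x | om s j.+1 m * cabs (lam s m x - c m) <= d / 2])).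
have [y [By yM]] := filter_ex FS; exists y; apply: (@filterS _ F _ _ _ _ FS) => z [Bz zM] /=.
apply: (@le_lt_trans _ _ (K * d)); last first.
  have -> : K * d = e / 2 by rewrite /d; field; rewrite gt_eqF.
  lra.
apply: hK => m; rewrite lamB; have [mM|Mm] := ltnP m M.
  have -> : lam s m z - lam s m y = (lam s m z - c m) - (lam s m y - c m) by ring.
  rewrite [leRHS]splitr; apply: le_trans (lerD (zM m mM) (yM m mM)).
  by rewrite -mulrDr ler_pM2l ?om_gt0// cabsB.
have h x : B x -> om s j.+1 m * cabs (lam s m x) <= d / 2.
  move=> Bx; apply: le_trans (sball_term _ (sball_le (Bb x Bx) (sball_hn s j.+2 x))) _.
  apply: (@le_trans _ _ (d / (2 * b) * b)); first by rewrite ler_pM2r// hM.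
  by rewrite le_eqVlt; apply/orP; left; apply/eqP; field; rewrite gt_eqF.
rewrite [leRHS]splitr; apply: le_trans (lerD (h z Bz) (h y By)).
by rewrite -mulrDr ler_pM2l ?om_gt0// cabsB.
Qed.

Lemma complex_rat_approx (z : R[i]) (d : R) : 0 < d ->
  exists q : rat * rat, cabs (z - (ratr q.1 +i* ratr q.2)) <= d.
Proof.
move=> d0; have approx (a : R) : exists q : rat, `|a - ratr q| <= d / 2.
  have [|q] := @rat_in_itvoo R (a - d / 2) (a + d / 2); first lra.
  by rewrite in_itv /= => /andP[h1 h2]; exists q; rewrite ler_norml; apply/andP; split; lra.
case: z => a b; have [p hp] := approx a; have [q hq] := approx b.
by exists (p, q); rewrite (le_trans (cabs_le_ReIm _))// [leRHS]splitr lerD.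
Qed.

(** A code records rational approximations of the first M weighted coordinates and a bound for the
    others. There are countably many codes, and one point is chosen for each code that some point
    satisfies; two points with the same code are close. *)
Lemma nuclear_system_separable : separable E.
Proof.
pose good (t : nat * nat * nat * seq (rat * rat)) x := let: (j, M, k, q) := t in
  (forall m, (m < M)%N -> om s j m * cabs (lam s m x -
     (ratr (nth (0, 0) q m).1 +i* ratr (nth (0, 0) q m).2)) <= k.+1%:R^-1) /\
  forall m, (M <= m)%N -> om s j m * cabs (lam s m x) <= k.+1%:R^-1.
have /choice[d Hd] t : exists d, (exists x, good t x) -> good t d.
  by have [[x tx]|nt] := pselect (exists x, good t x); [exists x|exists 0].
exists (range d); first by apply: sub_countable (card_image_le _ _) (countableP _).
move=> O [x Ox] Oo; have /(sys_nbhs s)[j [e [e0 eO]]] : nbhs x O by exact: open_nbhs_nbhs.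
have e2 : 0 < e / 2 by rewrite divr_gt0.
have [k /(_ k (leqnn k)) /ltW hk] := invS_small e2.
have [b xb] := sball_absorb s j.+1 x; have b0 := sball_ge0 xb.
have t0 : 0 < (k.+1%:R^-1 : R) by rewrite invr_gt0 ltr0n.
have tb0 : 0 < k.+1%:R^-1 / (b + 1) by rewrite divr_gt0// ltr_wpDl.
have [M hM] := ratio_small s j tb0.
have /choice[q Hq] m := complex_rat_approx (lam s m x) (divr_gt0 t0 (om_gt0 s j m)).
have tx : good (j, M, k, mkseq q M) x.
  split=> m mM; first by rewrite nth_mkseq// mulrC -ler_pdivlMr ?om_gt0.
  apply: le_trans (sball_term _ xb) _; apply: le_trans (ler_wpM2r b0 (hM m mM)) _.
  rewrite -mulrA ler_piMr ?(ltW t0)// mulrC ler_pdivrMr ?mul1r; lra.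
have [d1 d2] := Hd (j, M, k, mkseq q M) (ex_intro _ x tx); have [x1 x2] := tx.
exists (d (j, M, k, mkseq q M)); split; last by exists (j, M, k, mkseq q M).
have two m u v : om s j m * cabs u <= k.+1%:R^-1 -> om s j m * cabs v <= k.+1%:R^-1 ->
    om s j m * cabs (u - v) <= e.
  move=> hu hv; rewrite [leRHS]splitr.
  apply: le_trans (lerD (le_trans hu hk) (le_trans hv hk)).
  by rewrite -mulrDr ler_pM2l ?om_gt0// cabsB.
apply: eO => m; rewrite lamB; have [mM|Mm] := ltnP m M.
  set c : R[i] := ratr (nth (0, 0) (mkseq q M) m).1 +i* ratr (nth (0, 0) (mkseq q M) m).2.
  set u := lam s m (d _).
  have -> : u - lam s m x = (u - c) - (lam s m x - c) by ring.
  by apply: two; [exact: d1|exact: x1].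
by apply: two; [exact: d2|exact: x2].
Qed.

End NuclearSystemTopology.

(** * Reflexivity *)

Section LocallyConvex.
Context (R : realType) (V : lmodType R[i]) (S : {pred V}) (I : Type)
  (p : I -> V -> R) (hS : submod_closed S) (hp : forall i, seminorm_on S (p i)).
Local Notation E := (lcspace hS hp).

Lemma lc_max_lt ss x e : 0 < e -> (lc_max p ss x < e) = all (fun i => p i x < e) ss.
Proof.
move=> e0; rewrite /lc_max; elim: ss => [|i ss ih] /=; first by rewrite big_nil.
by rewrite big_cons gt_max ih.
Qed.

Lemma lc_nbhsP (x : E) (A : set E) : nbhs x A <-> exists ss e, 0 < e /\
  forall y : E, all (fun i => p i (\val y - \val x) < e) ss -> A y.
Proof.
split=> -[ss [e [e0 H]]]; exists ss, e; split=> // y.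
  by rewrite -lc_max_lt//; exact: H.
by rewrite lc_max_lt//; exact: H.
Qed.

Lemma lc_nbhs1 (x : E) i e : 0 < e -> nbhs x [set y : E | p i (\val y - \val x) < e].
Proof. by move=> e0; apply/lc_nbhsP; exists [:: i], e; split=> //= y; rewrite andbT. Qed.

Lemma lc_seminormZ i a (x : E) : p i (\val (a *: x)) = cabs a * p i (\val x).
Proof. by rewrite GRing.valZ; apply: (hp i).2; exact: valP. Qed.

Lemma lc_boundedP (P : set E) :
  tvs_bounded P <-> forall i, exists M, forall y : E, P y -> p i (\val y) <= M.
Proof.
split=> [bP i|H U /lc_nbhsP[ss [e [e0 eU]]]].
  have [t t0 H] := bP _ (lc_nbhs1 0 i ltr01); exists t => y Py.
  have tt : t <= cabs t%:C by rewrite cabsC ler_norm.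
  have [u /= u1 <-] := H _ tt _ Py.
  rewrite lc_seminormZ cabsC gtr0_norm// ler_piMr ?(ltW t0)//.
  by apply/ltW; rewrite /= subr0 in u1.
have [M M0 HM] : exists2 M, 0 <= M & forall y : E, P y -> all (fun i => p i (\val y) <= M) ss.
  elim: ss {eU} => [|i ss [M M0 HM]]; first by exists 0.
  have [M' HM'] := H i; exists (Num.max M M') => [|y Py /=]; first by rewrite le_max M0.
  rewrite le_max HM' ?orbT//=; apply: sub_all (HM y Py) => k h.
  by rewrite le_max h.
exists ((M + 1) / e); first by rewrite divr_gt0// ltr_wpDl.
move=> a ta y Py; have ca : 0 < cabs a by apply: lt_le_trans ta; rewrite divr_gt0// ltr_wpDl.
have an0 : a != 0 by apply: contraTneq ca => ->; rewrite cabs0 ltxx.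
exists (a^-1 *: y); last by rewrite scalerA mulfV// scale1r.
apply: eU; apply: sub_all (HM y Py) => i h.
rewrite GRing.val0 subr0 -(ltr_pM2l ca) -lc_seminormZ scalerA mulfV// scale1r.
by apply: (le_lt_trans h); move: ta; rewrite ler_pdivrMr//; lra.
Qed.

End LocallyConvex.

Lemma linear_ofN (R : realType) (E : lmodType R[i]) (f : E -> R[i]^o) : linear f ->
  [/\ f 0 = 0, forall a x, f (a *: x) = a * f x, forall x y, f (x + y) = f x + f y &
      forall x y, f (x - y) = f x - f y].
Proof.
move=> lf; have f0 : f 0 = 0 by have := lf (-1) 0 0; rewrite scaleN1r addNr scaleN1r addNr.
have fZ a x : f (a *: x) = a * f x by have := lf a x 0; rewrite f0 !addr0.
have fD x y : f (x + y) = f x + f y by have := lf 1 x y; rewrite !scale1r.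
by split=> // x y; rewrite fD -scaleN1r fZ mulN1r.
Qed.

Lemma nbhs_cabsP (R : realType) (z : R[i]^o) (A : set R[i]^o) :
  nbhs z A <-> exists2 e : R, 0 < e & forall y, cabs (y - z) < e -> A y.
Proof.
have rE (y : R[i]^o) : rnorm y = cabs y by apply: complexI; rewrite -rnormE cabsE.
by split=> [/nbhs_rnormP|] [e e0 eA]; [|apply/nbhs_rnormP]; exists e => // y; have := eA y; rewrite rE.
Qed.

Section StrongDual.
Context (R : realType) (E : tvsType R[i]).
Local Notation E' := (strong_dual E).

Lemma dual_linear (f : E') : linear (\val f).
Proof. by have /asboolP[] := valP f. Qed.

Lemma dual_continuous (f : E') : continuous (\val f).
Proof. by have /asboolP[] := valP f. Qed.

Lemma cabs_continuous_seminorm (f : E -> R[i]^o) : linear f -> continuous f ->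
  continuous_seminorm (fun x => cabs (f x)).
Proof.
move=> lf cf; have [f0 fZ fD fB] := linear_ofN lf; split.
  by split=> [x y _ _|a x _]; rewrite ?fD ?fZ ?cabsD ?cabsM.
move=> x A /nbhs_ballP[e e0 eA]; have : nbhs (f x) [set z : R[i]^o | cabs (z - f x) < e] by apply/nbhs_cabsP; exists e.
move=> /(cf x) H; apply: (@filterS _ (nbhs x) _ _ _ _ H) => y /= yx; apply: eA; rewrite /ball /=; apply: le_lt_trans yx.
rewrite ler_norml; apply/andP; split.
  by rewrite lerNl opprB lerBlDr -{1}(subrK (f x) (f y)) cabsD.
by rewrite lerBlDr -(cabsN (f y - f x)) opprB -{1}(subrK (f y) (f x)) cabsD.
Qed.

Lemma sup_seminorm_ub (B : {B : set E | tvs_bounded B}) (f : E') x :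
  sval B x -> cabs (\val f x) <= sup_seminorm B (\val f).
Proof. by move=> Bx; apply: ub_le_sup; [exact: (dual_has_ubound _ (valP f))|exists x]. Qed.

Lemma sup_seminorm_le (B : {B : set E | tvs_bounded B}) (f : E -> R[i]^o) t : 0 <= t ->
  (forall x, sval B x -> cabs (f x) <= t) -> sup_seminorm B f <= t.
Proof.
move=> t0 H; have [[x Bx]|/set0P/negP/negPn/eqP B0] := pselect (sval B !=set0).
  by apply: ge_sup; [exists (cabs (f x)), x|move=> _ [y By <-]; exact: H].
by rewrite /sup_seminorm B0 (image_set0 (fun x => cabs (f x))) sup0.
Qed.

End StrongDual.

Section Reflexive.
Context (R : realType) (E : tvsType R[i]) (s : nuclear_system E).
Local Notation E' := (strong_dual E).
Local Notation E'' := (strong_dual (strong_dual E)).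
Local Notation hn := (hn s).

Lemma dual_hn_bound (f : E') : exists j C, 0 < C /\ forall x, cabs (\val f x) <= C * hn j x.
Proof. exact: seminorm_hn (cabs_continuous_seminorm (@dual_linear _ _ f) (@dual_continuous _ _ f)). Qed.

Lemma hn_dual_pred (f : E -> R[i]^o) j C : linear f -> (forall x, cabs (f x) <= C * hn j x) -> f \in dual_pred E.
Proof.
move=> lf fC; have [_ _ _ fB] := linear_ofN lf; apply/asboolP; split=> // x A /nbhs_cabsP[e e0 eA].
have C0 : 0 < `|C| + 1 by rewrite ltr_wpDl.
apply/(nbhs_hnP s); exists j, (e / (`|C| + 1)); split; first exact: divr_gt0.
move=> y; rewrite ltr_pdivlMr// => yx; apply: eA; rewrite -fB; apply: le_lt_trans (fC _) _.
apply: le_lt_trans yx; rewrite mulrC ler_wpM2l ?hn_ge0//.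
by apply: le_trans (ler_norm _) _; rewrite lerDl.
Qed.

Section RieszFunctional.
Variables (j : nat) (psi : E).

(** The complex functional with real part x -> [sys_ip s j x psi], rebuilt by f x = Re f(x) - i Re
    f(i x). *)
Definition riesz (x : E) : R[i]^o := sys_ip s j x psi +i* (- sys_ip s j ('i *: x) psi).

Lemma riesz_linear : linear riesz.
Proof.
move=> [a b] x y.
have aE : a +i* b = a%:C + b%:C * 'i :> R[i] by simpc.
have ii : 'i *: ('i *: x) = - x by rewrite scalerA -expr2 sqr_i scaleN1r.
have h1 : sys_ip s j ((a +i* b) *: x + y) psi =
    a * sys_ip s j x psi + b * sys_ip s j ('i *: x) psi + sys_ip s j y psi.
  by rewrite aE scalerDl -(scalerA b%:C) !ipD !ipZ.
have h2 : sys_ip s j ('i *: ((a +i* b) *: x + y)) psi =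
    a * sys_ip s j ('i *: x) psi - b * sys_ip s j x psi + sys_ip s j ('i *: y) psi.
  rewrite scalerDr scalerA mulrC -scalerA aE scalerDl -(scalerA b%:C) ii !ipD !ipZ ipN.
  by rewrite mulrN.
rewrite /riesz h1 h2 /GRing.scale /=; simpc; apply/eqP; rewrite eq_complex /=.
by apply/andP; split; apply/eqP; ring.
Qed.

Lemma riesz_Re x : complex.Re (riesz x) = sys_ip s j x psi. Proof. by []. Qed.

End RieszFunctional.

(** Rotating x by a phase makes f x real and nonnegative without changing p x. *)
Lemma cabs_le_phase (f : E -> R[i]^o) (p : E -> R) : linear f ->
  (forall a x, cabs a = 1 -> p (a *: x) = p x) ->
  (forall x, complex.Re (f x) <= p x) -> forall x, cabs (f x) <= p x.
Proof.
move=> lf pZ fp x; have [_ fZ _ _] := linear_ofN lf; have [u [u1 uf]] := cabs_phase (f x).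
by rewrite -(pZ u x u1); apply: le_trans (fp _); rewrite fZ uf.
Qed.

Lemma riesz_le j psi x : cabs (riesz j psi x) <= hn j psi * hn j x.
Proof.
apply: (cabs_le_phase (p := fun x => hn j psi * hn j x)) => [|a y a1|y].
- exact: riesz_linear.
- by rewrite hnZ a1 mul1r.
- by rewrite riesz_Re mulrC (le_trans (ler_norm _))// ip_CS.
Qed.

Lemma riesz_dual j psi : exists f : E', forall x, \val f x = riesz j psi x.
Proof.
by exists (exist (fun f => f \in dual_pred E) _ (hn_dual_pred (riesz_linear j psi) (riesz_le j psi))).
Qed.

(** Plays the part of the Hahn-Banach theorem: the functional represented by x itself, divided by
    the seminorm of x, or 0 if that vanishes. *)
Lemma norming_functional j x : exists f : E',
  (forall y, cabs (\val f y) <= hn j y) /\ cabs (\val f x) = hn j x.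
Proof.
have [x0|xn0] := eqVneq (hn j x) 0.
  by exists 0; split=> [y|]; rewrite (_ : \val (0 : E') _ = 0)// cabs0 ?hn_ge0.
have [g gE] := riesz_dual j x; have x0 : 0 < hn j x by rewrite lt_neqAle eq_sym xn0 hn_ge0.
have cE (y : E) : cabs (\val ((hn j x)^-1%:C *: g) y) = (hn j x)^-1 * cabs (riesz j x y).
  rewrite GRing.valZ -gE.
  by rewrite (_ : (_ *: \val g) y = (hn j x)^-1%:C * \val g y)// cabsM cabsC ger0_norm// invr_ge0 ltW.
exists ((hn j x)^-1%:C *: g); split=> [y|].
  by rewrite cE ler_pdivrMl// riesz_le.
rewrite cE; apply/eqP; rewrite eq_le; apply/andP; split; first by rewrite ler_pdivrMl// riesz_le.
rewrite ler_pdivlMl//; apply: le_trans (le_trans (ler_norm _) (Re_le_cabs _)).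
by rewrite riesz_Re -ipnorm_sqr expr2.
Qed.

Definition evalE (x : E) (f : E') : R[i]^o := \val f x.

Lemma set1_bounded (x : E) : tvs_bounded [set x].
Proof. by apply: (hn_bounded (s := s)) => j; exists (hn j x) => _ ->. Qed.

Lemma evalE_dual x : evalE x \in dual_pred E'.
Proof.
apply/asboolP; split.
  by move=> a f g; rewrite /evalE GRing.valD GRing.valZ.
move=> f A /nbhs_cabsP[e e0 eA].
have := @lc_nbhs1 R _ _ _ _ (@dual_submod_closed R E) (@sup_seminormP R E) f (exist _ _ (set1_bounded x)) e e0.
apply: filterS => g /= gf; apply: eA; apply: le_lt_trans gf.
have := @sup_seminorm_ub _ _ (exist _ _ (set1_bounded x)) (g - f) x erefl.
by rewrite GRing.valB.
Qed.

Definition bidual (x : E) : E'' := exist (fun F => F \in dual_pred E') _ (evalE_dual x).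

Lemma bidualE x (f : E') : \val (bidual x) f = \val f x. Proof. by []. Qed.

Lemma bidual_inj : injective bidual.
Proof.
move=> x y xy; apply: (hn_small_eq (s := s)) => j e e0.
have [f [_ <-]] := norming_functional j (x - y).
have [_ _ _ fB] := linear_ofN (@dual_linear _ _ f).
by rewrite fB -!bidualE xy subrr cabs0 ltW.
Qed.

Lemma hn_polar_bounded j : tvs_bounded [set f : E' | forall x, cabs (\val f x) <= hn j x].
Proof.
apply/lc_boundedP => B; have [M M0 BM] := bounded_hn s (svalP B) j; exists M => f /= fj.
by apply: sup_seminorm_le => [|x Bx]; [exact: ltW|exact: le_trans (fj x) (BM x Bx)].
Qed.

(** Continuity of F involves finitely many bounded sets. M j is a common bound of h_j on all of
    them, so they are replaced by the single set of the x with h_j x <= M j for all j. *)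
Lemma bidual_bound (F : E'') : exists (M : nat -> R) C, 0 < C /\ forall (f : E') t, 0 <= t ->
  (forall x, (forall j, hn j x <= M j) -> cabs (\val f x) <= t) -> cabs (\val F f) <= C * t.
Proof.
have lF := @dual_linear _ _ F; have [F0 FZ _ _] := linear_ofN lF.
have : nbhs (0 : E') [set f : E' | cabs (\val F f) < 1].
  apply: (@dual_continuous _ _ F 0 [set z : R[i]^o | cabs z < 1]).
  by apply/nbhs_cabsP; exists 1 => // y; rewrite F0 subr0.
move=> /lc_nbhsP[ss [e [e0 eF]]].
have /choice[M HM] : forall j, exists M, all (fun B : {B : set E | tvs_bounded B} => `[< forall x, sval B x -> hn j x <= M >]) ss.
  move=> j; elim: ss {eF} => [|B ss [M HM]]; first by exists 0.
  have [M' _ HM'] := bounded_hn s (svalP B) j; exists (Num.max M M') => /=; apply/andP; split.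
    by apply/asboolP => x Bx; rewrite le_max HM' ?orbT.
  by apply: sub_all HM => B' /asboolP h; apply/asboolP => x Bx; rewrite le_max h.
have {}HM : all (fun B : {B : set E | tvs_bounded B} => `[< forall j x, sval B x -> hn j x <= M j >]) ss.
  elim: ss HM {eF} => [//|B ss ih] HM /=; apply/andP; split.
    by apply/asboolP => j; have /= /andP[/asboolP] := HM j.
  by apply: ih => j; have /= /andP[] := HM j.
exists M, (2 / e); split; first exact: divr_gt0.
move=> f t t0 ft; apply/ler_addgt0Pr => d d0.
(* The summand d e covers the case t = 0 and costs exactly d in the end. *)
pose u := e / (2 * t + d * e); have den : 0 < 2 * t + d * e by rewrite ltr_wpDl ?mulr_ge0// mulr_gt0.
have u0 : 0 < u by exact: divr_gt0.
have : cabs (\val F (u%:C *: f)) < 1.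
  apply: eF; apply: sub_all HM => B /asboolP HB.
  rewrite GRing.val0 subr0 lc_seminormZ cabsC gtr0_norm//.
  have h : sup_seminorm B (\val f) <= t.
    apply: sup_seminorm_le => // x Bx; apply: ft => j; exact: HB.
  apply: (@le_lt_trans _ _ (u * t)); first by rewrite ler_pM2l.
  rewrite /u mulrAC ltr_pdivrMr// ltr_pM2l//.
  by have := mulr_gt0 d0 e0; lra.
rewrite FZ cabsM cabsC gtr0_norm// -ltr_pdivlMl// mulr1 => /ltW/le_trans; apply.
by rewrite le_eqVlt; apply/orP; left; apply/eqP; rewrite /u; field; rewrite !gt_eqF.
Qed.

(** F composed with x -> [riesz j x] is bounded by h_j, so some phi represents its real part up to
    eps. A functional bounded by h_j is, up to t h_j with t as small as wanted, of the form
    [riesz j psi], and F turns this into an error of order t. *)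
Lemma bidual_approx (F : E'') j eps : 0 < eps -> exists phi, forall f : E',
  (forall x, cabs (\val f x) <= hn j x) -> cabs (\val F f - \val f phi) <= eps.
Proof.
move=> e0; have [M [C [C0 FC]]] := bidual_bound F.
have lF := @dual_linear _ _ F; have [F0 FZ FD FB] := linear_ofN lF.
have /choice[g gE] := riesz_dual j.
have Mj x : (forall j, hn j x <= M j) -> 0 <= M j by move=> /(_ j); apply: le_trans; exact: hn_ge0.
pose Mp := Num.max 0 (M j).
have Mp0 : 0 <= Mp by rewrite le_max lexx.
have FM (f : E') t : 0 <= t -> (forall x, cabs (\val f x) <= t * hn j x) -> cabs (\val F f) <= C * (t * Mp).
  move=> t0 ft; apply: FC => [|x xM]; first exact: mulr_ge0.
  by apply: le_trans (ft x) _; rewrite ler_wpM2l// le_max xM orbT.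
(* [riesz] is conjugate linear in its vector, so g is additive and commutes with real scalars; this
   is the linearity that [approx_riesz] asks for. *)
have gD x y : g (x + y) = g x + g y.
  apply: val_inj; apply/funext => z; rewrite GRing.valD gE -[RHS]/(\val (g x) z + \val (g y) z) !gE.
  rewrite /riesz !ipDr; simpc; congr (_ +i* _); ring.
have gZ (t : R) x : g (t%:C *: x) = t%:C *: g x.
  apply: val_inj; apply/funext => z; rewrite GRing.valZ gE -[RHS]/(t%:C * \val (g x) z) !gE.
  rewrite /riesz !ipZr; simpc; congr (_ +i* _); ring.
have [phi Hphi] : exists phi, forall x, `|complex.Re (\val F (g x)) - sys_ip s j x phi| <= eps * hn j x.
  apply: (approx_riesz (l := fun x => complex.Re (\val F (g x))) (K := C * Mp)) => //.
  - by move=> x y; rewrite gD FD ReD.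
  - by move=> t x; rewrite gZ FZ ReZ.
  - move=> x; apply: le_trans (Re_le_cabs _) _; rewrite -mulrA (mulrC Mp).
    by apply: FM => [|y]; [exact: hn_ge0|rewrite gE; exact: riesz_le].
exists phi => f fj; have [_ _ fD fB] := linear_ofN (@dual_linear _ _ f).
have main (h : E') : (forall x, cabs (\val h x) <= hn j x) -> complex.Re (\val F h - \val h phi) <= eps.
  move=> hj; have [_ hZ hD hB] := linear_ofN (@dual_linear _ _ h).
  apply/ler_addgt0Pr => d d0.
  (* Collects the coefficients of t in the three error terms, so that they stay below t K = d; the 1
     keeps K positive. *)
  pose K := C * Mp + eps + hn j phi + 1.
  have K0 : 0 < K by rewrite ltr_wpDl// !addr_ge0 ?mulr_ge0 ?hn_ge0// ltW.
  pose t := d / K; have t0 : 0 < t by exact: divr_gt0.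
  have [psi Hpsi] : exists psi, forall x, `|complex.Re (\val h x) - sys_ip s j x psi| <= t * hn j x.
    apply: (approx_riesz (l := fun x => complex.Re (\val h x)) (K := 1)) => //.
    - by move=> x y; rewrite hD ReD.
    - by move=> u x; rewrite hZ ReZ.
    - by move=> x; rewrite mul1r (le_trans (Re_le_cabs _)).
  have hg x : cabs (\val (h - g psi) x) <= t * hn j x.
    apply: (cabs_le_phase (p := fun x => t * hn j x)) => [|a y a1|y].
    - exact: dual_linear.
    - by rewrite hnZ a1 mul1r.
    - rewrite GRing.valB -[(_ - _) y]/(\val h y - \val (g psi) y) gE.
      apply: le_trans (ler_norm _) (le_trans _ (Hpsi y)).
      by rewrite -riesz_Re; case: (\val h y) (riesz j psi y) => ? ? [].
  have n1 : hn j psi <= 1 + t.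
    apply: (hn_le_dual (s := s)) => [|x]; first by rewrite addr_ge0// ltW.
    have h1 := le_trans (Re_le_cabs _) (hj x); have := Hpsi x.
    rewrite mulrDl mul1r => h2.
    have -> : sys_ip s j x psi = complex.Re (\val h x) - (complex.Re (\val h x) - sys_ip s j x psi) by ring.
    by rewrite (le_trans (ler_normB _ _))// lerD.
  have b1 := le_trans (ler_norm _) (le_trans (Re_le_cabs _) (FM _ t (ltW t0) hg)).
  have b2 := le_trans (ler_norm _) (Hphi psi).
  have b3 := le_trans (Re_le_cabs _) (hg phi).
  rewrite FB in b1.
  have b2' : complex.Re (\val F (g psi) - \val (g psi) phi) <= eps * hn j psi.
    by rewrite gE; move: b2; rewrite (ipC _ psi) -riesz_Re; case: (\val F _) (riesz j psi phi) => ? ? [].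
  have -> : \val F h - \val h phi = (\val F h - \val F (g psi)) + (\val F (g psi) - \val (g psi) phi) - (\val (h - g psi) phi).
    by rewrite GRing.valB -[(_ - _) phi]/(\val h phi - \val (g psi) phi); ring.
  rewrite ReD ReD; move: b3; rewrite ler_norml => /andP[b3 _].
  have -> : complex.Re (- \val (h - g psi) phi) = - complex.Re (\val (h - g psi) phi) by case: (\val _ _).
  have b4 : eps * hn j psi <= eps * (1 + t) by rewrite ler_pM2l.
  have tK : t * K = d by rewrite /t divfK// gt_eqF.
  move: b1 b2' b3 b4 tK; rewrite /K (_ : C * (t * Mp) = t * (C * Mp)); last by ring.
  move: (complex.Re (\val F h - _)) (complex.Re (\val F (g psi) - _)) (complex.Re (\val (h - _) phi)).
  by move: (hn j phi) (eps * hn j psi) (C * Mp) => *; lra.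
have [u [u1 uf]] := cabs_phase (\val F f - \val f phi).
have := main (u *: f); rewrite FZ GRing.valZ -[(u *: _) phi]/(u * \val f phi) -mulrBr uf; apply.
by move=> x; rewrite -[(u *: _) x]/(u * \val f x) cabsM u1 mul1r.
Qed.

Lemma cabs_small_eq0 (z : R[i]) : (forall d : R, 0 < d -> cabs z <= d) -> z = 0.
Proof.
move=> H; apply: cabs_eq0; apply/eqP; rewrite eq_le cabs_ge0 andbT.
by apply/ler_addgt0Pr => d d0; rewrite add0r; exact: H.
Qed.

(** Points ph k represent F up to 1 / (k + 1) on all functionals bounded by h_k. Norming functionals
    turn this into the Cauchy property, and the limit represents F, because every continuous
    functional is bounded by a multiple of some h_j. *)
Lemma bidual_surj (F : E'') : exists x, bidual x = F.
Proof.
have e0 t : 0 < (t.+1%:R^-1 : R) by rewrite invr_gt0 ltr0n.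
have /choice[ph Hph] k := bidual_approx F k (e0 k).
have Hph' j k (f : E') : (j <= k)%N -> (forall x, cabs (\val f x) <= hn j x) ->
    cabs (\val F f - \val f (ph k)) <= k.+1%:R^-1.
  by move=> jk fj; apply: Hph => x; exact: le_trans (fj x) (hn_homo _ _ jk).
have [|phi Hphi] := @hn_complete _ _ s ph.
  move=> j e e1; have e2 : 0 < e / 2 by rewrite divr_gt0.
  have [N hN] := invS_small e2; exists (maxn j N) => i k.
  rewrite !geq_max => /andP[ji Ni] /andP[jk Nk].
  have [f [fj <-]] := norming_functional j (ph i - ph k).
  have [_ _ _ fB] := linear_ofN (@dual_linear _ _ f); rewrite fB.
  have -> : \val f (ph i) - \val f (ph k) = (\val F f - \val f (ph k)) - (\val F f - \val f (ph i)) by ring.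
  apply: le_trans (cabsB _ _) _; rewrite [leRHS]splitr lerD//.
    exact: le_trans (Hph' _ _ _ jk fj) (ltW (hN _ Nk)).
  exact: le_trans (Hph' _ _ _ ji fj) (ltW (hN _ Ni)).
exists phi; apply: val_inj; apply/funext => f; rewrite bidualE; apply: subr0_eq.
apply: cabs_small_eq0 => d d0.
have [j [C [C0 fC]]] := dual_hn_bound f; have [_ _ _ fB] := linear_ofN (@dual_linear _ _ f).
have [_ FZ _ _] := linear_ofN (@dual_linear _ _ F).
have d1 : 0 < d / (2 * C) by rewrite divr_gt0// mulr_gt0.
have [N hN] := invS_small d1; have [N' hN'] := Hphi j _ d1.
pose k := maxn j (maxn N N').
have Nk : (N <= k)%N by rewrite /k !leq_max leqnn !orbT.
have N'k : (N' <= k)%N by rewrite /k !leq_max leqnn !orbT.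
have h1 : cabs (\val F f - \val f (ph k)) <= C * k.+1%:R^-1.
  have := Hph' j k (C^-1%:C *: f) (leq_maxl _ _).
  rewrite GRing.valZ FZ -[(C^-1%:C *: \val f) (ph k)]/(C^-1%:C * \val f (ph k)) -mulrBr cabsM cabsC gtr0_norm ?invr_gt0//.
  rewrite ler_pdivrMl//; apply=> x.
  rewrite -[(C^-1%:C *: \val f) x]/(C^-1%:C * \val f x) cabsM cabsC gtr0_norm ?invr_gt0//.
  by rewrite ler_pdivrMl.
have h2 := fC (ph k - phi); rewrite fB in h2.
have -> : \val f phi - \val F f = - ((\val F f - \val f (ph k)) + (\val f (ph k) - \val f phi)) by ring.
rewrite cabsN; apply: le_trans (cabsD _ _) _; apply: le_trans (lerD h1 h2) _.
rewrite -mulrDr -ler_pdivlMl//.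
have -> : C^-1 * d = d / (2 * C) + d / (2 * C) by field; rewrite gt_eqF.
by apply: lerD (ltW (hN k Nk)) (hN' k N'k).
Qed.

(* Otherwise choose f_k in P and x_k with hn_k(x_k) < 1 and |f_k(x_k)| = k + 1;
   the sequence x_k is bounded, but P is not bounded on it. *)
Lemma strong_bounded_equicontinuous (P : set E') : tvs_bounded P ->
  exists j, forall f : E', P f -> forall x, cabs (\val f x) <= j.+1%:R * hn j x.
Proof.
move=> /lc_boundedP bP; apply: contrapT => nP.
have /choice[x Hx] k : exists x, hn k x < 1 /\ exists2 f : E', P f & cabs (\val f x) = k.+1%:R.
  apply: contrapT => nk; apply: nP; exists k => f Pf y; rewrite leNgt; apply/negP => fy.
  have f0 : 0 < cabs (\val f y) by apply: le_lt_trans fy; rewrite mulr_ge0 ?hn_ge0.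
  have [_ fZ _ _] := linear_ofN (@dual_linear _ _ f).
  apply: nk; exists ((k.+1%:R / cabs (\val f y))%:C *: y); split.
    rewrite hnZ cabsC ger0_norm ?divr_ge0 ?cabs_ge0//.
    by rewrite mulrAC ltr_pdivrMr// mul1r.
  exists f => //; rewrite fZ cabsM cabsC ger0_norm ?divr_ge0 ?cabs_ge0//.
  by rewrite divfK// gt_eqF.
have bx : tvs_bounded (range x).
  apply: (hn_bounded (s := s)) => j; exists (1 + \sum_(k < j) hn j (x k)) => _ [k _ <-].
  have s0 : 0 <= \sum_(k < j) hn j (x k) by apply: sumr_ge0 => i _; exact: hn_ge0.
  have [kj|jk] := ltnP k j.
    rewrite (bigD1 (Ordinal kj))//= addrCA lerDl addr_ge0// sumr_ge0// => i _; exact: hn_ge0.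
  apply: le_trans (hn_homo _ _ jk) (le_trans (ltW (Hx k).1) _).
  by rewrite lerDl.
have [M HM] := bP (exist _ _ bx).
have [k] : exists k : nat, M < k.+1%:R by exists (Num.truncn M); exact: truncnS_gt.
have [_ [f Pf fk]] := Hx k; apply/negP; rewrite -leNgt -fk; apply: le_trans (HM _ Pf).
by apply: sup_seminorm_ub; exists k.
Qed.

(** By equicontinuity of a strongly bounded set, closeness for one h_j becomes uniform closeness on
    that set. *)
Lemma bidual_continuous : continuous bidual.
Proof.
move=> x A /lc_nbhsP[ss [e [e0 eA]]]; have e2 : 0 < e / 2 by rewrite divr_gt0.
suff : nbhs x [set y | all (fun P => sup_seminorm P (\val (bidual y) - \val (bidual x)) < e) ss].
  by move=> H; apply: (@filterS _ (nbhs x) _ _ _ _ H) => y; exact: eA.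
elim: ss {eA} => [|P ss ih]; first exact: (@filterS _ (nbhs x) _ _ _ _ (@filterT _ (nbhs x) _)).
have [j Hj] := strong_bounded_equicontinuous (svalP P).
have N : nbhs x [set y | hn j (y - x) < e / 2 / j.+1%:R].
  by apply/(nbhs_hnP s); exists j, (e / 2 / j.+1%:R); split; rewrite ?divr_gt0.
apply: (@filterS _ (nbhs x) _ _ _ _ (filterI N ih)) => y [/= yx ->]; rewrite andbT.
apply: (@le_lt_trans _ _ (e / 2)); last lra.
apply: sup_seminorm_le => [|f Pf]; first exact: ltW.
rewrite -[(_ - _) f]/(\val f y - \val f x).
have [_ _ _ fB] := linear_ofN (@dual_linear _ _ f); rewrite -fB.
by apply: le_trans (Hj f Pf _) _; rewrite mulrC -ler_pdivlMr// ltW.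
Qed.

Lemma nuclear_system_reflexive : reflexive_space E.
Proof.
have /choice[J' HJ'] := bidual_surj.
exists bidual, J'; split.
- exact: bidualE.
- by move=> x; apply: bidual_inj; rewrite HJ'.
- exact: HJ'.
- exact: bidual_continuous.
(* The polar of h_j is strongly bounded and contains a functional norming J' F' - J' F, so its sup
   seminorm at F' - F dominates h_j of that difference. *)
move=> F A /(nbhs_hnP s)[j [e [e0 eA]]].
have N := @lc_nbhs1 R _ _ _ _ (@dual_submod_closed R E') (@sup_seminormP R E') F (exist _ _ (hn_polar_bounded j)) e e0.
apply: (@filterS _ (nbhs F) _ _ _ _ N) => F' /= F'F; apply: eA; apply: le_lt_trans F'F.
have [f [fj <-]] := norming_functional j (J' F' - J' F).
have [_ _ _ fB] := linear_ofN (@dual_linear _ _ f); rewrite fB.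
have := @sup_seminorm_ub _ _ (exist _ _ (hn_polar_bounded j)) (F' - F) f fj.
by rewrite GRing.valB -{1}(HJ' F') -{1}(HJ' F).
Qed.

End Reflexive.

(** * Seminorms of entire functions *)

Lemma cabs1 (R : realType) : cabs (1 : R[i]) = 1.
Proof. by rewrite -[1](_ : (1 : R)%:C = _)// cabsC normr1. Qed.

Section ComplexDerivatives.
Context (R : realType) (n : nat) (G : lieGroupType R n) (e : lie_basis G).
Implicit Types (phi psi : G -> R[i]).
Local Notation Re phi := (fun g => complex.Re (phi g)).
Local Notation Im phi := (fun g => complex.Im (phi g)).

Lemma analytic_funP phi : analytic_fun phi <-> ranal (Re phi) /\ ranal (Im phi).
Proof.
by split=> [H|[H1 H2] k ak g kg]; [split=> k ak g kg; have [] := H k ak g kg|split; [exact: H1|exact: H2]].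
Qed.

Lemma lie_derives_Re w phi : Re (lie_derives e w phi) = rlds e w (Re phi).
Proof. by elim: w => [//|i w ih]; rewrite [RHS]/= -/(rlds e w _) -ih. Qed.

Lemma lie_derives_Im w phi : Im (lie_derives e w phi) = rlds e w (Im phi).
Proof. by elim: w => [//|i w ih]; rewrite [RHS]/= -/(rlds e w _) -ih. Qed.

Lemma lie_derivesE w phi :
  lie_derives e w phi = fun g => rlds e w (Re phi) g +i* rlds e w (Im phi) g.
Proof.
apply/funext => g; have h1 := congr1 (@^~ g) (lie_derives_Re w phi).
have h2 := congr1 (@^~ g) (lie_derives_Im w phi).
by move: h1 h2; case: (lie_derives e w phi g) => a b /= -> ->.
Qed.

Lemma lie_derives_cat w w' phi : lie_derives e (w ++ w') phi = lie_derives e w (lie_derives e w' phi).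
Proof. by rewrite /lie_derives foldr_cat. Qed.

Lemma analytic_lie_derives w phi : analytic_fun phi -> analytic_fun (lie_derives e w phi).
Proof.
move=> /analytic_funP[h1 h2]; apply/analytic_funP.
by rewrite lie_derives_Re lie_derives_Im; split; exact: rlds_ranal.
Qed.

Lemma ranalZ c (u : G -> R) : ranal u -> ranal (fun g => c * u g).
Proof. by move=> uG; apply: ranalM => //; exact: ranal_cst. Qed.

Lemma rlds_lin w a b (u v : G -> R) : ranal u -> ranal v ->
  rlds e w (fun g => a * u g + b * v g) = (fun g => a * rlds e w u g + b * rlds e w v g).
Proof.
move=> uG vG; elim: w => [//|i w ih]; rewrite /= -!/(rlds e w _) ih.
have uw := rlds_ranal e w uG; have vw := rlds_ranal e w vG.
by rewrite rldD ?rldZ//; exact: ranalZ.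
Qed.

Lemma analytic_funZD a phi psi : analytic_fun phi -> analytic_fun psi -> analytic_fun (a *: phi + psi).
Proof.
case: a => a b /analytic_funP[h1 h2] /analytic_funP[h3 h4]; apply/analytic_funP; split.
  have -> : Re ((a +i* b) *: phi + psi) = (fun g => (a * Re phi g - b * Im phi g) + Re psi g).
    by apply/funext => g; rewrite !fctE /=; case: (phi g) => ? ?; case: (psi g).
  by apply: ranalD => //; apply: ranalB; exact: ranalZ.
have -> : Im ((a +i* b) *: phi + psi) = (fun g => (a * Im phi g + b * Re phi g) + Im psi g).
  by apply/funext => g; rewrite !fctE /=; case: (phi g) => ? ?; case: (psi g).
by apply: ranalD => //; apply: ranalD; exact: ranalZ.
Qed.

Lemma analytic_fun0 : analytic_fun (0 : G -> R[i]).
Proof. by apply/analytic_funP; split; exact: ranal_cst. Qed.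

Lemma lie_derivesZD w a phi psi g : analytic_fun phi -> analytic_fun psi ->
  lie_derives e w (a *: phi + psi) g = a * lie_derives e w phi g + lie_derives e w psi g.
Proof.
case: a => a b /analytic_funP[h1 h2] /analytic_funP[h3 h4]; rewrite !lie_derivesE.
have -> : Re ((a +i* b) *: phi + psi) = (fun g => 1 * (a * Re phi g + (- b) * Im phi g) + 1 * Re psi g).
  by apply/funext => x; rewrite !fctE /=; case: (phi x) => ? ?; case: (psi x) => ? ? /=; rewrite !mul1r mulNr.
have -> : Im ((a +i* b) *: phi + psi) = (fun g => 1 * (a * Im phi g + b * Re phi g) + 1 * Im psi g).
  by apply/funext => x; rewrite !fctE /=; case: (phi x) => ? ?; case: (psi x) => ? ? /=; rewrite !mul1r.
rewrite !rlds_lin//; try by apply: ranalD; exact: ranalZ.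
by simpc; congr (_ +i* _); ring.
Qed.

Lemma lie_derives0 w g : lie_derives e w 0 g = 0.
Proof.
have := @lie_derivesZD w (-1) 0 0 g analytic_fun0 analytic_fun0.
by rewrite scaler0 addr0 mulN1r addNr.
Qed.

Lemma analytic_funM phi psi : analytic_fun phi -> analytic_fun psi -> analytic_fun (fun g => phi g * psi g).
Proof.
move=> /analytic_funP[h1 h2] /analytic_funP[h3 h4]; apply/analytic_funP; split.
  have -> : Re (fun g => phi g * psi g) = (fun g => Re phi g * Re psi g - Im phi g * Im psi g).
    by apply/funext => g; case: (phi g) => ? ?; case: (psi g).
  by apply: ranalB; exact: ranalM.
have -> : Im (fun g => phi g * psi g) = (fun g => Re phi g * Im psi g + Im phi g * Re psi g).
  by apply/funext => g; case: (phi g) => ? ?; case: (psi g).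
by apply: ranalD; exact: ranalM.
Qed.

Lemma lie_deriveM i phi psi : analytic_fun phi -> analytic_fun psi ->
  lie_derive e i (fun g => phi g * psi g) =
  (fun g => lie_derive e i phi g * psi g) + (fun g => phi g * lie_derive e i psi g).
Proof.
move=> /analytic_funP[h1 h2] /analytic_funP[h3 h4]; apply/funext => g.
have E f : lie_derive e i f = lie_derives e [:: i] f by [].
rewrite !E !lie_derivesE /= -[RHS]/(_ + _).
have -> : Re (fun g => phi g * psi g) = (fun g => Re phi g * Re psi g - Im phi g * Im psi g).
  by apply/funext => x; case: (phi x) => ? ?; case: (psi x).
have -> : Im (fun g => phi g * psi g) = (fun g => Re phi g * Im psi g + Im phi g * Re psi g).
  by apply/funext => x; case: (phi x) => ? ?; case: (psi x).
rewrite rldB ?rldD ?rldM//; try exact: ranalM.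
case: (phi g) => ? ?; case: (psi g) => ? ?; simpc => /=; congr (_ +i* _); ring.
Qed.

Definition jetsum k phi : R := wsum k (fun w => cabs (lie_derives e w phi 1%g)).

Lemma jetsum_ge0 k phi : 0 <= jetsum k phi.
Proof. by apply: wsum_ge0 => w; exact: cabs_ge0. Qed.

Lemma jetsumS k phi : jetsum k.+1 phi = \sum_i jetsum k (lie_derive e i phi).
Proof.
rewrite /jetsum wsum_rcons; apply: eq_bigr => i _; apply: eq_wsum => w _.
by rewrite -cats1 lie_derives_cat.
Qed.

Lemma jetsumD k phi psi : analytic_fun phi -> analytic_fun psi ->
  jetsum k (phi + psi) <= jetsum k phi + jetsum k psi.
Proof.
move=> h1 h2; rewrite /jetsum -wsumD; apply: ler_wsum => w _.
rewrite -(scale1r phi) lie_derivesZD// mul1r scale1r; exact: cabsD.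
Qed.

Lemma binomial_shift k (B : nat -> nat -> R) :
  \sum_(j < k.+2) 'C(k.+1, j)%:R * B j (k.+1 - j)%N =
  \sum_(j < k.+1) 'C(k, j)%:R * (B j.+1 (k - j)%N + B j (k - j).+1).
Proof.
rewrite big_ord_recl /= bin0 mul1r subn0.
under eq_bigr do rewrite /bump /= add1n binS natrD mulrDl subSS.
under [RHS]eq_bigr do rewrite mulrDr.
rewrite !big_split /= addrA addrC; congr (_ + _).
transitivity (\sum_(j < k.+2) 'C(k, j)%:R * B j (k.+1 - j)%N).
  by rewrite [RHS]big_ord_recl /= bin0 mul1r subn0; congr (_ + _).
rewrite big_ord_recr /= bin_small// mul0r addr0.
by apply: eq_bigr => j _; rewrite subSn// -ltnS.
Qed.

(** Leibniz rule summed over words. The induction peels the last letter, the derivative applied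
    first, so the hypothesis is used for the products of the two factors with one of them
    differentiated; Pascal's rule in [binomial_shift] recombines the terms. *)
Lemma jetsumM k phi psi : analytic_fun phi -> analytic_fun psi ->
  jetsum k (fun g => phi g * psi g) <= \sum_(j < k.+1) 'C(k, j)%:R * (jetsum j phi * jetsum (k - j) psi).
Proof.
elim: k phi psi => [|k ih] phi psi h1 h2.
  by rewrite big_ord1 /= mul1r /jetsum /= cabsM.
have d i f : analytic_fun f -> analytic_fun (lie_derive e i f) by move=> fG; exact: (analytic_lie_derives [:: i] fG).
rewrite (binomial_shift k (fun i j => jetsum i phi * jetsum j psi)) jetsumS.
under [leRHS]eq_bigr do rewrite !jetsumS mulr_suml mulr_sumr -big_split mulr_sumr.
rewrite exchange_big /=; apply: ler_sum => i _; rewrite lie_deriveM//.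
apply: le_trans (jetsumD _ _ _) _; try by apply: analytic_funM => //; exact: d.
apply: le_trans (lerD (ih _ _ (d i _ h1) h2) (ih _ _ h1 (d i _ h2))) _.
by rewrite -big_split /=; apply: ler_sum => j _; rewrite -mulrDr.
Qed.

End ComplexDerivatives.

Section WeightedBounds.
Context (R : realType) (n : nat) (r : R).
Hypothesis r0 : 0 <= r.
Implicit Types (T : seq 'I_n -> R[i]) (c Q : R).

(** The bound q_(r,c) <= Q, written as a [taylor_bound] of the jet weighted by k!^r, so that the
    lemmas for real jets apply to it. *)
Definition ebound c T Q := taylor_bound c (fun w => (size w)`!%:R `^ r * cabs (T w)) Q.

Lemma factr_ge1 k : 1 <= k`!%:R `^ r :> R.
Proof. by rewrite -[leLHS](powRr0 k`!%:R); apply: ler_powR => //; rewrite ler1n fact_gt0. Qed.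

Lemma taylor_bound_mono c (T T' : seq 'I_n -> R) Q : 0 <= c -> (forall w, `|T w| <= `|T' w|) ->
  taylor_bound c T' Q -> taylor_bound c T Q.
Proof.
move=> c0 TT H K; apply: le_trans (H K); apply: ler_sum => j _.
by rewrite ler_wpM2l ?divr_ge0 ?exprn_ge0//; apply: ler_wsum => w _.
Qed.

(** Since r >= 0, the weights k!^r are at least 1, so functions entire of order r satisfy the bounds
    of order 0; [f] is meant to be the real or the imaginary part. *)
Lemma ebound_taylor c T Q (f : R[i] -> R) : 0 <= c -> (forall z, `|f z| <= cabs z) ->
  ebound c T Q -> taylor_bound c (fun w => f (T w)) Q.
Proof.
move=> c0 fc; apply: taylor_bound_mono => // w.
rewrite normrM (ger0_norm (powR_ge0 _ _)) (ger0_norm (cabs_ge0 _)).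
by apply: le_trans (fc _) _; rewrite ler_peMl ?cabs_ge0 ?factr_ge1.
Qed.

Lemma eboundW c T Q Q' : Q <= Q' -> ebound c T Q -> ebound c T Q'.
Proof. by move=> QQ H K; exact: le_trans (H K) QQ. Qed.

Lemma eboundD c T T' Q Q' : 0 <= c -> ebound c T Q -> ebound c T' Q' -> ebound c (fun w => T w + T' w) (Q + Q').
Proof.
move=> c0 h1 h2; apply: taylor_bound_mono (taylor_boundD c0 h1 h2) => // w.
rewrite -mulrDr !normrM ler_wpM2l// !ger0_norm ?addr_ge0 ?cabs_ge0//; exact: cabsD.
Qed.

Lemma eboundZ c a T Q : 0 <= c -> ebound c T Q -> ebound c (fun w => a * T w) (cabs a * Q).
Proof.
move=> c0 h K; apply: le_trans (ler_wpM2l (cabs_ge0 a) (h K)); rewrite mulr_sumr.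
apply: ler_sum => j _; rewrite [leRHS]mulrCA ler_wpM2l ?divr_ge0 ?exprn_ge0// -wsumZ.
apply: ler_wsum => w _; rewrite !normrM cabsM normrM mulrCA.
by rewrite (ger0_norm (cabs_ge0 a)).
Qed.

Lemma ebound_lim c (T_ : nat -> seq 'I_n -> R[i]) T Q N : 0 <= c ->
  (forall w, (fun i => complex.Re (T_ i w)) @ \oo --> complex.Re (T w)) ->
  (forall w, (fun i => complex.Im (T_ i w)) @ \oo --> complex.Im (T w)) ->
  (forall i, (N <= i)%N -> ebound c (T_ i) Q) -> ebound c T Q.
Proof.
move=> c0 hR hI; apply: taylor_bound_lim => // w.
apply: cvgM; first exact: cvg_cst.
apply/cvgn_epsP => d d0; have d2 : 0 < d / 2 by rewrite divr_gt0.
have /cvgn_epsP/(_ _ d2)[N1 h1] := hR w; have /cvgn_epsP/(_ _ d2)[N2 h2] := hI w.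
exists (maxn N1 N2) => k; rewrite geq_max => /andP[/h1 k1 /h2 k2].
apply: (@le_trans _ _ (cabs (T w - T_ k w))).
  rewrite ler_norml; apply/andP; split.
    by rewrite lerNl opprB lerBlDr -(cabsN (_ - _)) opprB -{1}(subrK (T w) (T_ k w)) cabsD.
  by rewrite lerBlDr -{1}(subrK (T_ k w) (T w)) cabsD.
apply: le_trans (cabs_le_ReIm _) _; rewrite [leRHS]splitr.
by apply: lerD; [move: k1|move: k2]; case: (T w) => ? ?; case: (T_ k w).
Qed.

Lemma ebound_partial c T K :
  \sum_(k < K) c ^+ k / k`!%:R * wsum k (fun w => `|(size w)`!%:R `^ r * cabs (T w)|) =
  \sum_(k < K) k`!%:R `^ r * (k`!%:R^-1 * wsum k (fun w => cabs (T w))) * c ^+ k.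
Proof.
apply: eq_bigr => k _.
rewrite (@eq_wsum _ _ _ _ (fun w => k`!%:R `^ r * cabs (T w))) => [|w ->].
  by rewrite wsumZ; ring.
by rewrite ger0_norm// mulr_ge0 ?powR_ge0 ?cabs_ge0.
Qed.

Lemma factr_mul_le k j : (j <= k)%N ->
  k`!%:R `^ r <= (2 `^ r) ^+ j * j`!%:R `^ r * ((2 `^ r) ^+ (k - j) * (k - j)`!%:R `^ r) :> R.
Proof.
move=> jk; rewrite mulrACA -exprD subnKC// -powR_mulrn ?powR_ge0// powRAC -!powRM ?powR_ge0//.
apply: ge0_ler_powR => //; rewrite ?nnegrE ?mulr_ge0 ?powR_ge0//.
rewrite powR_mulrn// -natrX -!natrM ler_nat -(bin_fact jk) leq_mul2r.
apply/orP; right; have := expnDn 1 1 k; rewrite addn1 => ->.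
under eq_bigr do rewrite !exp1n !muln1.
have kj : (j < k.+1)%N by [].
by rewrite (bigD1 (Ordinal kj))//= leq_addr.
Qed.

End WeightedBounds.

Section EntireSeminorm.
Context (R : realType) (n : nat) (G : lieGroupType R n) (e : lie_basis G) (r : R).
Hypothesis r0 : 0 <= r.
Implicit Types (phi psi : G -> R[i]) (c Q : R).
Local Notation jet phi := (fun w => lie_derives e w phi 1%g).

Lemma entire_norm_partial c phi K :
  (\sum_(0 <= k < K) (k`!%:R `^ r * taylor_coef e k phi * c ^+ k)%:E)%E =
  (\sum_(k < K) c ^+ k / k`!%:R * wsum k (fun w => `|(size w)`!%:R `^ r * cabs (lie_derives e w phi 1%g)|))%:E.
Proof.
rewrite sumEFin big_mkord (ebound_partial r c (fun w => lie_derives e w phi 1%g) K); congr (_%:E).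
by apply: eq_bigr => k _; rewrite /taylor_coef -wsumE.
Qed.

Lemma entire_term_ge0 c phi : 0 <= c ->
  forall k, (0 <= (k`!%:R `^ r * taylor_coef e k phi * c ^+ k)%:E)%E.
Proof.
move=> c0 k; rewrite lee_fin !mulr_ge0 ?powR_ge0 ?exprn_ge0 ?invr_ge0//.
by apply: sumr_ge0 => w _; exact: cabs_ge0.
Qed.

Lemma entire_normP c phi Q : 0 <= c ->
  (entire_norm e r c phi <= Q%:E)%E <-> ebound r c (jet phi) Q.
Proof.
move=> c0; have t0 := entire_term_ge0 phi c0; split=> [H K|H].
  rewrite -lee_fin -entire_norm_partial; apply: le_trans H.
  by apply: nneseries_lim_ge => k _ _.
apply: lime_le; first by apply: is_cvg_nneseries => k _ _.
by apply: nearW => K; rewrite entire_norm_partial lee_fin; exact: H.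
Qed.

Lemma entireP phi : phi \in entire e r <->
  analytic_fun phi /\ forall c, 0 <= c -> exists Q, ebound r c (jet phi) Q.
Proof.
split=> [/asboolP[an H]|[an H]].
  split=> // c c0; have := H c c0; have n0 : (0 <= entire_norm e r c phi)%E.
    by apply: nneseries_ge0 => k _ _; exact: entire_term_ge0.
  case E : (entire_norm e r c phi) n0 => [Q| |]// _ _; exists Q.
  by apply/entire_normP => //; rewrite E.
apply/asboolP; split=> // c c0; have [Q /(entire_normP phi Q c0) HQ] := H c c0.
exact: le_lt_trans HQ (ltry _).
Qed.

Lemma entire_seminormP (c : {nonneg R}) phi : phi \in entire e r ->
  ebound r c%:num (jet phi) (entire_seminorm e r c phi).
Proof.
move=> /entireP[_ /(_ c%:num)[//|Q HQ]]; apply/entire_normP => //.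
move/entire_normP: HQ => /(_ (ge0 c)) HQ; rewrite /entire_seminorm fineK// ge0_fin_numE.
  exact: le_lt_trans HQ (ltry _).
by apply: nneseries_ge0 => k _ _; exact: entire_term_ge0.
Qed.

Lemma entire_seminorm_le (c : {nonneg R}) phi Q :
  ebound r c%:num (jet phi) Q -> entire_seminorm e r c phi <= Q.
Proof.
move=> /entire_normP => /(_ (ge0 c)) HQ; rewrite /entire_seminorm -lee_fin fineK// ge0_fin_numE.
  exact: le_lt_trans HQ (ltry _).
by apply: nneseries_ge0 => k _ _; exact: entire_term_ge0.
Qed.

Lemma jetZD a phi psi : analytic_fun phi -> analytic_fun psi ->
  jet (a *: phi + psi) = (fun w => a * jet phi w + jet psi w).
Proof. by move=> h1 h2; apply/funext => w; rewrite lie_derivesZD. Qed.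

Lemma eboundJ c phi psi a Q Q' : 0 <= c -> analytic_fun phi -> analytic_fun psi ->
  ebound r c (jet phi) Q -> ebound r c (jet psi) Q' -> ebound r c (jet (a *: phi + psi)) (cabs a * Q + Q').
Proof.
by move=> c0 h1 h2 b1 b2; rewrite jetZD//; apply: eboundD => //; exact: eboundZ.
Qed.

Lemma ebound0 c : ebound r c (jet 0) 0.
Proof.
move=> K; rewrite big1// => k _.
rewrite (@eq_wsum _ _ _ _ (fun=> 0)) ?wsum0 ?mulr0// => w _.
by rewrite lie_derives0 cabs0 mulr0 normr0.
Qed.

Lemma entire_submod : submod_closed (entire e r).
Proof.
split.
  by apply/entireP; split; [exact: analytic_fun0|move=> c c0; exists 0; exact: ebound0].
move=> a phi psi /entireP[h1 b1] /entireP[h2 b2]; apply/entireP; split; first exact: analytic_funZD.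
move=> c c0; have [Q HQ] := b1 c c0; have [Q' HQ'] := b2 c c0.
by exists (cabs a * Q + Q'); exact: eboundJ.
Qed.

Lemma entire_analytic phi : phi \in entire e r -> analytic_fun phi.
Proof. by move=> /entireP[]. Qed.

Lemma entire_seminorm_on (c : {nonneg R}) : seminorm_on (entire e r) (entire_seminorm e r c).
Proof.
have [S0 SD] := entire_submod.
have SZ a phi : phi \in entire e r -> a *: phi \in entire e r.
  by move=> h; rewrite -[_ *: _]addr0; exact: SD.
have le_Z a phi : phi \in entire e r -> entire_seminorm e r c (a *: phi) <= cabs a * entire_seminorm e r c phi.
  move=> h; apply: entire_seminorm_le.
  have c0 : 0 <= c%:num by exact: ge0.
  have := eboundJ a c0 (entire_analytic h) (@analytic_fun0 _ _ G) (entire_seminormP c h) (ebound0 c%:num).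
  by rewrite !addr0.
split=> [phi psi h1 h2|a phi h].
  apply: entire_seminorm_le; rewrite -{1}(scale1r phi).
  have -> : entire_seminorm e r c phi = cabs 1 * entire_seminorm e r c phi.
    by rewrite cabs1 mul1r.
  by apply: eboundJ => //; try exact: entire_analytic; exact: entire_seminormP.
(* For a != 0 the reverse inequality is [le_Z] applied to a^-1 and a phi. *)
apply/eqP; rewrite eq_le le_Z//=; have [->|a0] := eqVneq a 0.
  rewrite cabs0 mul0r; have := entire_seminormP c (SZ 0 phi h); exact: taylor_bound_ge0.
have ca : 0 < cabs a by rewrite lt_neqAle cabs_ge0 andbT eq_sym; apply: contra a0 => /eqP/cabs_eq0 ->.
have := le_Z a^-1 (a *: phi) (SZ _ _ h); rewrite scalerA mulVf// scale1r.
have -> : cabs a^-1 = (cabs a)^-1.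
  apply: (mulIf (x := cabs a)); first by rewrite gt_eqF.
  by rewrite -cabsM mulVf// mulVf ?gt_eqF// cabs1.
by rewrite ler_pdivlMl.
Qed.

Lemma ebound_jetM c phi psi Q Q' : 0 <= c -> analytic_fun phi -> analytic_fun psi ->
  ebound r (2 `^ r * c) (jet phi) Q -> ebound r (2 `^ r * c) (jet psi) Q' ->
  ebound r c (jet (fun g => phi g * psi g)) (Q * Q').
Proof.
move=> c0 h1 h2 b1 b2 K; rewrite ebound_partial.
pose t f k := k`!%:R `^ r * (k`!%:R^-1 * jetsum e k f) * (2 `^ r * c) ^+ k.
have t0 f k : 0 <= t f k.
  by rewrite /t !mulr_ge0 ?invr_ge0 ?powR_ge0 ?jetsum_ge0 ?exprn_ge0 ?mulr_ge0 ?powR_ge0.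
apply: (@le_trans _ _ ((\sum_(k < K) t phi k) * \sum_(k < K) t psi k)); last first.
  apply: ler_pM; try by apply: sumr_ge0 => k _.
    by have := b1 K; rewrite ebound_partial.
  by have := b2 K; rewrite ebound_partial.
apply: le_trans (triangle_sum_le K (t0 phi) (t0 psi)).
apply: ler_sum => k _; rewrite -/(jetsum e k _).
have w0 : 0 <= k`!%:R `^ r * k`!%:R^-1 * c ^+ k :> R.
  by rewrite !mulr_ge0 ?invr_ge0 ?powR_ge0 ?exprn_ge0.
have := ler_wpM2l w0 (jetsumM e k h1 h2).
have -> : k`!%:R `^ r * k`!%:R^-1 * c ^+ k * jetsum e k (fun g => phi g * psi g) =
  k`!%:R `^ r * (k`!%:R^-1 * jetsum e k (fun g => phi g * psi g)) * c ^+ k by ring.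
move/le_trans; apply; rewrite mulr_sumr; apply: ler_sum => j _.
have jk : (j <= k)%N by rewrite -ltnS.
have fn i : i`!%:R != 0 :> R by rewrite pnatr_eq0 -lt0n fact_gt0.
set A := jetsum e j phi; set B := jetsum e (k - j) psi.
have A0 : 0 <= A by exact: jetsum_ge0.
have B0 : 0 <= B by exact: jetsum_ge0.
have -> : k`!%:R `^ r * k`!%:R^-1 * c ^+ k * ('C(k, j)%:R * (A * B)) =
    k`!%:R `^ r * (c ^+ k * (A / j`!%:R) * (B / (k - j)`!%:R)).
  rewrite -(bin_fact jk) !natrM; field.
  by rewrite !fn pnatr_eq0 -lt0n bin_gt0 jk.
have -> : t phi j * t psi (k - j)%N = (2 `^ r) ^+ j * j`!%:R `^ r * ((2 `^ r) ^+ (k - j) * (k - j)`!%:R `^ r) *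
    (c ^+ k * (A / j`!%:R) * (B / (k - j)`!%:R)).
  have ck : c ^+ k = c ^+ j * c ^+ (k - j) by rewrite -exprD subnKC.
  rewrite /t -/A -/B !exprMn ck; ring.
by rewrite ler_wpM2r ?factr_mul_le// !mulr_ge0 ?exprn_ge0 ?invr_ge0.
Qed.

Lemma entireM phi psi : phi \in entire e r -> psi \in entire e r -> (fun g => phi g * psi g) \in entire e r.
Proof.
move=> /entireP[h1 b1] /entireP[h2 b2]; apply/entireP; split; first exact: analytic_funM.
move=> c c0; have c1 : 0 <= 2 `^ r * c by rewrite mulr_ge0 ?powR_ge0.
have [Q HQ] := b1 _ c1; have [Q' HQ'] := b2 _ c1.
by exists (Q * Q'); exact: ebound_jetM.
Qed.

End EntireSeminorm.

Section EntireComplete.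
Context (R : realType) (n : nat) (G : lieGroupType R n) (e : lie_basis G) (r : R).
Hypotheses (r0 : 0 <= r) (cG : connected [set: G]).
Implicit Types (phi psi : G -> R[i]).
Local Notation jet phi := (fun w => lie_derives e w phi 1%g).

Lemma jetB phi psi : analytic_fun phi -> analytic_fun psi -> jet (phi - psi) = (fun w => jet phi w - jet psi w).
Proof.
move=> h1 h2; apply/funext => w; rewrite addrC -scaleN1r lie_derivesZD// mulN1r addrC //.
Qed.

Lemma jet_Re phi : (fun w => rlds e w (fun g => complex.Re (phi g)) 1%g) = (fun w => complex.Re (jet phi w)).
Proof. by apply/funext => w; rewrite -lie_derives_Re. Qed.

Lemma jet_Im phi : (fun w => rlds e w (fun g => complex.Im (phi g)) 1%g) = (fun w => complex.Im (jet phi w)).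
Proof. by apply/funext => w; rewrite -lie_derives_Im. Qed.

Lemma jet_eq0 phi : analytic_fun phi -> (forall w, jet phi w = 0) -> phi = 0.
Proof.
move=> /analytic_funP[h1 h2] H; apply/funext => g.
have e1 : complex.Re (phi g) = 0.
  apply: (@ent_eq0 _ _ _ e cG _ h1) => w.
  by have := congr1 (@^~ w) (jet_Re phi) => /= ->; rewrite H.
have e2 : complex.Im (phi g) = 0.
  apply: (@ent_eq0 _ _ _ e cG _ h2) => w.
  by have := congr1 (@^~ w) (jet_Im phi) => /= ->; rewrite H.
by move: e1 e2; case: (phi g) => a b /= -> ->.
Qed.

Lemma entire_complete (x_ : nat -> G -> R[i]) : (forall i, x_ i \in entire e r) ->
  (forall c eps, 0 <= c -> 0 < eps -> exists N, forall i k, (N <= i)%N -> (N <= k)%N ->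
     ebound r c (fun w => jet (x_ i) w - jet (x_ k) w) eps) ->
  exists phi, phi \in entire e r /\ forall c eps, 0 <= c -> 0 < eps -> exists N, forall i, (N <= i)%N ->
     ebound r c (fun w => jet (x_ i) w - jet phi w) eps.
Proof.
move=> xE xC; have an i : analytic_fun (x_ i) by exact: entire_analytic (xE i).
have part (f : R[i] -> R) : (forall z, `|f z| <= cabs z) -> (forall z w, f (z - w) = f z - f w) ->
    (forall i, ranal (fun g => f (x_ i g))) ->
    (forall i, (fun w => rlds e w (fun g => f (x_ i g)) 1%g) = (fun w => f (jet (x_ i) w))) ->
    exists u, ranal u /\ forall w, (fun i => f (jet (x_ i) w)) @ \oo --> rlds e w u 1%g.
  move=> fle fB fan fjet; have [||| u [uG uE]] := @real_complete _ _ _ e cG (fun i g => f (x_ i g)).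
  - exact: fan.
  - move=> i c c0; have /entireP[_ /(_ c c0)[Q HQ]] := xE i; exists Q.
    by rewrite fjet; exact: ebound_taylor HQ.
  - move=> c eps c0 e0; have [N hN] := xC c eps c0 e0; exists N => i k Ni Nk.
    have -> : (fun w => rlds e w (fun g => f (x_ i g)) 1%g - rlds e w (fun g => f (x_ k g)) 1%g) =
        (fun w => f (jet (x_ i) w - jet (x_ k) w)).
      apply/funext => w; rewrite fB; congr (_ - _).
        exact: (congr1 (@^~ w) (fjet i)).
      exact: (congr1 (@^~ w) (fjet k)).
    exact: ebound_taylor (hN i k Ni Nk).
  exists u; split=> // w; have := uE w 1%g.
  have -> // : (fun i => rlds e w (fun g => f (x_ i g)) 1%g) = (fun i => f (jet (x_ i) w)).
  apply/funext => i; exact: (congr1 (@^~ w) (fjet i)).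
have [|||| u [uG uE]] := part (@complex.Re R).
- exact: Re_le_cabs.
- by move=> [? ?] [].
- by move=> i; have /analytic_funP[] := an i.
- by move=> i; exact: jet_Re.
have [|||| v [vG vE]] := part (@complex.Im R).
- exact: Im_le_cabs.
- by move=> [? ?] [].
- by move=> i; have /analytic_funP[] := an i.
- by move=> i; exact: jet_Im.
pose phi g := u g +i* v g.
have pa : analytic_fun phi by apply/analytic_funP.
have jE w : jet phi w = rlds e w u 1%g +i* rlds e w v 1%g by rewrite lie_derivesE.
have conv c eps : 0 <= c -> 0 < eps -> exists N, forall i, (N <= i)%N ->
    ebound r c (fun w => jet (x_ i) w - jet phi w) eps.
  move=> c0 e0; have [N hN] := xC c eps c0 e0; exists N => i Ni.
  apply: (@ebound_lim _ _ r c (fun k w => jet (x_ i) w - jet (x_ k) w) _ eps N c0) => [w|w|k Nk].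
  - have -> : (fun k => complex.Re (jet (x_ i) w - jet (x_ k) w)) =
        (fun k => complex.Re (jet (x_ i) w) - complex.Re (jet (x_ k) w)).
      by apply/funext => k; case: (jet (x_ i) w) => ? ?; case: (jet (x_ k) w).
    have -> : complex.Re (jet (x_ i) w - jet phi w) = complex.Re (jet (x_ i) w) - rlds e w u 1%g.
      by rewrite jE; case: (jet (x_ i) w).
    by apply: cvgB; [exact: cvg_cst|exact: uE].
  - have -> : (fun k => complex.Im (jet (x_ i) w - jet (x_ k) w)) =
        (fun k => complex.Im (jet (x_ i) w) - complex.Im (jet (x_ k) w)).
      by apply/funext => k; case: (jet (x_ i) w) => ? ?; case: (jet (x_ k) w).
    have -> : complex.Im (jet (x_ i) w - jet phi w) = complex.Im (jet (x_ i) w) - rlds e w v 1%g.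
      by rewrite jE; case: (jet (x_ i) w).
    by apply: cvgB; [exact: cvg_cst|exact: vE].
  - exact: hN.
exists phi; split=> //; apply/entireP; split=> // c c0.
have [N hN] := conv c 1 c0 ltr01.
have /entireP[_ /(_ c c0)[Q HQ]] := xE N.
(* The jet of the limit is that of x_ N minus a difference with bound 1. *)
exists (Q + cabs (-1) * 1).
have := eboundD c0 HQ (eboundZ (-1) c0 (hN N (leqnn N))).
congr (ebound _ _ _ _); apply/funext => w; ring.
Qed.

End EntireComplete.

(** * The jet at the unit as a weighted coordinate system *)

Section JetSystem.
Context (R : realType) (n : nat) (G : lieGroupType R n) (e : lie_basis G) (r : R).
Hypotheses (r0 : 0 <= r) (cG : connected [set: G]).
Implicit Types (phi psi : G -> R[i]).
Local Notation jet phi := (fun w => lie_derives e w phi 1%g).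

(** There are n^k words of length k, and n^k / growth^k <= 2^-k. The successor keeps the number
    positive for n = 0, and as growth >= 2 its powers are cofinal among the parameters c. *)
Definition growth : R := 2 * n.+1%:R.

(* Words are enumerated by [pickle]; on the integers that are not the code of a
   word, [jlam] is 0 and the value of [jom] only has to keep the ratios summable. *)
Definition jlam m phi : R[i] :=
  if @pickle_inv (seq 'I_n) m is Some w then jet phi w else 0.

Definition jom j m : R :=
  if @pickle_inv (seq 'I_n) m is Some w
  then (size w)`!%:R `^ r / (size w)`!%:R * (growth ^+ j) ^+ size w else (2 ^+ j) ^+ m.

Lemma growth_gt0 : 0 < growth.
Proof. exact: mulr_gt0. Qed.

Lemma growth_ge2 : 2 <= growth.
Proof. by rewrite /growth ler_peMr// ler1n. Qed.

Lemma jom_gt0 j m : 0 < jom j m.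
Proof.
have g0 := growth_gt0; rewrite /jom; case: pickle_inv => [w|]; last by rewrite !exprn_gt0.
by rewrite mulr_gt0 ?exprn_gt0// divr_gt0 ?powR_gt0 ?ltr0n ?fact_gt0.
Qed.

Lemma jom_ratio j m : jom j m / jom j.+1 m =
  if @pickle_inv (seq 'I_n) m is Some w then growth^-1 ^+ size w else 2^-1 ^+ m.
Proof.
have g0 : growth != 0 by rewrite gt_eqF// growth_gt0.
rewrite /jom; case: pickle_inv => [w|].
  have f0 : (size w)`!%:R `^ r != 0 :> R by rewrite gt_eqF// powR_gt0 ltr0n fact_gt0.
  have f1 : (size w)`!%:R != 0 :> R by rewrite pnatr_eq0 -lt0n fact_gt0.
  rewrite exprS [(growth * _) ^+ _]exprMn exprVn; have : (growth ^+ j) ^+ size w != 0 by rewrite !expf_neq0.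
  have : growth ^+ size w != 0 by rewrite expf_neq0.
  move: (growth ^+ size w) ((growth ^+ j) ^+ size w) => a b a0 b0; field.
  by rewrite f0 f1 a0 b0.
rewrite exprS exprMn exprVn; have : ((2 : R) ^+ j) ^+ m != 0 by rewrite !expf_neq0 ?pnatr_eq0.
have : (2 : R) ^+ m != 0 by rewrite expf_neq0 ?pnatr_eq0.
by move: ((2 : R) ^+ m) (((2 : R) ^+ j) ^+ m) => a b a0 b0; field; rewrite a0 b0.
Qed.

Lemma jom_le j m : jom j m <= jom j.+1 m.
Proof.
rewrite -[leRHS]mul1r -ler_pdivrMr ?jom_gt0// jom_ratio.
have g0 := growth_gt0; have g2 := growth_ge2.
case: pickle_inv => [w|]; apply: exprn_ile1; rewrite ?invr_ge0 ?(ltW g0)// ?invf_le1//.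
  by apply: le_trans g2; rewrite ler1n.
by rewrite ler1n.
Qed.

Lemma half_sum K : \sum_(k < K) (2^-1 : R) ^+ k <= 2.
Proof.
have -> : \sum_(k < K) (2^-1 : R) ^+ k = 2 - 2 * 2^-1 ^+ K.
  elim: K => [|K ih]; first by rewrite big_ord0 expr0 mulr1 subrr.
  by rewrite big_ord_recr /= ih exprS; field.
by rewrite lerBlDr lerDl mulr_ge0 ?exprn_ge0.
Qed.

Lemma wsum_cst k (c : R) : wsum k (fun _ : seq 'I_n => c) = n%:R ^+ k * c.
Proof.
elim: k => [|k ih] /=; first by rewrite expr0 mul1r.
by under eq_bigr do rewrite ih; rewrite sumr_const card_ord exprS -[LHS]mulr_natl mulrA.
Qed.

Lemma growth_half k : n%:R ^+ k * growth^-1 ^+ k <= 2^-1 ^+ k :> R.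
Proof.
have g0 := growth_gt0; rewrite -exprMn lerXn2r ?nnegrE ?mulr_ge0 ?invr_ge0 ?(ltW g0)//.
rewrite ler_pdivrMr// /growth mulrA mulVf ?pnatr_eq0// mul1r ler_nat; exact: leqnSn.
Qed.

Lemma jom_sum j : exists K, forall M, \sum_(m < M) jom j m / jom j.+1 m <= K.
Proof.
(* One geometric series of ratio 1/2 over the integers that code no word, and one over the word
   lengths. *)
exists (2 + 2) => M; under eq_bigr do rewrite jom_ratio.
have g0 := growth_gt0.
pose sz m := if @pickle_inv (seq 'I_n) m is Some w then size w else 0%N.
pose K := (\max_(m < M) sz m).+1.
(* Marks the word coded by m, which allows the sum over codes to be exchanged with sums over all
   words of each length below K. *)
pose F m k (w : seq 'I_n) : R := (pickle w == m)%:R * growth^-1 ^+ k.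
have F0 m k w : 0 <= F m k w by rewrite mulr_ge0 ?exprn_ge0 ?invr_ge0 ?(ltW g0).
apply: (@le_trans _ _ (\sum_(m < M) (2^-1 ^+ m + \sum_(k < K) wsum k (F m k)))).
  apply: ler_sum => m _; case E : pickle_inv => [w|]; last first.
    by rewrite lerDl sumr_ge0// => k _; exact: wsum_ge0.
  have wK : (size w < K)%N by rewrite ltnS; apply: leq_trans (leq_bigmax m); rewrite /sz E.
  apply: (@le_trans _ _ (wsum (size w) (F m (size w)))).
    have := @ler_wsum_term R n (size w) (F m (size w)) w (F0 m _) erefl; apply: le_trans.
    have wm : pickle w = m by have := @pickle_invK (seq 'I_n) m; rewrite E.
    by rewrite /F wm eqxx mul1r.
  rewrite (bigD1 (Ordinal wK))//= addrCA lerDl addr_ge0 ?exprn_ge0// sumr_ge0// => k _.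
  exact: wsum_ge0.
rewrite big_split /=; apply: lerD; first exact: half_sum.
rewrite exchange_big /=; apply: le_trans (half_sum K); apply: ler_sum => k _.
rewrite -wsum_sum; apply: le_trans (growth_half k); rewrite -wsum_cst.
apply: ler_wsum => w _; rewrite /F -mulr_suml ler_piMl ?exprn_ge0 ?invr_ge0 ?(ltW g0)//.
have [wM|Mw] := ltnP (pickle w) M.
  rewrite (bigD1 (Ordinal wM))//= eqxx big1 ?addr0// => m /eqP mw.
  by case: eqP => // E; case: mw; apply: val_inj; rewrite /= E.
rewrite big1// => m _; case: eqP => // E; by have := ltn_ord m; rewrite -E ltnNge Mw.
Qed.

Lemma jlam_le j m phi Q : ebound r (growth ^+ j) (jet phi) Q -> jom j m * cabs (jlam m phi) <= Q.
Proof.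
move=> H; have g0 := growth_gt0; have Q0 : 0 <= Q by exact: taylor_bound_ge0 H.
rewrite /jom /jlam; case: pickle_inv => [w|]; last by rewrite cabs0 mulr0.
have c0 : 0 <= growth ^+ j by rewrite exprn_ge0// ltW.
have := taylor_bound_term w c0 H; rewrite normrM (ger0_norm (powR_ge0 _ _)) (ger0_norm (cabs_ge0 _)).
have f1 : 0 < (size w)`!%:R :> R by rewrite ltr0n fact_gt0.
rewrite -ler_pdivrMl// => /(le_trans _); apply.
by rewrite le_eqVlt; apply/orP; left; apply/eqP; ring.
Qed.

(** From suprema back to sums: raising the index divides the terms of length k by growth^k, which
    outweighs the number of words by 2^k, and 2 is the sum of the powers of 1/2. *)
Lemma jlam_ebound j phi eps : 0 <= eps ->
  (forall m, jom j.+1 m * cabs (jlam m phi) <= eps) -> ebound r (growth ^+ j) (jet phi) (2 * eps).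
Proof.
move=> e0 H K; have g0 := growth_gt0.
apply: le_trans (ler_wpM2r e0 (half_sum K)); rewrite mulr_suml; apply: ler_sum => k _.
apply: le_trans (ler_wpM2r e0 (growth_half k)).
apply: (@le_trans _ _ (wsum k (fun _ : seq 'I_n => growth^-1 ^+ k * eps))); last by rewrite wsum_cst mulrA.
rewrite -wsumZ.
apply: ler_wsum => w wk; have := H (pickle w); rewrite /jom /jlam pickleK_inv wk.
rewrite normrM (ger0_norm (powR_ge0 _ _)) (ger0_norm (cabs_ge0 _)) => h.
have gk : 0 <= growth^-1 ^+ k by rewrite exprn_ge0// invr_ge0 ltW.
apply: le_trans (ler_wpM2l gk h); rewrite exprS [(growth * _) ^+ _]exprMn exprVn.
have : growth ^+ k != 0 by rewrite expf_neq0// gt_eqF.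
have : k`!%:R != 0 :> R by rewrite pnatr_eq0 -lt0n fact_gt0.
move: (growth ^+ k) (k`!%:R : R) => a b b0 a0.
by rewrite le_eqVlt; apply/orP; left; apply/eqP; field; rewrite a0 b0.
Qed.

Lemma growth_unbounded c : exists j, c <= growth ^+ j.
Proof.
exists (Num.truncn c); apply: le_trans (ltW (truncnS_gt c)) _.
apply: (@le_trans _ _ (2 ^+ Num.truncn c)); first by rewrite -natrX ler_nat ltn_expl.
by rewrite lerXn2r ?nnegrE ?growth_ge2// ltW// growth_gt0.
Qed.

End JetSystem.

(** * The space of entire functions *)

Section EntireSpace.
Context (R : realType) (n : nat) (G : lieGroupType R n) (e : lie_basis G) (r : R).
Hypotheses (r0 : 0 <= r) (cG : connected [set: G]).
Local Notation jet phi := (fun w => lie_derives e w phi 1%g).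
Local Notation E := (lcspace (entire_submod e r) (entire_seminorm_on e r)).
Local Notation g_ := (growth R n).

Let c_ge0 j : 0 <= g_ ^+ j. Proof. by rewrite exprn_ge0// ltW// growth_gt0. Qed.

Let valE (x : E) : \val x \in entire e r. Proof. exact: valP. Qed.

Let valan (x : E) : analytic_fun (\val x). Proof. exact: entire_analytic (valE x). Qed.

Lemma entire_nbhsP (x : E) (A : set E) : nbhs x A <-> exists j eps, 0 < eps /\
  forall y : E, (forall m, jom n r j m * cabs (jlam e m (\val (y - x))) <= eps) -> A y.
Proof.
split=> [/lc_nbhsP[ss [d [d0 dA]]]|[j [d [d0 dA]]]].
  have [j Hj] : exists j, all (fun c : {nonneg R} => c%:num <= g_ ^+ j) ss.
    elim: ss {dA} => [|c ss [j Hj]]; first by exists 0%N.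
    have [k Hk] := growth_unbounded n c%:num; exists (maxn j k) => /=.
    have mono i : (i <= maxn j k)%N -> g_ ^+ i <= g_ ^+ maxn j k.
      by move=> ik; rewrite ler_eXn2l// (lt_le_trans _ (growth_ge2 R n))// ltr1n.
    rewrite (le_trans Hk (mono _ (leq_maxr _ _)))/=; apply: sub_all Hj => c' h.
    exact: le_trans h (mono _ (leq_maxl _ _)).
  (* The index j + 1 pays for the passage from suprema to sums in [jlam_ebound]; its factor 2
     together with d / 3 leaves room for the strict inequality. *)
  exists j.+1, (d / 3); split; first exact: divr_gt0.
  move=> y /(jlam_ebound (ltW (divr_gt0 d0 (ltr0n _ 3)))) H; apply: dA.
  apply: sub_all Hj => c cj; apply: (@le_lt_trans _ _ (2 * (d / 3))); last lra.
  apply: entire_seminorm_le; rewrite -GRing.valB; exact: taylor_boundW cj H.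
have N := @lc_nbhs1 R _ _ _ _ (entire_submod e r) (entire_seminorm_on e r) x (NngNum (c_ge0 j)) d d0.
apply: (@filterS _ (nbhs x) _ _ _ _ N) => y /= yx; apply: dA => m.
apply: jlam_le; apply: eboundW (ltW yx) _.
exact: (@entire_seminormP _ _ _ e r (NngNum (c_ge0 j)) _ (valE (y - x))).
Qed.

Lemma jlamZD m a (x y : E) : jlam e m (\val (a *: x + y)) = a * jlam e m (\val x) + jlam e m (\val y).
Proof.
rewrite GRing.valD GRing.valZ /jlam; case: pickle_inv => [w|]; last by rewrite mulr0 addr0.
by rewrite lie_derivesZD.
Qed.

Lemma jlamD m (x y : E) : jlam e m (\val (x + y)) = jlam e m (\val x) + jlam e m (\val y).
Proof. by have := jlamZD m 1 x y; rewrite scale1r mul1r. Qed.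

Lemma jlamZ m a (x : E) : jlam e m (\val (a *: x)) = a * jlam e m (\val x).
Proof.
have := jlamZD m a x 0; rewrite addr0 => ->; rewrite {2}/jlam; case: pickle_inv => [w|]; last by rewrite addr0.
by rewrite GRing.val0 lie_derives0 addr0.
Qed.

Lemma jlam_separated (x : E) : (forall m, jlam e m (\val x) = 0) -> x = 0.
Proof.
move=> H; apply: val_inj; rewrite GRing.val0; apply: (jet_eq0 (e := e) cG (valan x)) => w.
by have := H (pickle w); rewrite /jlam pickleK_inv.
Qed.

Lemma jlam_complete (x_ : nat -> E) :
  (forall j eps, 0 < eps -> exists N, forall i k, (N <= i)%N -> (N <= k)%N ->
     forall m, jom n r j m * cabs (jlam e m (\val (x_ i - x_ k))) <= eps) ->
  exists x : E, forall j eps, 0 < eps -> exists N, forall i, (N <= i)%N ->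
     forall m, jom n r j m * cabs (jlam e m (\val (x_ i - x))) <= eps.
Proof.
move=> xC; have [|c eps c0 e0|phi [phiE Hphi]] := @entire_complete _ _ _ e r r0 cG (fun i => \val (x_ i)).
- by move=> i; exact: valE.
- have [j cj] := growth_unbounded n c; have e2 : 0 < eps / 2 by rewrite divr_gt0.
  have [N hN] := xC j.+1 _ e2; exists N => i k Ni Nk.
  rewrite -jetB//; have := jlam_ebound (ltW e2) (hN i k Ni Nk).
  rewrite GRing.valB mulrC divfK// => h; exact: taylor_boundW cj h.
exists (exist (fun phi => phi \in entire e r) phi phiE) => j eps e0; have [N hN] := Hphi _ _ (c_ge0 j) e0.
have pa := entire_analytic phiE; exists N => i Ni m; apply: jlam_le.
by rewrite GRing.valB jetB//; exact: hN.
Qed.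

Definition entire_system : nuclear_system E :=
  NuclearSystem jlamD jlamZ (jom_gt0 n r) (jom_le n r) (jom_sum n r) entire_nbhsP jlam_complete jlam_separated.

Definition entire_mul (x y : E) : E :=
  exist (fun phi => phi \in entire e r) (fun g => \val x g * \val y g) (entireM r0 (valE x) (valE y)).

Lemma entire_seminorm_mul (c : {nonneg R}) (c' : {nonneg R}) (x y : E) : c'%:num = 2 `^ r * c%:num ->
  entire_seminorm e r c (\val (entire_mul x y)) <=
  entire_seminorm e r c' (\val x) * entire_seminorm e r c' (\val y).
Proof.
move=> cc; apply: entire_seminorm_le; apply: ebound_jetM => //; rewrite -cc; exact: entire_seminormP.
Qed.

Lemma entire_mul_linear x : linear (entire_mul x).
Proof. by move=> a y z; apply: val_inj; apply/funext => g /=; rewrite !fctE mulrDr mulrCA. Qed.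

Lemma entire_mul_linearl y : linear (entire_mul^~ y).
Proof. by move=> a x z; apply: val_inj; apply/funext => g /=; rewrite !fctE mulrDl -mulrA. Qed.

Lemma entire_mulA : associative entire_mul.
Proof. by move=> x y z; apply: val_inj; apply/funext => g /=; rewrite mulrA. Qed.

Lemma entire_mul_continuous : continuous (fun xy : E * E => entire_mul xy.1 xy.2).
Proof.
move=> [x y] A /lc_nbhsP[ss [d [d0 dA]]].
suff H : nbhs (x, y) [set xy : E * E |
    all (fun c => entire_seminorm e r c (\val (entire_mul xy.1 xy.2) - \val (entire_mul x y)) < d) ss].
  by apply: (@filterS _ (nbhs (x, y)) _ _ _ _ H) => xy; exact: dA.
elim: ss {dA} => [|c ss ih]; first exact: (@filterS _ (nbhs (x, y)) _ _ _ _ (@filterT _ (nbhs (x, y)) _)).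
have c0 : 0 <= 2 `^ r * c%:num by rewrite mulr_ge0 ?powR_ge0.
pose c' := NngNum c0; pose q (z : E) := entire_seminorm e r c' (\val z).
have q0 z : 0 <= q z by exact: taylor_bound_ge0 (entire_seminormP c' (valE z)).
pose M := q x + q y + 1; have M0 : 0 < M by rewrite ltr_wpDl ?addr_ge0.
(* If u, v < t <= 1 are the seminorms of the two increments, then u v + u q(y) + q(x) v <= t M <= d
   / 2. *)
pose t := Num.min 1 (d / (2 * M)).
have t0 : 0 < t by rewrite lt_min ltr01 divr_gt0// mulr_gt0.
have t1 : t <= 1 by rewrite ge_min lexx.
have tM : t * M <= d / 2.
  have : t <= d / (2 * M) by rewrite ge_min lexx orbT.
  rewrite -(ler_pM2r M0) => /le_trans; apply; rewrite le_eqVlt; apply/orP; left; apply/eqP; field.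
  by rewrite gt_eqF.
have N (z : E) : nbhs z [set z' : E | q (z' - z) < t].
  exact: (@lc_nbhs1 R _ _ _ _ (entire_submod e r) (entire_seminorm_on e r) z c' t t0).
have N2 : nbhs (x, y) [set xy : E * E | q (xy.1 - x) < t /\ q (xy.2 - y) < t].
  by exists ([set x' : E | q (x' - x) < t], [set y' : E | q (y' - y) < t]) => //=; split; exact: N.
apply: (@filterS _ (nbhs (x, y)) _ _ _ _ (filterI N2 ih)) => -[x' y'] [/= [x'x y'y] ->]; rewrite andbT.
have [sD _] := entire_seminorm_on e r c.
have mE (a b : E) : entire_seminorm e r c (\val (entire_mul a b)) <= q a * q b by exact: entire_seminorm_mul.
have -> : \val (entire_mul x' y') - \val (entire_mul x y) =
    \val (entire_mul (x' - x) (y' - y)) + (\val (entire_mul (x' - x) y) + \val (entire_mul x (y' - y))).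
  apply/funext => g; rewrite -[LHS]/(\val x' g * \val y' g - \val x g * \val y g).
  rewrite -[RHS]/((\val x' g - \val x g) * (\val y' g - \val y g) +
    ((\val x' g - \val x g) * \val y g + \val x g * (\val y' g - \val y g))).
  ring.
have SD := (entire_submod e r).2 1.
apply: (@le_lt_trans _ _ (q (x' - x) * q (y' - y) + (q (x' - x) * q y + q x * q (y' - y)))).
  have h3 : \val (entire_mul (x' - x) y) + \val (entire_mul x (y' - y)) \in entire e r.
    by have := SD _ _ (valE (entire_mul (x' - x) y)) (valE (entire_mul x (y' - y))); rewrite scale1r.
  apply: le_trans (sD _ _ (valE _) h3) _; apply: lerD; first exact: mE.
  by apply: le_trans (sD _ _ (valE _) (valE _)) _; apply: lerD; exact: mE.
have := q0 x; have := q0 y; have := q0 (x' - x); have := q0 (y' - y).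
move: (t) t0 t1 (tM : t * (q x + q y + 1) <= d / 2) x'x y'y.
move: (q x) (q y) (q (x' - x)) (q (y' - y)) => a b u v t' t'0 t'1 tM' ut vt v0 u0 b0 a0.
have : u * v <= t' by rewrite -[leRHS]mulr1 ler_pM// ltW// (lt_le_trans vt).
have : u * b <= t' * b by rewrite ler_wpM2r// ltW.
have : a * v <= a * t' by rewrite ler_wpM2l// ltW.
lra.
Qed.

End EntireSpace.

Theorem theorem4p18 (R : realType) (n : nat) (G : lieGroupType R n)
    (e : lie_basis G) (r : R) :
  connected [set: G] -> 0 <= r ->
  exists (hS : submod_closed (entire e r))
         (hq : forall c, seminorm_on (entire e r) (entire_seminorm e r c)),
  let E : tvsType R[i] := lcspace hS hq in
  exists mul : E -> E -> E,
  (forall (phi psi : E) (g : G),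
     \val (mul phi psi) g = \val phi g * \val psi g) /\
  [/\ frechet_algebra mul,
      nuclear_space E,
      montel E &
      separable E /\ reflexive_space E].

Proof.
move=> cG r0; exists (entire_submod e r), (entire_seminorm_on e r) => E.
pose s := entire_system e r0 cG; exists (entire_mul (e := e) r0); split=> //; split.
- split.
  (* The entourages of the space come from the neighbourhoods of 0 through differences, so the same
     U serves in both directions. *)
  + apply: (nuclear_system_frechet s) => A; split=> -[U [U0 UA]]; exists U; split=> // xy.
      by move=> Uxy; have := UA xy; rewrite !inE; apply.
    by rewrite !inE; exact: UA.
  + exact: entire_mulA.
  + exact: entire_mul_linear.
  + exact: entire_mul_linearl.
  + exact: entire_mul_continuous.
- exact: nuclear_system_nuclear s.
- exact: nuclear_system_montel s.
- by split; [exact: nuclear_system_separable s|exact: nuclear_system_reflexive s].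
Qed.
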